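(* Let $M$ be a finitely generated $\mathrm{II}_1$ factor and let $n$ be the minimal number of hermitian (self-adjoint) elements generating $M$ as a von Neumann algebra. Then $$n-1\leq 2\,\mathcal G(M)+1\leq n.$$
   Context: Let $M$ be a $\mathrm{II}_1$ factor with its faithful normal trace $\tau$, $\tau(1)=1$. Let $\mathcal P(M)$ be the collection of all finite sets of mutually orthogonal projections in $M$ which sum to $1$. For $x\in M$ and $P\in\mathcal P(M)$ put $\mathcal I(x;P)=\sum_{p,q\in P,\ pxq\neq 0}\tau(p)\tau(q)$. For a finite subset $X\subset M$ put $\mathcal I(X;P)=\sum_{x\in X}\mathcal I(x;P)$ and $\mathcal I(X)=\inf_{P\in\mathcal P(M)}\mathcal I(X;P)$. $W^*(X)$ denotes the von Neumann algebra generated by $X$ (not automatically assumed to contain the identity of $M$). The generator invariant is $\mathcal G(M)=\inf\{\mathcal I(X): X\subset M\text{ finite},\ W^*(X)=M\}$, with $\mathcal G(M)=\infty$ if $M$ is not finitely generated. *)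

(* Defs.v *)
From mathcomp Require Export all_boot all_order all_algebra.
From mathcomp Require Export sesquilinear complex.
From mathcomp Require Export all_classical all_reals all_analysis.

Set Implicit Arguments.
Unset Strict Implicit.
Unset Printing Implicit Defensive.

Import Order.TTheory GRing.Theory Num.Theory.
Import numFieldNormedType.Exports.

Local Open Scope classical_set_scope.
Local Open Scope ring_scope.

(* A complex Hilbert space is a complete normed space [H] over [R[i]] with an
   inner product [ip] (linear on the left, conjugate-linear on the right)
   inducing its norm.  Operators are plain functions [H -> H], so that [+], [*:]
   and [0] are pointwise, the product is [\o] and the unit is [idfun]. *)

Section VonNeumannAlgebras.
Context (R : realType) (H : completeNormedModType R[i])
        (ip : {dot H for Num.conj}).
Implicit Types (a b p x : H -> H) (A M X P : set (H -> H)).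

Definition hilbert_inner_product : Prop := forall v : H, ip v v = `|v| ^+ 2.

Definition bounded_op a : Prop := linear a /\ continuous a.

(* The default value 0 is never reached for bounded [a] on a Hilbert space, by
   the Riesz representation theorem. *)
Definition adj a : H -> H :=
  xget 0 [set b | bounded_op b /\ forall u v, ip (a u) v = ip u (b v)].

Definition selfadjoint a : Prop := bounded_op a /\ adj a = a.

Definition projection p : Prop := selfadjoint p /\ p \o p = p.

Definition op_le a b : Prop := forall v : H, 0 <= ip ((b - a) v) v.

(* Not necessarily unital. *)
Definition star_subalgebra A : Prop :=
  [/\ A `<=` bounded_op /\ A 0,
      forall a b, A a -> A b -> A (a + b),
      forall (c : R[i]) a, A a -> A (c *: a),
      forall a b, A a -> A b -> A (a \o b)
    & forall a, A a -> A (adj a)].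

(* Closed in the weak operator topology of the bounded operators. *)
Definition wot_closed A : Prop :=
  forall a, bounded_op a ->
    (forall (F : seq (H * H)) (e : R[i]), 0 < e ->
       exists2 b, A b & forall uv, uv \in F -> `|ip ((a - b) uv.1) uv.2| < e) ->
    A a.

Definition von_neumann_algebra M : Prop :=
  [/\ star_subalgebra M, wot_closed M & M idfun].

(* W^*(X); it need not contain [idfun]. *)
Definition generated_vna X : set (H -> H) :=
  smallest [set A | star_subalgebra A /\ wot_closed A] X.

Definition factor M : Prop :=
  [/\ von_neumann_algebra M,
      (idfun : H -> H) <> 0
    & forall a, M a -> (forall b, M b -> a \o b = b \o a) ->
        exists c : R[i], a = c *: (idfun : H -> H)].

Definition abelian_projection M p : Prop :=
  [/\ M p, projection p
    & forall a b, M a -> M b ->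
        (p \o a \o p) \o (p \o b \o p) = (p \o b \o p) \o (p \o a \o p)].

Definition finite_vna M : Prop :=
  forall v, M v -> adj v \o v = idfun -> v \o adj v = idfun.

Definition type_II1_factor M : Prop :=
  [/\ factor M,
      forall p, abelian_projection M p -> p = 0
    & finite_vna M].

(* Only the values of [tau] on [M] matter. *)
Definition normalized_trace M (tau : (H -> H) -> R[i]) : Prop :=
  [/\ forall a b, M a -> M b -> tau (a + b) = tau a + tau b,
      forall (c : R[i]) a, M a -> tau (c *: a) = c * tau a,
      forall a, M a -> 0 <= tau (adj a \o a),
      forall a b, M a -> M b -> tau (a \o b) = tau (b \o a)
    & tau idfun = 1].

Definition faithful_on M (tau : (H -> H) -> R[i]) : Prop :=
  forall a, M a -> tau (adj a \o a) = 0 -> a = 0.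

(* [tau] preserves suprema of bounded increasing nets of selfadjoint elements;
   such a net is represented by the upward directed set of its values. *)
Definition normal_on M (tau : (H -> H) -> R[i]) : Prop :=
  forall A x,
    A !=set0 -> A `<=` M `&` selfadjoint ->
    (forall a b, A a -> A b -> exists c, [/\ A c, op_le a c & op_le b c]) ->
    M x -> selfadjoint x ->
    (forall a, A a -> op_le a x) ->
    (forall y, M y -> selfadjoint y -> (forall a, A a -> op_le a y) ->
       op_le x y) ->
    complex.Re (tau x) = sup [set complex.Re (tau a) | a in A].

Definition faithful_normal_trace M (tau : (H -> H) -> R[i]) : Prop :=
  [/\ normalized_trace M tau, faithful_on M tau & normal_on M tau].

Definition projection_partition M P : Prop :=
  [/\ finite_set P,
      P `<=` M `&` projection,
      forall p q, P p -> P q -> p <> q -> p \o q = 0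
    & \sum_(p \in P) p = idfun].

Definition gen_cost1 (tau : (H -> H) -> R[i]) x P : R :=
  \sum_(pq \in [set pq | [/\ P pq.1, P pq.2 & pq.1 \o x \o pq.2 <> 0]])
     complex.Re (tau pq.1) * complex.Re (tau pq.2).

Definition gen_cost_at (tau : (H -> H) -> R[i]) X P : R :=
  \sum_(x \in X) gen_cost1 tau x P.

Definition gen_cost M (tau : (H -> H) -> R[i]) X : R :=
  inf [set gen_cost_at tau X P | P in projection_partition M].

Definition finite_generating_set M X : Prop :=
  [/\ finite_set X, X `<=` M & generated_vna X = M].

Definition finitely_generated M : Prop := exists X, finite_generating_set M X.

(* The infimum of the empty set is [+oo]. *)
Definition generator_invariant M (tau : (H -> H) -> R[i]) : \bar R :=
  ereal_inf [set (gen_cost M tau X)%:E | X in finite_generating_set M].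

Definition generated_by_selfadjoints M (n : nat) : Prop :=
  exists x : 'I_n -> H -> H,
    (forall i, M (x i) /\ selfadjoint (x i)) /\ generated_vna (range x) = M.

Definition min_selfadjoint_generators M (n : nat) : Prop :=
  generated_by_selfadjoints M n /\
  forall m, generated_by_selfadjoints M m -> (n <= m)%N.

End VonNeumannAlgebras.

(* Main.v *)
From HB Require Import structures.
Require Import Defs.
From mathcomp Require Import ring lra.

(* Upper bound: let [x_0, ..., x_(n-1)] be hermitian generators.  The relative
   commutant of [x_0] is diffuse, so some partition [P] into projections of
   trace at most [d] commutes with [x_0].  Replacing each other [x_i] by its
   upper triangular part with respect to [P] and adding [P] to the generators
   gives a generating set of cost at most [2 d + (n - 1) (1 + d) / 2].

   Lower bound: suppose that [X] generates with cost less than [m / 2] with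
   respect to [P].  Cut [P] into copies of a projection [e] of small trace [d],
   leaving few smaller remainders.  The cost bound says that less than half of
   the [m / d ^ 2] blocks of [m] matrices are needed to store the nonzero blocks
   of the elements of [X], so they all fit, together with one row of partial
   isometries, strictly above the diagonals of [m] hermitian operators; one more
   hermitian diagonal operator recovers the projections. *)

Set Implicit Arguments.
Unset Strict Implicit.
Unset Printing Implicit Defensive.

Import Order.TTheory GRing.Theory Num.Theory.
Import numFieldNormedType.Exports.

Local Open Scope classical_set_scope.
Local Open Scope complex_scope.
Local Open Scope ring_scope.

Local Notation Re := complex.Re.
Local Notation Im := complex.Im.

(** * The real inner product *)

Section InnerProduct.
Context (R : realType) (H : completeNormedModType R[i])
        (ip : {dot H for Num.conj}).
Context (hip : hilbert_inner_product ip).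

(** The factor one half has the same origin in both bounds: a hermitian matrix over [N] pieces of
    trace [1 / N] is determined by its upper triangle, about [N ^ 2 / 2] blocks, while a cost [c]
    stands for about [c N ^ 2] nonzero blocks. The upper bound saves one generator because [x_0]
    becomes block diagonal and costs nothing in the limit; the lower bound pays one for the diagonal
    operator.

    The traces of the projections in [P] need not be commensurable, which forces remainders. There
    is at most one for each member of [P], whatever the size of [e], so they disturb the counts only
    in order [1 / d], and the strict inequality on the cost absorbs this once [d] is small.

    The operator theory rests on strong limits of sequences alone: square roots come from an
    iteration, kernel projections from powers, spectral projections from kernels. Maximal
    projections and partial isometries are limits of sequences whose trace grows greedily, so
    normality of the trace is used only along increasing sequences of projections. *)

Definition nrm (v : H) : R := Re `|v|.
Definition re_ip (u v : H) : R := Re (ip u v).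
Local Notation rip := re_ip.

Lemma nrmE (v : H) : `|v| = (nrm v)%:C.
Proof. by rewrite RRe_real // ger0_real. Qed.

Lemma ReD (x y : R[i]) : Re (x + y) = Re x + Re y.
Proof. by case: x; case: y. Qed.
Lemma ReN (x : R[i]) : Re (- x) = - Re x.
Proof. by case: x. Qed.
Lemma ReZ (c : R) (x : R[i]) : Re (c%:C * x) = c * Re x.
Proof. by case: x => a b /=; rewrite mul0r subr0. Qed.

Lemma nrm_ge0 v : 0 <= nrm v.
Proof. by rewrite -lecR -nrmE normr_ge0. Qed.
Lemma nrmD u v : nrm (u + v) <= nrm u + nrm v.
Proof. by rewrite -lecR rmorphD /= -!nrmE ler_normD. Qed.
Lemma nrmN v : nrm (- v) = nrm v.
Proof. by rewrite /nrm normrN. Qed.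
Lemma nrmB u v : nrm (u - v) = nrm (v - u).
Proof. by rewrite -nrmN opprB. Qed.
Lemma nrmZ (c : R[i]) v : nrm (c *: v) = Re `|c| * nrm v.
Proof.
by apply: complexI; rewrite -nrmE normrZ nrmE rmorphM /= RRe_real // ger0_real.
Qed.
Lemma nrm_eq0 v : nrm v = 0 -> v = 0.
Proof. by move=> h; apply/eqP; rewrite -normr_eq0 nrmE h. Qed.
Lemma nrm0 : nrm 0 = 0.
Proof. by rewrite /nrm normr0. Qed.

Lemma ripDl u v w : rip (u + v) w = rip u w + rip v w.
Proof. by rewrite /re_ip linearDl /= ReD. Qed.
Lemma ripDr u v w : rip w (u + v) = rip w u + rip w v.
Proof. by rewrite /re_ip linearDr /= ReD. Qed.
Lemma ripNl u v : rip (- u) v = - rip u v.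
Proof. by rewrite /re_ip linearNl /= ReN. Qed.
Lemma ripNr u v : rip u (- v) = - rip u v.
Proof. by rewrite /re_ip linearNr /= ReN. Qed.
Lemma ripBl u v w : rip (u - v) w = rip u w - rip v w.
Proof. by rewrite ripDl ripNl. Qed.
Lemma ripBr u v w : rip w (u - v) = rip w u - rip w v.
Proof. by rewrite ripDr ripNr. Qed.
Lemma ipC u v : ip u v = (ip v u)^*%C.
Proof. by rewrite (@hermitian_subproof _ _ _ _ ip) expr0 mul1r. Qed.
Lemma ripC u v : rip u v = rip v u.
Proof. by rewrite /re_ip ipC; case: (ip v u). Qed.
Lemma ripZl (c : R) u v : rip (c%:C *: u) v = c * rip u v.
Proof. by rewrite /re_ip linearZl_LR /= ReZ. Qed.
Lemma ripZr (c : R) u v : rip u (c%:C *: v) = c * rip u v.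
Proof. by rewrite ripC ripZl ripC. Qed.
Lemma rip_nrm v : rip v v = nrm v ^+ 2.
Proof. by rewrite /re_ip hip nrmE -rmorphXn. Qed.
Lemma rip0l v : rip 0 v = 0.
Proof. by rewrite /re_ip linear0l. Qed.
Lemma rip0r v : rip v 0 = 0.
Proof. by rewrite ripC rip0l. Qed.

Lemma ipE u v : ip u v = rip u v +i* rip u ('i%C *: v).
Proof.
rewrite /re_ip linearZr_LR /=; case: (ip u v) => a b /=.
by congr (_ +i* _); ring.
Qed.

Lemma nrmD_sq u v : nrm (u + v) ^+ 2 = nrm u ^+ 2 + nrm v ^+ 2 + 2 * rip u v.
Proof. by rewrite -!rip_nrm ripDl !ripDr (ripC v u); ring. Qed.
Lemma nrmB_sq u v : nrm (u - v) ^+ 2 = nrm u ^+ 2 + nrm v ^+ 2 - 2 * rip u v.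
Proof. by rewrite nrmD_sq nrmN ripNr; ring. Qed.

Lemma nrmZr (c : R) v : 0 <= c -> nrm (c%:C *: v) = c * nrm v.
Proof. by move=> c0; rewrite nrmZ ger0_norm ?lecR. Qed.

(** Cauchy-Schwarz, from expanding the squared norm of [|v| u - |u| v]. *)
Lemma rip_le u v : rip u v <= nrm u * nrm v.
Proof.
have [u0|u0] := eqVneq (nrm u) 0; first by rewrite (nrm_eq0 u0) rip0l nrm0 mul0r.
have [v0|v0] := eqVneq (nrm v) 0; first by rewrite (nrm_eq0 v0) rip0r nrm0 mulr0.
have up : 0 < nrm u by rewrite lt_def u0 nrm_ge0.
have vp : 0 < nrm v by rewrite lt_def v0 nrm_ge0.
have := sqr_ge0 (nrm ((nrm v)%:C *: u - (nrm u)%:C *: v)).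
rewrite nrmB_sq !nrmZr ?nrm_ge0 // ripZl ripZr => h.
rewrite -(ler_pM2l up) -(ler_pM2l vp); nra.
Qed.

Lemma rip_le_norm u v : `|rip u v| <= nrm u * nrm v.
Proof. by rewrite ler_norml rip_le lerNl -ripNl (le_trans (rip_le _ _)) ?nrmN. Qed.

Lemma rip_ext u v : (forall w, rip u w = rip v w) -> u = v.
Proof.
move=> h; apply/eqP; rewrite -subr_eq0; apply/eqP/nrm_eq0/eqP.
by rewrite -sqrf_eq0 -rip_nrm ripBl h subrr.
Qed.

Lemma norm_Im (z : R[i]) : Re `|z| <= `|Re z| + `|Im z|.
Proof.
have := ler_normD ((Re z)%:C : R[i]) ('i%C * (Im z)%:C).
rewrite -complexE normrM complexiE normCi mul1r !normc_def /= => h.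
rewrite lecE in h; case/andP: h => _ /=.
by rewrite !expr0n !addr0 !sqrtr_sqr.
Qed.

Definition converges (u : nat -> H) (l : H) : Prop :=
  forall e : R, 0 < e -> exists N, forall n, (N <= n)%N -> nrm (u n - l) < e.

Lemma converges_cauchy (u : nat -> H) :
  (forall e : R, 0 < e -> exists N, forall n m, (N <= n)%N -> (N <= m)%N ->
    nrm (u n - u m) < e) -> exists l, converges u l.
Proof.
move=> hu.
have /cauchy_cvgP cu : cauchy (u @ \oo).
  apply: cauchy_exP => e e0.
  have er : e = (Re e)%:C by rewrite RRe_real // gtr0_real.
  have [|N hN] := hu (Re e); first by rewrite -ltcR -er.
  exists (u N); exists N => // n /= Nn.
  rewrite -ball_normE /ball_ /=.
  by rewrite nrmE er ltcR hN.
exists (lim (u @ \oo)) => e e0.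
have e0' : (0 : R[i]) < e%:C by rewrite ltcR.
have [N _ hN] := (@cvgrPdist_lt _ _ _ _ _ u (lim (u @ \oo))).1 cu e%:C e0'.
by exists N => n /hN /=; rewrite nrmE ltcR nrmB.
Qed.

Lemma converges_uniq u l l' : converges u l -> converges u l' -> l = l'.
Proof.
move=> h h'; apply/eqP; rewrite -subr_eq0; apply/eqP/nrm_eq0/eqP.
rewrite eq_le nrm_ge0 andbT leNgt; apply/negP => d0.
have d2 : 0 < nrm (l - l') / 2 by lra.
have [N hN] := h _ d2; have [N' hN'] := h' _ d2.
have := hN (maxn N N') (leq_maxl _ _); have := hN' (maxn N N') (leq_maxr _ _).
set n := maxn _ _; have := nrmD (l - u n) (u n - l').
by rewrite subrKA (nrmB l (u n)); lra.
Qed.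

Lemma converges_cst l : converges (fun=> l) l.
Proof. by move=> e e0; exists 0%N => n _; rewrite subrr nrm0. Qed.

Lemma convergesD u v l l' : converges u l -> converges v l' ->
  converges (fun n => u n + v n) (l + l').
Proof.
move=> h h' e e0; have d2 : 0 < e / 2 by lra.
have [N hN] := h _ d2; have [N' hN'] := h' _ d2.
exists (maxn N N') => n; rewrite geq_max => /andP[/hN a /hN' b].
rewrite opprD addrACA; have := nrmD (u n - l) (v n - l'); lra.
Qed.

Lemma converges_bound (C : R) u l (v : nat -> H) l' : 0 <= C ->
  (forall n, nrm (v n - l') <= C * nrm (u n - l)) ->
  converges u l -> converges v l'.
Proof.
move=> C0 hC h e e0.
have C1 : 0 < C + 1 by lra.
have [|N hN] := h (e / (C + 1)); first by rewrite divr_gt0.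
exists N => n /hN hn; apply: le_lt_trans (hC n) _.
rewrite ltr_pdivlMr // in hn.
by have := nrm_ge0 (u n - l); nra.
Qed.

Lemma converges_rip u l w : converges u l ->
  forall e : R, 0 < e -> exists N, forall n, (N <= n)%N ->
  `|rip (u n) w - rip l w| < e.
Proof.
move=> h e e0.
have w1 : 0 < nrm w + 1 by have := nrm_ge0 w; lra.
have [|N hN] := h (e / (nrm w + 1)); first by rewrite divr_gt0.
exists N => n /hN hn; rewrite -ripBl; apply: le_lt_trans (rip_le_norm _ _) _.
rewrite ltr_pdivlMr // in hn.
by have := nrm_ge0 (u n - l); nra.
Qed.

Lemma converges_rip_le u l w (c : R) : converges u l ->
  (exists N, forall n, (N <= n)%N -> rip (u n) w <= c) -> rip l w <= c.
Proof.
move=> h [N0 hc]; rewrite leNgt; apply/negP => lc.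
have [|N hN] := converges_rip w h (e := rip l w - c); first by lra.
have := hN (maxn N0 N) (leq_maxr _ _); have := hc (maxn N0 N) (leq_maxl _ _).
by rewrite ltr_norml => ? /andP[]; lra.
Qed.

Lemma converges_rip_ge u l w (c : R) : converges u l ->
  (exists N, forall n, (N <= n)%N -> c <= rip (u n) w) -> c <= rip l w.
Proof.
move=> h [N hN]; rewrite -lerN2 -ripNr.
apply: converges_rip_le h _; exists N => n /hN ?.
by rewrite ripNr lerN2.
Qed.

Lemma converges_nrm_le u l (c : R) : converges u l ->
  (forall n, nrm (u n) <= c) -> nrm l <= c.
Proof.
move=> h hc; rewrite leNgt; apply/negP => lc.
have [|N hN] := h (nrm l - c); first by lra.
have := hN N (leqnn _); have := hc N; have := nrmD (l - u N) (u N).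
by rewrite subrK nrmB; lra.
Qed.

End InnerProduct.

(** * Bounded operators and adjoints *)

Section BoundedOperators.
Context (R : realType) (H : completeNormedModType R[i]).

Lemma bounded_opP (a : H -> H) :
  bounded_op a <->
  linear a /\ exists2 C : R, 0 <= C & forall v, nrm (a v) <= C * nrm v.
Proof.
split=> -[la]; last first.
  case=> C C0 hC; split=> // v; apply/(@cvgrPdist_lt _ _ _ (nbhs v)) => e e0.
  have er : e = (Re e)%:C by rewrite RRe_real // gtr0_real.
  have re0 : 0 < Re e by rewrite -ltcR -er.
  have C1 : 0 < C + 1 by lra.
  apply/nbhs_ballP; exists (Re e / (C + 1))%:C; first by rewrite /= ltcR divr_gt0.
  move=> u; rewrite -ball_normE /ball_ /= nrmE ltcR ltr_pdivlMr // => vu.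
  have -> : a v - a u = a (v - u).
    by have := la (-1) u v; rewrite !scaleN1r => h; rewrite addrC -h addrC.
  rewrite nrmE er ltcR; apply: le_lt_trans (hC _) _.
  by have := nrm_ge0 (v - u); nra.
have a0 : a 0 = 0 by have := la 1 0 0; rewrite !scale1r addr0 => /esym/eqP;
  rewrite -subr_eq0 addrK => /eqP.
have aZ c v : a (c *: v) = c *: a v by have := la c v 0; rewrite a0 !addr0.
move=> /(_ 0) ca.
have /(@cvgrPdist_lt _ _ _ (nbhs 0)) /(_ 1 ltr01) := ca.
move=> /nbhs_ballP[d /= d0 hd]; split=> //.
have dr : d = (Re d)%:C by rewrite RRe_real // gtr0_real.
have rd0 : 0 < Re d by rewrite -ltcR -dr.
exists (2 / Re d); first by rewrite divr_ge0 // ltW.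
move=> v; have [/nrm_eq0 ->|v0] := eqVneq (nrm v) 0; first by rewrite a0 nrm0 mulr0.
have vp : 0 < nrm v by rewrite lt_def v0 nrm_ge0.
(* Rescaling [v] to norm [d / 2] puts it in the ball on which [a] has norm less than 1; hence the
   bound [2 / d]. *)
have cp : 0 < Re d / (2 * nrm v) by rewrite divr_gt0 // mulr_gt0.
have /hd /= : ball (0 : H) d ((Re d / (2 * nrm v))%:C *: v).
  rewrite -ball_normE /ball_ /= sub0r normrN nrmE nrmZr ?(ltW cp) // {2}dr ltcR.
  have -> : Re d / (2 * nrm v) * nrm v = Re d / 2 by field.
  lra.
rewrite a0 sub0r normrN nrmE aZ nrmZr ?(ltW cp) // (_ : 1 = 1%:C :> R[i]) // ltcR => h.
rewrite -(ler_pM2l cp).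
have -> : Re d / (2 * nrm v) * (2 / Re d * nrm v) = 1.
  by field; rewrite v0 gt_eqF.
exact: ltW.
Qed.

(** Bundling makes composition a ring product: on bare functions [\o] does not distribute over a sum
    on its right. *)
Record bop := Bop {bopf :> H -> H; bopP : bounded_op bopf}.

Lemma bop_ext (a b : bop) : (forall v, a v = b v) -> a = b.
Proof.
case: a b => [a ha] [b hb] /= /funext ab; subst b.
by rewrite (Prop_irrelevance ha hb).
Qed.

HB.instance Definition _ := gen_eqMixin bop.
HB.instance Definition _ := gen_choiceMixin bop.

Lemma bop_linear (a : bop) : linear a.
Proof. by case: (bopP a). Qed.

Lemma bop_bound (a : bop) : exists2 C : R, 0 <= C & forall v, nrm (a v) <= C * nrm v.
Proof. by case: a => a /= /bounded_opP[]. Qed.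

Lemma bop0v (a : bop) : a 0 = 0.
Proof.
have := bop_linear a 1 0 0; rewrite !scale1r addr0 => /esym/eqP.
by rewrite -subr_eq0 addrK => /eqP.
Qed.
Lemma bopZv (a : bop) c v : a (c *: v) = c *: a v.
Proof. by have := bop_linear a c v 0; rewrite bop0v !addr0. Qed.
Lemma bopDv (a : bop) u v : a (u + v) = a u + a v.
Proof. by have := bop_linear a 1 u v; rewrite !scale1r. Qed.
Lemma bopNv (a : bop) v : a (- v) = - a v.
Proof. by rewrite -scaleN1r bopZv scaleN1r. Qed.
Lemma bopBv (a : bop) u v : a (u - v) = a u - a v.
Proof. by rewrite bopDv bopNv. Qed.

Lemma bounded_op0 : bounded_op (0 : H -> H).
Proof.
apply/bounded_opP; split=> [c u v|]; first by rewrite /= scaler0 addr0.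
by exists 0 => // v; rewrite nrm0 mul0r.
Qed.
Lemma bounded_op1 : bounded_op (idfun : H -> H).
Proof. by apply/bounded_opP; split=> //; exists 1 => // v; rewrite mul1r. Qed.
Lemma bounded_opD (a b : bop) : bounded_op ((a : H -> H) + (b : H -> H)).
Proof.
have [C C0 hC] := bop_bound a; have [D D0 hD] := bop_bound b.
apply/bounded_opP; split=> [c u v|].
  by rewrite !fctE !bop_linear scalerDr addrACA.
exists (C + D); first by apply: addr_ge0.
by move=> v; rewrite mulrDl; apply: le_trans (nrmD _ _) _; apply: lerD.
Qed.
Lemma bounded_opZ (c : R[i]) (a : bop) : bounded_op (c *: (a : H -> H)).
Proof.
have [C C0 hC] := bop_bound a.
apply/bounded_opP; split=> [d u v|].
  by rewrite !fctE /= bop_linear scalerDr !scalerA mulrC.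
exists (Re `|c| * C).
  by apply: mulr_ge0 => //; rewrite normc_def sqrtr_ge0.
move=> v; rewrite fctE /= nrmZ -mulrA ler_wpM2l //.
by rewrite normc_def sqrtr_ge0.
Qed.
Lemma bounded_opM (a b : bop) : bounded_op ((a : H -> H) \o b).
Proof.
have [C C0 hC] := bop_bound a; have [D D0 hD] := bop_bound b.
apply/bounded_opP; split=> [c u v|]; first by rewrite /= !bop_linear.
exists (C * D); first by apply: mulr_ge0.
by move=> v /=; rewrite (le_trans (hC _)) // -mulrA ler_wpM2l.
Qed.

Definition bop_add (a b : bop) := Bop (bounded_opD a b).
Definition bop_scale (c : R[i]) (a : bop) := Bop (bounded_opZ c a).
Definition bop_zero := Bop bounded_op0.
Definition bop_one := Bop bounded_op1.
Definition bop_mul (a b : bop) := Bop (bounded_opM a b).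

Lemma bop_addA : associative bop_add.
Proof. by move=> a b c; apply: bop_ext => v; rewrite /= !fctE /= addrA. Qed.
Lemma bop_addC : commutative bop_add.
Proof. by move=> a b; apply: bop_ext => v; rewrite /= !fctE /= addrC. Qed.
Lemma bop_add0 : left_id bop_zero bop_add.
Proof. by move=> a; apply: bop_ext => v; rewrite /= !fctE /= add0r. Qed.
Lemma bop_addN : left_inverse bop_zero (bop_scale (-1)) bop_add.
Proof. by move=> a; apply: bop_ext => v; rewrite /= !fctE /= scaleN1r addNr. Qed.
HB.instance Definition _ :=
  GRing.isZmodule.Build bop bop_addA bop_addC bop_add0 bop_addN.

Lemma bop_mulA : associative bop_mul.
Proof. by move=> a b c; apply: bop_ext. Qed.
Lemma bop_mul1 : left_id bop_one bop_mul.
Proof. by move=> a; apply: bop_ext. Qed.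
Lemma bop_mulr1 : right_id bop_one bop_mul.
Proof. by move=> a; apply: bop_ext. Qed.
Lemma bop_mulDl : left_distributive bop_mul +%R.
Proof. by move=> a b c; apply: bop_ext. Qed.
Lemma bop_mulDr : right_distributive bop_mul +%R.
Proof. by move=> a b c; apply: bop_ext => v; rewrite /= !fctE /= bopDv. Qed.
HB.instance Definition _ :=
  GRing.Zmodule_isPzRing.Build bop bop_mulA bop_mul1 bop_mulr1 bop_mulDl bop_mulDr.

Lemma bop_scaleA (c d : R[i]) (a : bop) :
  bop_scale c (bop_scale d a) = bop_scale (c * d) a.
Proof. by apply: bop_ext => v; rewrite /= !fctE /= scalerA. Qed.
Lemma bop_scale1 : left_id 1 bop_scale.
Proof. by move=> a; apply: bop_ext => v; rewrite /= !fctE /= scale1r. Qed.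
Lemma bop_scaleDr : right_distributive bop_scale +%R.
Proof. by move=> c a b; apply: bop_ext => v; rewrite /= !fctE /= scalerDr. Qed.
Lemma bop_scaleDl a : {morph bop_scale^~ a : c d / c + d}.
Proof. by move=> c d; apply: bop_ext => v; rewrite /= !fctE /= scalerDl. Qed.
HB.instance Definition _ :=
  GRing.Zmodule_isLmodule.Build R[i] bop bop_scaleA bop_scale1 bop_scaleDr bop_scaleDl.

Lemma bop_scaleAl (c : R[i]) (a b : bop) : c *: (a * b) = c *: a * b.
Proof. by apply: bop_ext. Qed.
Lemma bop_scaleAr (c : R[i]) (a b : bop) : c *: (a * b) = a * (c *: b).
Proof. by apply: bop_ext => v; rewrite /= !fctE /= bopZv. Qed.


Lemma bopDE (a b : bop) v : (a + b) v = a v + b v. Proof. by []. Qed.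
Lemma bopZE c (a : bop) v : (c *: a) v = c *: a v. Proof. by []. Qed.
Lemma bopNE (a : bop) v : (- a) v = - a v.
Proof. by rewrite -scaleN1r bopZE scaleN1r. Qed.
Lemma bopBE (a b : bop) v : (a - b) v = a v - b v.
Proof. by rewrite bopDE bopNE. Qed.
Lemma bopME (a b : bop) v : (a * b) v = a (b v). Proof. by []. Qed.
Lemma bop1E v : (1 : bop) v = v. Proof. by []. Qed.
Lemma bop0E v : (0 : bop) v = 0. Proof. by []. Qed.

End BoundedOperators.

Section Adjoint.
Context (R : realType) (H : completeNormedModType R[i])
        (ip : {dot H for Num.conj}).
Context (hip : hilbert_inner_product ip).
Local Notation rip := (re_ip ip).

(* A minimizing sequence of [nrm u ^+ 2 - 2 * f u] is Cauchy by the
   parallelogram law, and its limit represents [f]. *)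
Lemma riesz (f : H -> R) (C : R) :
  (forall u v, f (u + v) = f u + f v) ->
  (forall (c : R) u, f (c%:C *: u) = c * f u) ->
  (forall u, f u <= C * nrm u) -> exists w, forall u, f u = rip u w.
Proof.
move=> fD fZ fC; pose J u := nrm u ^+ 2 - 2 * f u.
pose S := [set J u | u in setT].
have Jge u : - C ^+ 2 <= J u.
  by have := fC u; have := sqr_ge0 (nrm u - C); rewrite /J; nra.
have S0 : has_inf S.
  split; first by exists (J 0), 0.
  by exists (- C ^+ 2) => _ [u _ <-].
pose m := inf S.
have mJ u : m <= J u by apply: ge_inf; [exact: S0.2 | exists u].
have /choice[x hx] (n : nat) : exists u, J u < m + n.+1%:R^-1.
  have n0 : 0 < n.+1%:R^-1 :> R by rewrite invr_gt0.
  have [_ [u _ <-] h] := inf_adherent n0 S0.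
  by exists u.
have par u v : nrm (u - v) ^+ 2 <= 2 * (J u - m) + 2 * (J v - m).
  have := mJ ((2^-1)%:C *: (u + v)); rewrite /J nrmZr ?invr_ge0 // fZ fD.
  by rewrite exprMn (nrmD_sq hip) (nrmB_sq hip); nra.
have small (e : R) : 0 < e -> exists N, forall n, (N <= n)%N -> n.+1%:R^-1 < e.
  move=> e0; have [N _ hN] := near_infty_natSinv_lt (PosNum e0).
  by exists N => n /hN.
have [e e0|w hw] := converges_cauchy (u := x).
  have [|N hN] := small (e ^+ 2 / 4); first by rewrite divr_gt0 // exprn_gt0.
  exists N => n k /hN hn /hN hk.
  rewrite -(ltr_pXn2r (n := 2)) ?nnegrE ?nrm_ge0 ?(ltW e0) //.
  apply: le_lt_trans (par _ _) _; move: (hx n) (hx k) hn hk.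
  by move: n.+1%:R^-1 k.+1%:R^-1 => *; lra.
exists w => u; apply/eqP; rewrite -subr_eq0; apply/negPn/negP => D0.
pose D := rip w u - f u; pose N := nrm u ^+ 2.
have D0' : D != 0 by rewrite /D ripC -oppr_eq0 opprB.
have N0 : 0 <= N by rewrite sqr_ge0.
have N1 : 0 < N + 1 by apply: ltr_wpDl.
have N1' : N + 1 != 0 by rewrite gt_eqF.
(* Moving from the limit [w] to [w + t u] would lower the functional by [k > 0]; along the sequence
   this falls below the infimum [m]. The [+ 1] in the denominator covers [u = 0]. *)
pose t := - D / (N + 1); pose k := - (2 * t * D + t ^+ 2 * N).
have k0 : 0 < k.
  have -> : k = D ^+ 2 * (N + 2) / (N + 1) ^+ 2 by rewrite /k /t; field.
  by rewrite divr_gt0 ?exprn_gt0 // mulr_gt0 ?exprn_even_gt0 ?ltr_wpDl.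
have [K1 h1] := small (k / 2) (divr_gt0 k0 (ltr0n _ 2)).
have t1 : 0 < `|2 * t| + 1 by have := normr_ge0 (2 * t); lra.
have [|K2 h2] := converges_rip hip u hw (e := k / 2 / (`|2 * t| + 1)).
  by rewrite !divr_gt0.
pose n := maxn K1 K2.
have {h1} := h1 n (leq_maxl _ _); have {h2} := h2 n (leq_maxr _ _).
rewrite ltr_pdivlMr // => h2 h1.
have := mJ (x n + t%:C *: u).
rewrite /J (nrmD_sq hip) fD fZ ripZr.
have -> : nrm (t%:C *: u) ^+ 2 = t ^+ 2 * N by rewrite -!(rip_nrm hip) ripZl ripZr (rip_nrm hip) -/N; ring.
have h3 : 2 * t * (rip (x n) u - rip w u) < k / 2.
  apply: le_lt_trans (ler_norm _) _; rewrite normrM.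
  by have := normr_ge0 (rip (x n) u - rip w u); nra.
have := hx n; rewrite /J; move: h3 h1; rewrite /k /D.
clearbody t N m; move: n.+1%:R^-1 => *; lra.
Qed.

Definition is_adj (a b : bop H) := forall u v, rip (a u) v = rip u (b v).

(** The imaginary parts agree as well because [b] commutes with multiplication by ['i]; from here on
    adjoints are tested on real parts. *)
Lemma is_adjP (a b : bop H) :
  is_adj a b <-> forall u v, ip (a u) v = ip u (b v).
Proof.
split=> h u v; last by rewrite /re_ip h.
rewrite ipE (ipE _ u); congr (_ +i* _); first exact: h.
by rewrite h bopZv.
Qed.

Lemma is_adj_ex (a : bop H) : exists b, is_adj a b.
Proof.
have [C C0 hC] := bop_bound a.
have /choice[b hb] (v : H) : exists w, forall u, rip (a u) v = rip u w.
  apply: (@riesz (fun u => rip (a u) v) (C * nrm v)) => [u w|c u|u].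
  - by rewrite bopDv ripDl.
  - by rewrite bopZv ripZl.
  - rewrite (le_trans (rip_le hip _ _)) // mulrAC ler_wpM2r //; exact: nrm_ge0.
have hb' u v : ip (a u) v = ip u (b v).
  rewrite ipC (ipC _ u) !ipE; congr (conjc _); congr (_ +i* _).
    by rewrite !(ripC _ _ u) ripC.
  by rewrite ripC -bopZv hb ripC.
have bb : bounded_op b.
  apply/bounded_opP; split=> [c u v|].
    apply: (rip_ext hip) => w; rewrite ripC [RHS]ripC /re_ip.
    by rewrite -hb' !linearDr /= !linearZr_LR /= !hb'.
  exists C => // v; have [/nrm_eq0 ->|v0] := eqVneq (nrm (b v)) 0.
    by rewrite nrm0 mulr_ge0 // nrm_ge0.
  have vp : 0 < nrm (b v) by rewrite lt_def v0 nrm_ge0.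
  rewrite -(ler_pM2l vp) -expr2 -(rip_nrm hip) -hb (le_trans (rip_le hip _ _)) //.
  by rewrite mulrA ler_wpM2r ?nrm_ge0 // mulrC.
by exists (Bop bb) => u v; rewrite hb.
Qed.

Definition star (a : bop H) : bop H := projT1 (cid (is_adj_ex a)).
Local Notation "a ^*" := (star a) : ring_scope.
Local Open Scope ring_scope.

Lemma starP (a : bop H) u v : rip (a u) v = rip u (a^* v).
Proof. exact: projT2 (cid (is_adj_ex a)) u v. Qed.

Lemma star_uniq (a b : bop H) : is_adj a b -> a^* = b.
Proof.
move=> h; apply: bop_ext => v; apply: (rip_ext hip) => w.
by rewrite ripC -starP h ripC.
Qed.

Lemma adj_star (a : bop H) : adj ip a = a^*.
Proof.
rewrite /adj; case: xgetP => [b _ [bb hb]|/(_ (a^*))[]]; last first.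
  split; [exact: bopP | exact/is_adjP/starP].
by rewrite (@star_uniq a (Bop bb)) //; apply/is_adjP.
Qed.

Lemma starK (a : bop H) : a^*^* = a.
Proof. by apply: star_uniq => u v; rewrite ripC -starP ripC. Qed.
Lemma starD (a b : bop H) : (a + b)^* = a^* + b^*.
Proof. by apply: star_uniq => u v; rewrite !bopDE ripDl ripDr !starP. Qed.
Lemma starZ (c : R) (a : bop H) : (c%:C *: a)^* = c%:C *: a^*.
Proof. by apply: star_uniq => u v; rewrite !bopZE ripZl ripZr starP. Qed.
Lemma starN (a : bop H) : (- a)^* = - a^*.
Proof. by apply: star_uniq => u v; rewrite !bopNE ripNl ripNr starP. Qed.
Lemma starB (a b : bop H) : (a - b)^* = a^* - b^*.
Proof. by rewrite starD starN. Qed.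
Lemma starM (a b : bop H) : (a * b)^* = b^* * a^*.
Proof. by apply: star_uniq => u v; rewrite !bopME !starP. Qed.
Lemma star1 : 1^* = 1.
Proof. exact: star_uniq. Qed.
Lemma star0 : 0^* = 0.
Proof. by apply: star_uniq => u v; rewrite !bop0E rip0l rip0r. Qed.
Lemma star_sum I (r : seq I) (P : pred I) (F : I -> bop H) :
  (\sum_(i <- r | P i) F i)^* = \sum_(i <- r | P i) (F i)^*.
Proof. by elim/big_rec2: _ => [|i x y _ <-]; rewrite ?star0 ?starD. Qed.
Lemma starX (a : bop H) n : (a ^+ n)^* = a^* ^+ n.
Proof. by elim: n => [|n ih]; rewrite ?expr0 ?star1 // exprS starM ih exprSr. Qed.

Lemma star_mul_eq0 (a : bop H) : a^* * a = 0 -> a = 0.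
Proof.
move=> h; apply: bop_ext => v; apply: nrm_eq0; apply/eqP.
by rewrite -sqrf_eq0 -(rip_nrm hip) starP -bopME h bop0E rip0r.
Qed.

End Adjoint.

(** * Strong limits and positive operators *)

Section FunctionalCalculus.
Context (R : realType) (H : completeNormedModType R[i])
        (ip : {dot H for Num.conj}).
Context (hip : hilbert_inner_product ip).
Local Notation rip := (re_ip ip).
Local Notation "a ^*" := (star hip a) : ring_scope.
Implicit Types (a b c e p q w z : bop H) (r : R) (S : set (bop H)).

Definition contraction a := forall v, nrm (a v) <= nrm v.
Definition positive a := a^* = a /\ forall v, 0 <= rip (a v) v.
Definition effect a := positive a /\ positive (1 - a).
Definition proj p := p^* = p /\ p * p = p.
(** Convergence in the strong operator topology. *)
Definition sconv (a : nat -> bop H) b := forall v, converges (fun n => a n v) (b v).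

(** Real multiples get their own operation because they pass through the adjoint unchanged. *)
Definition scalr r a : bop H := r%:C *: a.
Local Notation "r **: a" := (scalr r a) (at level 40).

Lemma scalrE r a v : (r **: a) v = r%:C *: a v. Proof. by []. Qed.
Lemma scalrAl r a b : r **: a * b = r **: (a * b).
Proof. by rewrite /scalr bop_scaleAl. Qed.
Lemma scalrAr r a b : a * (r **: b) = r **: (a * b).
Proof. by rewrite /scalr bop_scaleAr. Qed.
Lemma scalrA r r' a : r **: (r' **: a) = (r * r') **: a.
Proof. by rewrite /scalr scalerA rmorphM. Qed.
Lemma scalr1 a : 1 **: a = a. Proof. by rewrite /scalr scale1r. Qed.
Lemma scalr0 r : r **: 0 = 0. Proof. by rewrite /scalr scaler0. Qed.
Lemma scalrDr r a b : r **: (a + b) = r **: a + r **: b.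
Proof. by rewrite /scalr scalerDr. Qed.
Lemma scalrDl r r' a : (r + r') **: a = r **: a + r' **: a.
Proof. by rewrite /scalr rmorphD /= scalerDl. Qed.
Lemma scalrBl r r' a : (r - r') **: a = r **: a - r' **: a.
Proof. by rewrite /scalr rmorphB /= scalerBl. Qed.
Lemma scalrNr r a : r **: (- a) = - (r **: a).
Proof. by rewrite /scalr scalerN. Qed.
Lemma scalr_star r a : (r **: a)^* = r **: a^*.
Proof. exact: starZ. Qed.
Lemma scalrVK r a : r != 0 -> r^-1 **: (r **: a) = a.
Proof. by move=> r0; rewrite scalrA mulVf // scalr1. Qed.

Lemma sconv_uniq (a : nat -> bop H) b c : sconv a b -> sconv a c -> b = c.
Proof. by move=> h h'; apply: bop_ext => v; apply: converges_uniq (h v) (h' v). Qed.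

Lemma sconv_cst a : sconv (fun=> a) a.
Proof. by move=> v; apply: converges_cst. Qed.

Lemma sconvD (a b : nat -> bop H) c d :
  sconv a c -> sconv b d -> sconv (fun n => a n + b n) (c + d).
Proof. by move=> h h' v; apply: convergesD. Qed.

Lemma sconvMl c (a : nat -> bop H) b : sconv a b -> sconv (fun n => c * a n) (c * b).
Proof.
move=> h v; have [C C0 hC] := bop_bound c.
by apply: converges_bound C0 _ (h v) => n; rewrite !bopME -bopBv.
Qed.

Lemma sconvMr c (a : nat -> bop H) b : sconv a b -> sconv (fun n => a n * c) (b * c).
Proof. by move=> h v; apply: h. Qed.

Lemma sconvN (a : nat -> bop H) b : sconv a b -> sconv (fun n => - a n) (- b).
Proof.
move=> h v; apply: converges_bound ler01 _ (h v) => n.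
by rewrite !bopNE -opprD nrmN mul1r.
Qed.

Lemma sconvB (a b : nat -> bop H) c d :
  sconv a c -> sconv b d -> sconv (fun n => a n - b n) (c - d).
Proof. by move=> h /sconvN; apply: sconvD. Qed.

Lemma sconvZ r (a : nat -> bop H) b : sconv a b -> sconv (fun n => r **: a n) (r **: b).
Proof.
move=> h; exact: (sconvMl (r **: 1) h).
Qed.

(** Multiplication is not jointly strongly continuous; the uniform bound on the left factors
    controls the term [a n (b n v - d v)]. *)
Lemma sconvM (a b : nat -> bop H) c d : (forall n, contraction (a n)) ->
  sconv a c -> sconv b d -> sconv (fun n => a n * b n) (c * d).
Proof.
move=> ha h h' v.
have h1 : converges (fun n => a n (b n v - d v)) 0.
  by apply: converges_bound ler01 _ (h' v) => n; rewrite subr0 mul1r; apply: ha.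
have := convergesD h1 (h (d v)); rewrite add0r; congr converges.
by apply/funext => n; rewrite bopBv subrK.
Qed.

Lemma sconvS (a : nat -> bop H) b : sconv a b -> sconv (fun n => a n.+1) b.
Proof. by move=> h v e /(h v e)[N hN]; exists N => n Nn; apply/hN/leqW. Qed.

(** Taking adjoints is not strongly continuous, so convergence of both sequences is assumed; the
    inner products then identify the limits. *)
Lemma sconv_star (a b : nat -> bop H) c d : sconv a c -> sconv b d ->
  (forall n, (a n)^* = b n) -> c^* = d.
Proof.
move=> h h' hab; apply: star_uniq => u v; apply/eqP; rewrite -subr_eq0.
apply/negPn/negP => D0; set D := _ - _ in D0.
have D2 : 0 < `|D| / 2 by rewrite divr_gt0 ?normr_gt0.
have [N hN] := converges_rip hip v (h u) D2.
have [N' hN'] := converges_rip hip u (h' v) D2.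
have {hN} := hN (maxn N N') (leq_maxl _ _).
have {hN'} := hN' (maxn N N') (leq_maxr _ _).
set n := maxn N N'; rewrite -hab ripC -starP [rip (d v) u]ripC => h1 h2.
have := ler_normB (rip (a n u) v - rip u (d v)) (rip (a n u) v - rip (c u) v).
have -> : rip (a n u) v - rip u (d v) - (rip (a n u) v - rip (c u) v) = D.
  by rewrite /D; ring.
lra.
Qed.

Lemma sconv_positive (a : nat -> bop H) b : sconv a b ->
  (forall n, positive (a n)) -> positive b.
Proof.
move=> h hp; split; first by apply: (sconv_star h h) => n; case: (hp n).
move=> v; apply: (converges_rip_ge hip (h v)).
by exists 0%N => n _; case: (hp n) => _; apply.
Qed.

Lemma sconv_contraction (a : nat -> bop H) b : sconv a b ->
  (forall n, contraction (a n)) -> contraction b.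
Proof. by move=> h hc v; apply: converges_nrm_le (h v) _ => n; apply: hc. Qed.

(** [g] acts as a potential: it increases along the sequence and is bounded, so its increments,
    which dominate the squared distances, become small. *)
Lemma strong_limit (a : nat -> bop H) (g : nat -> H -> R) (K : H -> R) :
  (forall n, contraction (a n)) ->
  (forall n m v, (n <= m)%N -> nrm (a m v - a n v) ^+ 2 <= g m v - g n v) ->
  (forall n v, g n v <= K v) -> exists b, sconv a b.
Proof.
move=> ha hg hK.
have /choice[b hb] (v : H) : exists l, converges (fun n => a n v) l.
  apply: converges_cauchy => e e0.
  pose A := [set g n v | n in setT].
  have A0 : has_sup A.
    by split; [exists (g 0%N v), 0%N | exists (K v) => _ [n _ <-]].
  have [_ [N _ <-] hN] := sup_adherent (exprn_gt0 2 e0) A0.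
  have le n m : (N <= n)%N -> (n <= m)%N -> nrm (a m v - a n v) < e.
    move=> Nn nm; rewrite -(ltr_pXn2r (n := 2)) ?nnegrE ?nrm_ge0 ?(ltW e0) //.
    apply: le_lt_trans (hg _ _ _ nm) _.
    have h1 : g m v <= sup A by apply: ub_le_sup; [exact: A0.2 | exists m].
    have h2 : g N v <= g n v by rewrite -subr_ge0 (le_trans _ (hg _ _ v Nn)) ?sqr_ge0.
    lra.
  exists N => n m Nn Nm; case/orP: (leq_total n m) => h; last exact: le.
  by rewrite nrmB; apply: le.
have bb : bounded_op b.
  apply/bounded_opP; split=> [c u v|].
    apply: converges_uniq (hb _) _.
    have h1 : converges (fun n => c *: a n u) (c *: b u).
      apply: (converges_bound (C := Re `|c|)) (hb u) => [|n].
        by rewrite normc_def sqrtr_ge0.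
      by rewrite -scalerBr nrmZ.
    have := convergesD h1 (hb v); congr converges.
    by apply/funext => n; rewrite bop_linear.
  exists 1 => // v; rewrite mul1r.
  by apply: converges_nrm_le (hb v) _ => n; apply: ha.
by exists (Bop bb).
Qed.

(** This is [a ^ 2 <= a] for [0 <= a <= 1]: positivity of [a] at [v - a v] gives
    [a - 2 a ^ 2 + a ^ 3 >= 0], and [a ^ 3 <= a ^ 2]. *)
Lemma positive_sqr_le a : positive a -> (forall v, rip (a v) v <= nrm v ^+ 2) ->
  forall v, nrm (a v) ^+ 2 <= rip (a v) v.
Proof.
move=> [sa pa] ha v; have := pa (v - a v); rewrite bopBv !ripBl !ripBr.
have -> : rip (a (a v)) v = rip (a v) (a v) by rewrite starP sa.
by have := ha (a v); rewrite (rip_nrm hip); lra.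
Qed.

Lemma effect_le a v : effect a -> rip (a v) v <= nrm v ^+ 2.
Proof.
by case=> _ [_ /(_ v)]; rewrite bopBE bop1E ripBl (rip_nrm hip) subr_ge0.
Qed.

Lemma effect_sqr_le a v : effect a -> nrm (a v) ^+ 2 <= rip (a v) v.
Proof. by move=> ha; apply: positive_sqr_le => [|w]; [case: ha|exact: effect_le]. Qed.

Lemma effect_contraction a : effect a -> contraction a.
Proof.
move=> ha v; rewrite -(ler_pXn2r (n := 2)) ?nnegrE ?nrm_ge0 //.
by rewrite (le_trans (effect_sqr_le v ha)) // effect_le.
Qed.

Lemma contraction_le1 a v : contraction a -> rip (a v) v <= nrm v ^+ 2.
Proof.
move=> ha; apply: le_trans (rip_le hip _ _) _.
by rewrite expr2 ler_wpM2r ?nrm_ge0.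
Qed.

Lemma contraction_effect a : positive a -> contraction a -> effect a.
Proof.
move=> pa ca; split=> //; split; first by rewrite starB star1 pa.1.
by move=> v; rewrite bopBE bop1E ripBl (rip_nrm hip) subr_ge0 contraction_le1.
Qed.

Lemma positiveD a b : positive a -> positive b -> positive (a + b).
Proof.
move=> [sa pa] [sb pb]; split; first by rewrite starD sa sb.
by move=> v; rewrite bopDE ripDl addr_ge0.
Qed.

Lemma positiveZ r a : 0 <= r -> positive a -> positive (r **: a).
Proof.
move=> r0 [sa pa]; split; first by rewrite scalr_star sa.
by move=> v; rewrite scalrE ripZl mulr_ge0.
Qed.

Lemma positive_conj a c : positive a -> positive (c^* * a * c).
Proof.
move=> [sa pa]; split; first by rewrite !starM starK sa mulrA.
by move=> v; rewrite !bopME starP starK.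
Qed.

Lemma positive1 : positive 1.
Proof.
by split=> [|v]; rewrite ?star1 // bop1E (rip_nrm hip) sqr_ge0.
Qed.

Lemma positive_star_mul c : positive (c^* * c).
Proof. by have := positive_conj c positive1; rewrite mulr1. Qed.

Lemma positiveX a n : positive a -> positive (a ^+ n).
Proof.
move=> pa.
have -> : a ^+ n = (a ^+ n./2)^* * a ^+ (odd n) * a ^+ n./2.
  rewrite starX pa.1 -!exprD; congr (_ ^+ _).
  by rewrite addnAC addnn addnC odd_double_half.
by apply: positive_conj; case: (odd n); rewrite ?expr1 //; apply: positive1.
Qed.

End FunctionalCalculus.

(** * Spectral calculus *)

Section SpectralCalculus.
Context (R : realType) (H : completeNormedModType R[i])
        (ip : {dot H for Num.conj}).
Context (hip : hilbert_inner_product ip).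
Local Notation rip := (re_ip ip).
Local Notation "a ^*" := (star hip a) : ring_scope.
Local Notation "r **: a" := (scalr r a) (at level 40).
Local Notation positive := (positive hip).
Local Notation effect := (effect hip).
Local Notation proj := (proj hip).
Implicit Types (a b c e p q w z : bop H) (r : R) (S : set (bop H)).

Lemma monotone_limit (a : nat -> bop H) : (forall n, effect (a n)) ->
  (forall n, positive (a n.+1 - a n)) -> exists b, sconv a b.
Proof.
move=> ha hd.
have pmn n m : (n <= m)%N -> positive (a m - a n).
  move=> /subnK <-; elim: (m - n)%N => [|k ih].
    by rewrite subrr; split=> [|v]; rewrite ?star0 // bop0E rip0l.
  by rewrite addSn -(subrKA (a (k + n)%N)); apply: positiveD.
apply: (@strong_limit _ _ a (fun n v => rip (a n v) v) (fun v => nrm v ^+ 2)).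
- by move=> n; apply: effect_contraction (ha n).
- move=> n m v /pmn p; rewrite -ripBl -bopBE; apply: (positive_sqr_le p) => u.
  rewrite bopBE ripBl; have := effect_le u (ha m).
  by have := (ha n).1.2 u; lra.
- by move=> n v; apply: effect_le.
Qed.

(** [M], commutants and their intersections are such classes. Each spectral construction below puts
    its result into every closed class that contains the data; this yields at once that the result
    lies in [M] and that it commutes with whatever commutes with the data. *)
Definition closed_class S : Prop :=
  [/\ S 1, forall a b, S a -> S b -> S (a + b),
      forall r a, S a -> S (r **: a), forall a b, S a -> S b -> S (a * b)
    & forall (a : nat -> bop H) b, (forall n, S (a n)) -> sconv a b -> S b].

Lemma closed_classB S a b : closed_class S -> S a -> S b -> S (a - b).
Proof.
case=> _ SD SZ _ _ Sa Sb; apply: (SD) => //.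
by have := SZ (-1) b Sb; rewrite /scalr rmorphN1 scaleN1r.
Qed.

Lemma closed_class_commutant c : closed_class [set a | a * c = c * a].
Proof.
split=> /=; first by rewrite mul1r mulr1.
- by move=> a b ha hb; rewrite mulrDl mulrDr ha hb.
- by move=> r a ha; rewrite scalrAl scalrAr ha.
- by move=> a b ha hb; rewrite -mulrA hb mulrA ha mulrA.
- move=> a b ha hab; apply: (sconv_uniq (sconvMr c hab)).
  by have := sconvMl c hab; congr sconv; apply/funext => n; rewrite ha.
Qed.

Lemma closed_classI S S' : closed_class S -> closed_class S' ->
  closed_class (S `&` S').
Proof.
move=> [a1 a2 a3 a4 a5] [b1 b2 b3 b4 b5]; split=> //.
- by move=> a b [? ?] [? ?]; split; [apply: a2|apply: b2].
- by move=> r a [? ?]; split; [apply: a3|apply: b3].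
- by move=> a b [? ?] [? ?]; split; [apply: a4|apply: b4].
- move=> a b h hab; split; [apply: (a5 a)|apply: (b5 a)] => // n; by case: (h n).
Qed.

(* The iterates below and their increments are polynomials in [z] with
   nonnegative coefficients, hence positive. *)
Inductive poscone z : bop H -> Prop :=
| poscone1 : poscone z 1
| posconeD a b : poscone z a -> poscone z b -> poscone z (a + b)
| posconeZ r a : 0 <= r -> poscone z a -> poscone z (r **: a)
| posconeX a : poscone z a -> poscone z (a * z).

Lemma posconeM z a b : poscone z a -> poscone z b -> poscone z (a * b).
Proof.
move=> ha; elim=> [|c d _ hc _ hd|r c r0 _ hc|c _ hc].
- by rewrite mulr1.
- by rewrite mulrDr; apply: posconeD.
- by rewrite scalrAr; apply: posconeZ.
- by rewrite mulrA; apply: posconeX.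
Qed.

Lemma poscone_positive z a : positive z -> poscone z a -> positive a.
Proof.
move=> pz ha; suff h k : positive (a * z ^+ k) by have := h 0%N; rewrite mulr1.
elim: ha k => {a} [|a b _ ha _ hb|r a r0 _ ha|a _ ha] k.
- by rewrite mul1r; apply: positiveX.
- by rewrite mulrDl; apply: positiveD.
- by rewrite scalrAl; apply: positiveZ.
- by rewrite -mulrA -exprS; apply: ha.
Qed.

Fixpoint sqrt_iter z n : bop H :=
  if n is n'.+1 then 2^-1 **: (z + sqrt_iter z n' * sqrt_iter z n') else 0.

Lemma halfD a : 2^-1 **: a + 2^-1 **: a = a.
Proof. by rewrite -scalrDl (_ : 2^-1 + 2^-1 = 1) ?scalr1 //; field. Qed.

(* The iteration [t := (z + t ^ 2) / 2] increases to a solution of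
   [(1 - t) ^ 2 = 1 - z]. *)
Lemma effect_sqrt z : effect z -> exists t,
  [/\ effect t, (1 - t) * (1 - t) = 1 - z
    & forall S, closed_class S -> S z -> S t].
Proof.
move=> ez; pose t := sqrt_iter z.
have tS n : t n.+1 = 2^-1 **: (z + t n * t n) by [].
have h0 : poscone z 0.
  have -> : (0 : bop H) = 0 **: 1 by rewrite /scalr rmorph0 scale0r.
  by apply: posconeZ => //; apply: poscone1.
have hz : poscone z z by rewrite -[X in poscone z X]mul1r; apply/posconeX/poscone1.
have h2 : (0 : R) <= 2^-1 by rewrite invr_ge0.
have pt n : poscone z (t n).
  by elim: n => [|n ih] //; rewrite tS; apply: posconeZ => //; apply: posconeD => //; apply: posconeM.
have pd n : poscone z (t n.+1 - t n).
  elim: n => [|n ih].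
    by rewrite tS /= mul0r addr0 subr0; apply: posconeZ.
  have -> : t n.+2 - t n.+1 = 2^-1 **: ((t n.+1 - t n) * t n.+1 + t n * (t n.+1 - t n)).
    rewrite (tS n.+1) [X in _ - X]tS -scalrNr -scalrDr; congr (_ **: _).
    by rewrite mulrBl mulrBr opprD addrACA subrr add0r subrKA.
  by apply: posconeZ => //; apply: posconeD; apply: posconeM.
have ct n : contraction (t n).
  elim: n => [|n ih] v; first by rewrite bop0E nrm0 nrm_ge0.
  rewrite tS scalrE nrmZr // bopDE.
  have := nrmD (z v) ((t n * t n) v); have := effect_contraction ez v.
  have := ih v; have := ih (t n v); rewrite bopME.
  by move: (nrm _) (nrm _) (nrm _) (nrm _) (nrm _) => *; lra.
have et n : effect (t n).
  by apply: contraction_effect => //; apply: poscone_positive (pt n); case: ez.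
have [|b tb] := monotone_limit et.
  by move=> n; apply: poscone_positive (pd n); case: ez.
exists b.
have eb : b = 2^-1 **: (z + b * b).
  apply: sconv_uniq (sconvS tb) _.
  by apply: sconvZ; apply: sconvD; [exact: sconv_cst | exact: sconvM].
split.
- apply: contraction_effect; last exact: sconv_contraction tb ct.
  by apply: sconv_positive tb _ => n; case: (et n).
- have e2 : z + b * b = b + b by rewrite {3 4}eb halfD.
  by rewrite mulrBl mul1r mulrBr mulr1 -addrA -opprD addrA -e2 addrK.
- move=> S clS Sz; have [S1 SD SZ SM SL] := clS.
  apply: SL tb; elim=> [|n ih]; last by rewrite tS; apply: (SZ); apply: (SD) => //; apply: (SM).
  by have := closed_classB clS S1 S1; rewrite subrr.
Qed.

Lemma bop_scale_contraction a : exists2 r, 0 < r & contraction (r **: a).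
Proof.
have [C C0 hC] := bop_bound a; have C1 : 0 < C + 1 by lra.
exists (C + 1)^-1; first by rewrite invr_gt0.
move=> v; rewrite scalrE nrmZr ?invr_ge0 ?(ltW C1) // ler_pdivrMl //.
by have := hC v; have := nrm_ge0 v; nra.
Qed.

Lemma sa_sqr_effect c : c^* = c -> contraction c -> effect (1 - c * c).
Proof.
move=> sc cc; have pc : positive (c * c) by have := positive_star_mul hip c; rewrite sc.
have ec : effect (c * c).
  by apply: contraction_effect => // v; apply: le_trans (cc _) (cc _).
by split; [case: ec | rewrite subKr].
Qed.

(* [(1 - c ^ 2) ^ n] decreases to the projection onto the kernel of [c]. *)
Lemma kernel_proj c : c^* = c -> exists e,
  [/\ proj e, c * e = 0, forall f, c * f = 0 -> e * f = f
    & forall S, closed_class S -> S c -> S e].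
Proof.
wlog cc : c / contraction c => [hw sc|sc].
  have [r r0 cr] := bop_scale_contraction c.
  have [|e [pe ce he Se]] := hw _ cr; first by rewrite scalr_star sc.
  exists e; split=> //.
  - move: ce; rewrite scalrAl => /(congr1 (scalr r^-1)).
    by rewrite scalrVK ?gt_eqF // scalr0.
  - by move=> f cf; apply: he; rewrite scalrAl cf scalr0.
  - by move=> S clS Sc; apply: Se => //; case: clS => _ _ SZ _ _; apply: (SZ).
pose w := 1 - c * c; have ew : effect w by apply: sa_sqr_effect.
have cw : c * w = w * c by rewrite /w mulrBl mulrBr mulr1 mul1r mulrA.
have pw n : positive (w ^+ n) by apply: positiveX; case: ew.
have cn n : contraction (w ^+ n).
  elim: n => [|n ih] v; first by rewrite expr0 bop1E.
  by rewrite exprS bopME; apply: le_trans (effect_contraction ew _) (ih v).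
have en n : effect (1 - w ^+ n).
  by have [h1 h2] := contraction_effect (pw n) (cn n); split=> //; rewrite subKr.
have cwn n : c * w ^+ n = w ^+ n * c.
  by elim: n => [|n ih]; rewrite ?expr0 ?mulr1 ?mul1r // exprS mulrA cw -[LHS]mulrA ih !mulrA.
have dn n : positive ((1 - w ^+ n.+1) - (1 - w ^+ n)).
  have -> : (1 - w ^+ n.+1) - (1 - w ^+ n) = c^* * w ^+ n * c.
    rewrite opprB addrC addrA subrK exprSr sc cwn -[RHS]mulrA.
    by rewrite {2}/w mulrBr mulr1 subKr.
  exact: positive_conj.
have [u hu] := monotone_limit en dn.
pose e := 1 - u.
have he : sconv (fun n => w ^+ n) e.
  have := sconvB (sconv_cst 1) hu; congr sconv; apply/funext => n.
  by rewrite subKr.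
have we : w * e = e.
  apply: sconv_uniq (sconvMl w he) _.
  by have := sconvS he; congr sconv; apply/funext => n; rewrite exprS.
have cce : c * (c * e) = 0.
  by have := we; rewrite {1}/w mulrBl mul1r => h; rewrite mulrA -[LHS](subKr e) h subrr.
have se : e^* = e by have [] := sconv_positive he pw.
have fix_e f : w * f = f -> e * f = f.
  move=> wf; have wnf n : w ^+ n * f = f.
    by elim: n => [|n ih]; rewrite ?expr0 ?mul1r // exprS -mulrA ih.
  apply: sconv_uniq (sconvMr f he) _.
  by have := sconv_cst f; congr sconv; apply/funext => n; rewrite wnf.
exists e; split.
- by split=> //; apply: fix_e.
- by apply: (star_mul_eq0 (hip := hip)); rewrite starM sc -mulrA cce mulr0.
- by move=> f cf; apply: fix_e; rewrite /w mulrBl mul1r -mulrA cf mulr0 subr0.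
- move=> S clS Sc; have [S1 _ _ SM SL] := clS.
  apply: SL he; elim=> [|n ih]; first by rewrite expr0.
  by rewrite exprS; apply: (SM) => //; apply: closed_classB => //; apply: (SM).
Qed.

(* The spectral projection of [a] on the half-line [0, +oo[ is the kernel
   projection of [|a| - a]. *)
Lemma spectral_cut a : a^* = a -> exists e,
  [/\ proj e, a * e = e * a, positive (a * e), positive (- (a * (1 - e)))
    & forall S, closed_class S -> S a -> S e].
Proof.
wlog ca : a / contraction a => [hw sa|sa].
  have [r r0 cr] := bop_scale_contraction a.
  have [|e [pe ce p1 p2 Se]] := hw _ cr; first by rewrite scalr_star sa.
  have ri : 0 <= r^-1 by rewrite invr_ge0 ltW.
  exists e; split=> //.
  - move: ce; rewrite scalrAl scalrAr => /(congr1 (scalr r^-1)).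
    by rewrite !scalrVK ?gt_eqF.
  - by have := positiveZ ri p1; rewrite scalrAl scalrVK ?gt_eqF.
  - by have := positiveZ ri p2; rewrite scalrAl -scalrNr scalrVK ?gt_eqF.
  - by move=> S clS Sa; apply: Se => //; case: clS => _ _ SZ _ _; apply: (SZ).
have ez := sa_sqr_effect sa ca.
have [t [et t2 St]] := effect_sqrt ez.
(* [b] is the absolute value of [a], the square root of [a ^ 2 = 1 - (1 - a ^ 2)]. *)
pose b := 1 - t; have pb : positive b by case: et.
have Sb S : closed_class S -> S a -> S b.
  move=> clS Sa; have [S1 _ _ SM _] := clS; apply: closed_classB => //.
  by apply: St => //; apply: closed_classB => //; apply: (SM).
have b2 : b * b = a * a by rewrite /b t2 subKr.
have ab : b * a = a * b by apply: (Sb _ (closed_class_commutant a)).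
have sb : b^* = b by case: pb.
clearbody b.
have [e [pe ce he Se]] := kernel_proj (c := b - a) ltac:(by rewrite starB sa sb).
have Se' S : closed_class S -> S a -> S e.
  by move=> clS Sa; apply: Se => //; apply: closed_classB => //; apply: Sb.
have ae : a * e = e * a.
  by apply/esym; apply: (Se' _ (closed_class_commutant a)).
have be : b * e = e * b.
  apply/esym; apply: (Se' _ (closed_class_commutant b)) => /=.
  by rewrite ab.
have bae : b * e = a * e by apply/eqP; rewrite -subr_eq0 -mulrBl ce.
(* [(b - a) (b + a) = b ^ 2 - a ^ 2 = 0], so [e] fixes [b + a]. Hence [b + a] vanishes under
   [1 - e], where [- a] therefore agrees with [b]. *)
have e2 : e * (b + a) = b + a.
  by apply: he; rewrite mulrBl !mulrDr b2 ab opprD addrA addrK subrr.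
exists e; split=> //.
  have -> : a * e = e^* * b * e by rewrite pe.1 -be -mulrA pe.2 bae.
  exact: positive_conj.
have -> : - (a * (1 - e)) = (1 - e)^* * b * (1 - e).
  have ee : (1 - e) * (b + a) = 0 by rewrite mulrBl mul1r e2 subrr.
  have cb : (1 - e) * b = b * (1 - e) by rewrite mulrBl mulrBr mulr1 mul1r be.
  have ca' : (1 - e) * a = a * (1 - e) by rewrite mulrBl mulrBr mulr1 mul1r ae.
  have e3 : (1 - e) * (1 - e) = 1 - e by rewrite mulrBr mulr1 mulrBl mul1r pe.2 subrr subr0.
  rewrite starB star1 pe.1 cb -mulrA e3 -cb -ca'.
  by apply/eqP; rewrite eq_sym -subr_eq0 opprK -mulrDr ee.
exact: positive_conj.
Qed.

(** The Neumann series of [w = 1 - b], scaled by [d]: its partial sums increase, and they stay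
    contractions because [d + (1 - d) = 1]. The limit [u] satisfies [b u = d]. *)
Lemma positive_inverse b (d : R) : 0 < d -> d <= 1 -> positive (1 - b) ->
  (forall v, nrm ((1 - b) v) <= (1 - d) * nrm v) -> exists k,
  [/\ k^* = k, b * k = 1 & forall S, closed_class S -> S b -> S k].
Proof.
move=> d0 d1 pw hw; pose w := 1 - b.
pose s := fix s n := if n is n'.+1 then d **: 1 + w * s n' else 0 : bop H.
have sE n : s n.+1 = d **: 1 + w * s n by [].
have sX n : s n.+1 - s n = d **: w ^+ n.
  elim: n => [|n ih]; first by rewrite sE /= mulr0 addr0 subr0 expr0.
  by rewrite sE [s n.+1 in X in _ - X]sE opprD addrACA subrr add0r -mulrBr ih scalrAr exprS.
have pd n : positive (s n.+1 - s n).
  by rewrite sX; apply: positiveZ; [exact: ltW | exact: positiveX].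
have ps n : positive (s n).
  elim: n => [|n ih]; first by split=> [|v]; rewrite ?star0 // bop0E rip0l.
  by rewrite -(subrK (s n) (s n.+1)); apply: positiveD.
have cs n : contraction (s n).
  elim: n => [|n ih] v; first by rewrite bop0E nrm0 nrm_ge0.
  rewrite sE bopDE scalrE bop1E bopME; apply: le_trans (nrmD _ _) _.
  rewrite nrmZr ?(ltW d0) //; have := hw (s n v); have := ih v.
  by rewrite -/w; move: (nrm _) (nrm _) (nrm _) => *; nra.
have [|u hu] := monotone_limit _ pd; first by move=> n; apply: contraction_effect.
have eu : u = d **: 1 + w * u.
  apply: sconv_uniq (sconvS hu) _.
  by apply: sconvD; [exact: sconv_cst | exact: sconvMl].
have dn : d != 0 by rewrite gt_eqF.
exists (d^-1 **: u); split.
- by rewrite scalr_star; have [-> _] := sconv_positive hu ps.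
- have : b * u = d **: 1.
    by rewrite -[b](subKr 1) -/w mulrBl mul1r {1}eu addrK.
  by move=> h; rewrite scalrAr h scalrVK.
- move=> S clS Sb; have [S1 SD SZ SM SL] := clS; apply: (SZ); apply: SL hu.
  elim=> [|n ih]; first by have := closed_classB clS S1 S1; rewrite subrr.
  by rewrite sE; apply: (SD); [exact: SZ | apply: (SM) => //; apply: closed_classB].
Qed.

Lemma wot_closed_sconv (M : set (H -> H)) (a : nat -> bop H) b :
  wot_closed ip M -> (forall n, M (a n)) -> sconv a b -> M b.
Proof.
move=> Mw Ma hab; apply: Mw => [|F e e0]; first exact: bopP.
have er : e = (Re e)%:C by rewrite RRe_real // gtr0_real.
have re0 : 0 < Re e by rewrite -ltcR -er.
have re2 : 0 < Re e / 2 by rewrite divr_gt0.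
suff [N hN] : exists N, forall n, (N <= n)%N -> forall uv, uv \in F ->
    `|ip (((b : H -> H) - (a n : H -> H)) uv.1) uv.2| < e.
  by exists (a N) => // uv; apply: hN.
elim: F => [|[u v] F [N hN]]; first by exists 0%N.
have [N1 h1] := converges_rip hip v (hab u) re2.
have [N2 h2] := converges_rip hip ('i%C *: v) (hab u) re2.
exists (maxn N (maxn N1 N2)) => n; rewrite !geq_max => /and3P[nN n1 n2] uv.
rewrite inE => /orP[/eqP ->|]; last exact: hN.
rewrite /= fctE /= er -[`|_|]RRe_real ?ger0_real // ltcR.
apply: le_lt_trans (norm_Im _) _.
have := h1 n n1; have := h2 n n2; rewrite ipE /=.
change ((- (a n : H -> H)) u) with (- a n u).
by rewrite !ripBl !(distrC (rip (b u) _)) => *; lra.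
Qed.

End SpectralCalculus.

(** * Projections in a II_1 factor *)

(* Each step gains at least half of the supremum of the possible gains. *)
Lemma greedy_sequence (R : realType) (T : Type) (step : T -> T -> Prop)
    (f : T -> R) (K : R) (x0 : T) :
  (forall x, step x x) -> (forall x, f x <= K) ->
  exists u : nat -> T, [/\ u 0%N = x0, forall n, step (u n) (u n.+1)
    & forall d : R, 0 < d ->
        exists n, forall y, step (u n) y -> f y < f (u n) + d].
Proof.
move=> step_refl fK; pose s x := sup [set f y | y in step x].
have hs x : has_sup [set f y | y in step x].
  by split; [exists (f x), x | exists K => _ [y _ <-]].
have fs x y : step x y -> f y <= s x.
  by move=> xy; apply: ub_le_sup; [case: (hs x) | exists y].
have /choice[g hg] x : exists y, step x y /\ (f x + s x) / 2 <= f y.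
  have := fs x x (step_refl x); rewrite le_eqVlt => /orP[/eqP e|lt].
    by exists x; split=> //; rewrite -e; lra.
  have e0 : 0 < (s x - f x) / 2 by lra.
  have [_ [y xy <-] hy] := sup_adherent e0 (hs x).
  by exists y; split=> //; move: hy; rewrite -/(s x); lra.
pose u n := iter n g x0.
exists u; split=> // [n|d d0]; first by case: (hg (u n)).
have step2 n : s (u n) - f (u n) <= 2 * (f (u n.+1) - f (u n)).
  by have [_] := hg (u n); rewrite -[g _]/(u n.+1); lra.
have [[n hn]|none] := pselect (exists n, f (u n.+1) - f (u n) < d / 2).
  by exists n => y /fs; have := step2 n; lra.
have lin n : f x0 + n%:R * (d / 2) <= f (u n).
  elim: n => [|n ih]; first by rewrite mul0r addr0.
  have : d / 2 <= f (u n.+1) - f (u n) by rewrite leNgt; apply/negP => h; apply: none; exists n.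
  by rewrite -[n.+1%:R]natr1 mulrDl mul1r; lra.
pose k := Num.bound ((K - f x0) / (d / 2)).
have : (K - f x0) / (d / 2) < k%:R 
  by apply: archi_boundP; rewrite divr_ge0 ?subr_ge0 // divr_ge0 // ltW.
rewrite ltr_pdivrMr ?divr_gt0 //; have := lin k; have := fK (u k); lra.
Qed.

Section Projections.
Context (R : realType) (H : completeNormedModType R[i])
        (ip : {dot H for Num.conj}) (hip : hilbert_inner_product ip).
Local Notation rip := (re_ip ip).
Local Notation "a ^*" := (star hip a) : ring_scope.
Local Notation "r **: a" := (scalr r a) (at level 40).
Local Notation positive := (positive hip).
Local Notation effect := (effect hip).
Local Notation proj := (proj hip).
Implicit Types (a b c e p q w x y z : bop H) (r : R) (S : set (bop H)).

Lemma proj_zero : proj 0.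
Proof. by split; [rewrite star0 | rewrite mulr0]. Qed.

Lemma proj_leC p q : proj p -> proj q -> q * p = p -> p * q = p.
Proof. by move=> [sp _] [sq _] qp; rewrite -[RHS]sp -[in RHS]qp starM sp sq. Qed.

Lemma proj_orthC p q : proj p -> proj q -> q * p = 0 -> p * q = 0.
Proof. by move=> [sp _] [sq _] qp; rewrite -sp -sq -starM qp star0. Qed.

Lemma projB p q : proj p -> proj q -> q * p = p -> proj (q - p).
Proof.
move=> pp pq qp; split; first by rewrite starB pp.1 pq.1.
by rewrite mulrBl !mulrBr pp.2 pq.2 qp (proj_leC pp pq qp) subrr subr0.
Qed.

Lemma projD p q : proj p -> proj q -> q * p = 0 -> proj (p + q).
Proof.
move=> pp pq qp; split; first by rewrite starD pp.1 pq.1.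
by rewrite mulrDl !mulrDr pp.2 pq.2 qp (proj_orthC pp pq qp) addr0 add0r.
Qed.

Lemma proj_positive p : proj p -> positive p.
Proof. by case=> sp pp; have := positive_star_mul hip p; rewrite sp pp. Qed.

Lemma proj_form p v : proj p -> rip (p v) v = nrm (p v) ^+ 2.
Proof.
by case=> sp p2; rewrite -(rip_nrm hip) [RHS]starP sp -bopME p2 ripC.
Qed.

Lemma proj_one : proj 1.
Proof. by split; rewrite ?star1 ?mulr1. Qed.

Lemma projC p : proj p -> proj (1 - p).
Proof. by move=> pp; apply: projB proj_one _ => //; rewrite mul1r. Qed.

Lemma proj_effect p : proj p -> effect p.
Proof. by move=> pp; split; apply: proj_positive => //; apply: projC. Qed.

Lemma sa_form0 c : c^* = c -> (forall v, rip (c v) v = 0) -> c = 0.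
Proof.
move=> sc hc; apply: bop_ext => u; apply: (rip_ext hip) => w.
rewrite bop0E rip0l; have := hc (u + w).
rewrite bopDv ripDl !ripDr !hc add0r addr0 [rip (c w) u]starP sc.
by rewrite [rip w _]ripC; lra.
Qed.

Lemma positive_antisym c : positive c -> positive (- c) -> c = 0.
Proof.
move=> [sc pc] [_ nc]; apply: sa_form0 => // v.
by apply/eqP; rewrite eq_le pc andbT -oppr_ge0 -ripNl -bopNE nc.
Qed.

Lemma positive_norm_le a r : 0 < r -> positive a ->
  (forall v, rip (a v) v <= r * nrm v ^+ 2) -> forall v, nrm (a v) <= r * nrm v.
Proof.
move=> r0 pa ha v; have ri : 0 <= r^-1 by rewrite invr_ge0 ltW.
have [sa pa'] := positiveZ ri pa.
have /effect_contraction/(_ v) : effect (r^-1 **: a).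
  split=> //; split; first by rewrite starB star1 sa.
  move=> w; rewrite bopBE scalrE ripBl ripZl bop1E (rip_nrm hip) subr_ge0.
  by rewrite ler_pdivrMl // ha.
by rewrite scalrE nrmZr // ler_pdivrMl.
Qed.

Lemma proj_limit (u : nat -> bop H) : (forall n, proj (u n)) ->
  (forall n, u n.+1 * u n = u n) ->
  exists Q, [/\ sconv u Q, proj Q & forall n, Q * u n = u n].
Proof.
move=> pu hu; have [n|n|Q hQ] := @monotone_limit _ _ _ hip u.
- exact: proj_effect.
- by apply/proj_positive/projB.
have cu n : contraction (u n) by exact: (effect_contraction (proj_effect (pu n))).
have umn n k : u (k + n)%N * u n = u n.
  elim: k => [|k ih]; first by case: (pu n).
  by rewrite addSn -ih mulrA hu.
exists Q; split=> // [|n].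
  split; first by apply: (sconv_star hQ hQ) => n; case: (pu n).
  apply: sconv_uniq (sconvM cu hQ hQ) _.
  by move: hQ; congr sconv; apply/funext => n; case: (pu n).
have hs : sconv (fun k => u (k + n)%N) Q.
  move=> v d /(hQ v)[N hN]; exists N => k Nk; apply: hN.
  exact: leq_trans Nk (leq_addr _ _).
apply: sconv_uniq (sconvMr (u n) hs) _.
by have := sconv_cst (u n); congr sconv; apply/funext => k; rewrite umn.
Qed.

Lemma rip_i (u v : H) : rip ('i%C *: u) v = - rip u ('i%C *: v).
Proof.
rewrite /re_ip linearZl_LR linearZr_LR /=; case: (ip u v) => s s' /=; ring.
Qed.

Lemma star_i c : ('i%C *: c)^* = - ('i%C *: c^*).
Proof.
apply: star_uniq => u v.
by rewrite bopZE bopNE bopZE ripNr rip_i -bopZv starP bopZv.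
Qed.

(* If all the spectral cuts of the [c - r p] were trivial, [c] would be the
   multiple of [p] by the supremum of the [r] with [c >= r p]. *)
Lemma nonscalar_subproj c p : c^* = c -> proj p -> c * p = c ->
  (forall r, c <> r **: p) -> exists q,
  [/\ proj q, p * q = q, q <> 0, q <> p
    & forall S, closed_class S -> S c -> S p -> S q].
Proof.
move=> sc pp cp nc; have [sp p2] := pp.
have pc : p * c = c by rewrite -sp -sc -starM sc cp.
apply: contrapT => none.
(* [c] is comparable with every multiple of [p]: the spectral projection of [c - r p], cut down to
   [p], can only be [0] or [p]. *)
have cut r : positive (r **: p - c) \/ positive (c - r **: p).
  have sd : (c - r **: p)^* = c - r **: p by rewrite starB scalr_star sc sp.
  pose d := c - r **: p.
  have dp : d * p = d by rewrite /d mulrBl cp scalrAl p2.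
  have pd : p * d = d by rewrite /d mulrBr pc scalrAr p2.
  have [e [pe de p1 p2' Se]] := spectral_cut sd.
  have ep : e * p = p * e by apply: (Se _ (closed_class_commutant p)); rewrite /= dp pd.
  have pep : proj (e * p).
    split; first by rewrite starM pe.1 sp.
    by rewrite -mulrA [p * _]mulrA -ep -mulrA p2 mulrA pe.2.
  have dep : d * (e * p) = d * e by rewrite ep mulrA dp.
  have [ep0|ep0] := pselect (e * p = 0).
    left; move: p2'; rewrite mulrBr mulr1 -dep ep0 mulr0 subr0.
    by rewrite /d opprB.
  have [epp|epp] := pselect (e * p = p).
    by right; move: p1; rewrite -dep epp dp.
  case: none; exists (e * p); split=> //; first by rewrite ep mulrA p2.
  move=> S clS Sc Sp; have [_ _ SZ SM _] := clS; apply: (SM) => //.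
  by apply: Se => //; apply: closed_classB => //; apply: (SZ).
have form v r : rip ((c - r **: p) v) v = rip (c v) v - r * nrm (p v) ^+ 2.
  by rewrite bopBE scalrE ripBl ripZl (proj_form v pp).
pose A := [set r | positive (c - r **: p)].
have [p0|/eqP p0] := pselect (p = 0).
  by apply: (nc 0); rewrite -cp p0 mulr0 scalr0.
have [v0 v0N] : exists v, p v <> 0.
  apply: contrapT => h; move/eqP: p0; apply; apply: bop_ext => v.
  by apply: contrapT => h'; apply: h; exists v.
have v0p : 0 < nrm (p v0) ^+ 2.
  rewrite exprn_gt0 // lt_def nrm_ge0 andbT; apply/eqP => h.
  exact/v0N/nrm_eq0.
have supA : has_sup A.
  split.
    have [C C0 hC] := bop_bound c; exists (- C); split.
      by rewrite starB scalr_star sc sp.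
    move=> v; rewrite form //.
    have -> : rip (c v) v = rip (c (p v)) (p v) by rewrite -{1}cp bopME -{1}pc bopME starP sp.
    have := rip_le hip (- c (p v)) (p v); rewrite nrmN ripNl.
    have := hC (p v); have := nrm_ge0 (p v); rewrite expr2; nra.
  exists (rip (c v0) v0 / nrm (p v0) ^+ 2) => r [_ /(_ v0)].
  by rewrite form // ler_pdivlMr // subr_ge0.
pose L := sup A; apply: (nc L).
apply/eqP; rewrite -subr_eq0; apply/eqP/sa_form0.
  by rewrite starB scalr_star sc sp.
move=> v; rewrite form //; have nv : 0 <= nrm (p v) ^+ 2 by rewrite sqr_ge0.
apply/eqP; rewrite eq_le; apply/andP; split; rewrite leNgt; apply/negP => h.
  set d := _ - _ in h; pose k := d / (2 * (nrm (p v) ^+ 2 + 1)).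
  have n1 : 0 < 2 * (nrm (p v) ^+ 2 + 1) by lra.
  have k0 : 0 < k by rewrite divr_gt0.
  have [[_ /(_ v)]|Ak] := cut (L + k); last first.
    have : L + k <= L by apply: ub_le_sup Ak; case: supA.
    by rewrite gerDl leNgt k0.
  rewrite bopBE ripBl scalrE ripZl.
  have -> : rip (p v) v = nrm (p v) ^+ 2 by apply: proj_form.
  have : k * (2 * (nrm (p v) ^+ 2 + 1)) = d by rewrite /k divfK // gt_eqF.
  rewrite /d; nra.
set d := _ - _ in h; have n0 : 0 < nrm (p v) ^+ 2 + 1 by lra.
pose e := - d / (nrm (p v) ^+ 2 + 1).
have e0 : 0 < e by rewrite divr_gt0 // oppr_gt0.
have ed : e * (nrm (p v) ^+ 2 + 1) = - d by rewrite divfK // gt_eqF.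
have [r Ar] := sup_adherent e0 supA; rewrite -/L => h2.
have [_ /(_ v)] := Ar; rewrite form // => h1.
have : 0 <= (r - (L - e)) * nrm (p v) ^+ 2 by rewrite mulr_ge0 // subr_ge0 ltW.
by move: ed h1; rewrite /d; clearbody e; move: (nrm _ ^+ 2) => N; nra.
Qed.

End Projections.

(** * Traced factors and maximal projections *)

Section FactorProjections.
Context (R : realType) (H : completeNormedModType R[i])
        (ip : {dot H for Num.conj}) (hip : hilbert_inner_product ip).
Local Notation rip := (re_ip ip).
Local Notation "a ^*" := (star hip a) : ring_scope.
Local Notation "r **: a" := (scalr r a) (at level 40).
Local Notation positive := (positive hip).
Local Notation effect := (effect hip).
Local Notation proj := (proj hip).
Implicit Types (a b c e p q w x y z : bop H) (r : R) (S : set (bop H)).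

(* A II_1 factor [M] with the real part [t] of its trace; normality is only
   needed for increasing sequences of projections. *)
Record traced_factor (M : set (bop H)) (t : bop H -> R) : Prop := TracedFactor {
  tf_closed : closed_class M;
  tf_star : forall a, M a -> M a^*;
  tf_i : forall a, M a -> M ('i%C *: a);
  tf_center : forall a, M a -> (forall b, M b -> a * b = b * a) ->
    exists c : R[i], a = c *: (1 : bop H);
  tf_diffuse : forall p, M p -> proj p ->
    (forall a b, M a -> M b ->
      (p * a * p) * (p * b * p) = (p * b * p) * (p * a * p)) -> p = 0;
  tf_neq0 : 1 <> 0 :> bop H;
  ttD : forall a b, M a -> M b -> t (a + b) = t a + t b;
  ttC : forall a b, M a -> M b -> t (a * b) = t (b * a);
  tt_ge0 : forall a, M a -> 0 <= t (a^* * a);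
  tt1 : t 1 = 1;
  tt_faithful : forall a, M a -> t (a^* * a) = 0 -> a = 0;
  tt_normal : forall (u : nat -> bop H) Q r, (forall n, M (u n)) ->
    (forall n, proj (u n)) -> (forall n, u n.+1 * u n = u n) ->
    sconv u Q -> (forall n, t (u n) <= r) -> t Q <= r
}.

Context (M : set (bop H)) (t : bop H -> R) (tf : traced_factor M t).

Lemma tf1 : M 1. Proof. by case: (tf_closed tf). Qed.
Lemma tfD a b : M a -> M b -> M (a + b). Proof. by case: (tf_closed tf) => _ h _ _ _; apply: h. Qed.
Lemma tfZ r a : M a -> M (r **: a). Proof. by case: (tf_closed tf) => _ _ h _ _; apply: h. Qed.
Lemma tfM a b : M a -> M b -> M (a * b). Proof. by case: (tf_closed tf) => _ _ _ h _; apply: h. Qed.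
Lemma tf_lim (u : nat -> bop H) b : (forall n, M (u n)) -> sconv u b -> M b.
Proof. by case: (tf_closed tf) => _ _ _ _ h; apply: h. Qed.
Lemma tfB a b : M a -> M b -> M (a - b).
Proof. by move=> Ma Mb; apply: (closed_classB (tf_closed tf)). Qed.
Lemma tf0 : M 0.
Proof. by rewrite -(subrr 1); apply: tfB; apply: tf1. Qed.

Lemma tt0 : t 0 = 0.
Proof. by have := ttD tf tf0 tf0; rewrite addr0 => h; lra. Qed.
Lemma ttB a b : M a -> M b -> t (a - b) = t a - t b.
Proof.
move=> Ma Mb; have := ttD tf (tfB Ma Mb) Mb; rewrite subrK => ->; lra.
Qed.
Lemma tp_ge0 p : M p -> proj p -> 0 <= t p.
Proof. by move=> Mp [sp p2]; have := tt_ge0 tf Mp; rewrite sp p2. Qed.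
Lemma tp_eq0 p : M p -> proj p -> t p = 0 -> p = 0.
Proof. by move=> Mp [sp p2] tp; apply: (tt_faithful tf Mp); rewrite sp p2. Qed.
Lemma tp_gt0 p : M p -> proj p -> p <> 0 -> 0 < t p.
Proof.
move=> Mp pp p0; rewrite lt_def tp_ge0 // andbT; apply/eqP => h.
exact/p0/tp_eq0.
Qed.
Lemma tp_le p q : M p -> M q -> proj p -> proj q -> q * p = p -> t p <= t q.
Proof.
move=> Mp Mq pp pq qp; rewrite -subr_ge0 -ttB //.
by apply: tp_ge0; [exact: tfB | exact: projB].
Qed.

(* A maximal element of [V] without Zorn's lemma: the limit of a sequence whose
   trace grows greedily. *)
Lemma maximal_projection (V : set (bop H)) q0 :
  (forall q, V q -> M q /\ proj q) -> V q0 ->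
  (forall (u : nat -> bop H) Q, (forall n, V (u n)) ->
     (forall n, u n.+1 * u n = u n) -> sconv u Q -> V Q) ->
  (forall u Q (r : bop H), V u -> V Q -> Q * u = u -> M r -> proj r -> Q * r = 0 ->
     V (Q + r) -> V (u + r)) ->
  exists Q, [/\ V Q, Q * q0 = q0
    & forall r : bop H, M r -> proj r -> Q * r = 0 -> V (Q + r) -> r = 0].
Proof.
move=> VM Vq0 Vlim Vher; pose T := {q | V q}.
pose step (A B : T) := sval B * sval A = sval A.
have [|q|u [u0 us ud]] := @greedy_sequence R T step (fun A => t (sval A)) 1 (exist _ q0 Vq0).
- by move=> [q Vq]; have [_ [_]] := VM _ Vq.
- have [Mq pq] := VM _ (svalP q); rewrite -(tt1 tf).
  by apply: tp_le => //; [exact: tf1 | exact: proj_one | rewrite mul1r].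
have pu n : proj (sval (u n)) by case: (VM _ (svalP (u n))).
have [Q [hQ pQ Qu]] := proj_limit pu us.
have VQ : V Q by apply: Vlim hQ => // n; apply: svalP.
exists Q; split=> // [|r Mr pr Qr VQr]; first by have := Qu 0%N; rewrite u0.
apply: contrapT => r0; have tr := tp_gt0 Mr pr r0.
have [n hn] := ud _ tr.
have ur : sval (u n) * r = 0.
  by rewrite -(proj_leC (pu n) pQ (Qu n)) -mulrA Qr mulr0.
(* The enlargement is made at [u n] instead of at [Q]: there the greedy bound says that every gain
   stays below [t r]. *)
have Vur : V (sval (u n) + r) by apply: Vher (Qu n) _ _ _ VQr => //; apply: svalP.
have := hn (exist _ _ Vur); rewrite /step /=.
have -> : (sval (u n) + r) * sval (u n) = sval (u n).
  by rewrite mulrDl (proj_orthC pr (pu n) ur) addr0; case: (pu n).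
have Mu : M (sval (u n)) by case: (VM _ (svalP (u n))).
by rewrite (ttD tf) // ltxx => /(_ erefl).
Qed.

(** * Fine partitions commuting with a hermitian element *)

Section RelativeCommutant.
Variable x : bop H.
Context (Mx : M x) (sx : x^* = x).

Definition relcomm : set (bop H) := M `&` [set a | a * x = x * a].

Lemma relcomm_closed : closed_class relcomm.
Proof. by apply: closed_classI; [exact: tf_closed tf | exact: closed_class_commutant]. Qed.

(** If [x p] is not a multiple of [p], some spectral projection of it works. If it is, every
    subprojection of [p] in [M] commutes with [x], and [p M p], not being abelian, contains a
    nonscalar hermitian element to cut. *)
Lemma relcomm_diffuse p : relcomm p -> proj p -> p <> 0 -> exists q,
  [/\ relcomm q, proj q, p * q = q, q <> 0 & q <> p].
Proof.
move=> [Mp px] pp p0; have [sp p2] := pp.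
have [[r xp]|nonsc] := pselect (exists r, x * p = r **: p); last first.
  have [|||r h|q [pq pq' q0 qp Sq]] := @nonscalar_subproj _ _ _ hip (x * p) p.
  - by rewrite starM sx sp.
  - exact: pp.
  - by rewrite -mulrA p2.
  - by apply: nonsc; exists r.
  exists q; split=> //; apply: Sq relcomm_closed _ _ => //.
  by split; [exact: tfM | rewrite /= -mulrA px].
have [d [Md sd dp nd]] : exists d, [/\ M d, d^* = d, d * p = d & forall r, d <> r **: p].
  apply: contrapT => none.
  have sc d : M d -> d^* = d -> d * p = d -> exists r, d = r **: p.
    move=> Md sd dp; apply: contrapT => h; apply: none; exists d; split=> // r' h'.
    by apply: h; exists r'.
  (* If all hermitian elements of the corner are scalar, so is every [p a p], through its two
     hermitian parts; the corner is then abelian. *)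
  have corner a : M a -> exists z : R[i], p * a * p = z *: p.
    move=> Ma; set f := p * a * p; have Mf : M f by apply: tfM => //; apply: tfM.
    have fp : f * p = f by rewrite /f -!mulrA p2.
    have fsp : f^* * p = f^* by rewrite /f !starM sp -!mulrA p2.
    have Mfs : M f^* by apply: (tf_star tf).
    have [|||r1 e1] := sc (f + f^*).
    - exact: tfD.
    - by rewrite starD starK addrC.
    - by rewrite mulrDl fp fsp.
    have [|||r2 e2] := sc ('i%C *: (f - f^*)).
    - by apply: (tf_i tf); apply: tfB.
    - by rewrite star_i starB starK -scalerN opprB.
    - by rewrite -bop_scaleAl mulrBl fp fsp.
    exists ((2^-1)%:C * (r1%:C - 'i%C * r2%:C)).
    have : f + f = (r1%:C - 'i%C * r2%:C) *: p.
      rewrite scalerBl -scalerA -[r1%:C *: p]e1 -[r2%:C *: p]e2.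
      have -> : 'i%C *: ('i%C *: (f - f^*)) = - (f - f^*).
        by rewrite scalerA -expr2 sqr_i scaleN1r.
      by rewrite opprK addrACA subrr addr0.
    by rewrite -scalerA => <-; rewrite scalerDr -!/(scalr _ _) halfD.
  apply: p0; apply: (tf_diffuse tf) => // a b Ma Mb.
  have [z ->] := corner a Ma; have [z' ->] := corner b Mb.
  by rewrite -!bop_scaleAl -!bop_scaleAr !scalerA [z * z']mulrC.
have [q [pq pq' q0 qp Sq]] := nonscalar_subproj sd pp dp nd.
exists q; split=> //; split; first by apply: Sq (tf_closed tf) _ _.
have xq : x * q = r **: q by rewrite -pq' mulrA xp scalrAl.
have : (x * q)^* = r **: q by rewrite xq scalr_star pq.1.
by rewrite starM sx pq.1 /= xq.
Qed.

(** Of two complementary pieces of a projection one has at most half the trace; halving is repeated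
    until [2 ^ n] reaches [t p / d]. *)
Lemma relcomm_small p (d : R) : relcomm p -> proj p -> p <> 0 -> 0 < d ->
  exists q, [/\ relcomm q, proj q, p * q = q, q <> 0 & t q <= d].
Proof.
move=> Np pp p0 d0.
have halve q : relcomm q -> proj q -> q <> 0 -> exists q',
    [/\ relcomm q', proj q', q * q' = q', q' <> 0 & t q' <= t q / 2].
  move=> Nq pq q0; have [q' [Nq' pq' qq' q'0 q'q]] := relcomm_diffuse Nq pq q0.
  have [h|h] := leP (t q') (t q / 2); first by exists q'.
  exists (q - q'); split; first exact: closed_classB relcomm_closed _ _.
  - exact: projB.
  - by rewrite mulrBr pq.2 qq'.
  - by move/eqP; rewrite subr_eq0 => /eqP /esym.
  - by rewrite ttB; [lra | case: Nq | case: Nq'].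
have iter_halve n : exists q, [/\ relcomm q, proj q, p * q = q, q <> 0 & t q * 2 ^+ n <= t p].
  elim: n => [|n [q [Nq pq pq' q0 tq]]].
    by exists p; split=> //; [case: pp | rewrite expr0 mulr1].
  have [q' [Nq' pq1 qq' q'0 tq']] := halve q Nq pq q0.
  exists q'; split=> //; first by rewrite -qq' mulrA pq'.
  have n0 : 0 <= 2 ^+ n :> R by rewrite exprn_ge0.
  by rewrite exprS; move: tq tq'; move: (2 ^+ n) n0 => N N0; nra.
pose n := Num.bound (t p / d).
have [q [Nq pq pq' q0 tq]] := iter_halve n.
exists q; split=> //.
have tp : 0 <= t p / d.
  by apply: divr_ge0; [apply: tp_ge0 => //; case: Np | exact: ltW].
have := archi_boundP tp; rewrite -/n ltr_pdivrMr // => h.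
have n2 : n%:R <= 2 ^+ n :> R by rewrite -natrX ler_nat ltnW // ltn_expl.
have q1 : 0 <= t q by apply: tp_ge0 => //; case: Nq.
rewrite leNgt; apply/negP => dq.
have : n%:R * d <= 2 ^+ n * t q by rewrite ler_pM // ?ler0n ltW.
by rewrite mulrC; lra.
Qed.

(** A maximal subprojection of trace at most [d] has trace at least [d / 2], since otherwise a piece
    of the remainder of trace at most [d / 2] could be added. The lower bound is what makes the
    partition below finite. *)
Lemma relcomm_interval p (d : R) : relcomm p -> proj p -> 0 < d -> d <= t p ->
  exists q, [/\ relcomm q, proj q, p * q = q, d / 2 <= t q & t q <= d].
Proof.
move=> Np pp d0 dp.
pose V := [set q | [/\ relcomm q, proj q, p * q = q & t q <= d]].
have Mp : M p by case: Np.
have [|||u Q r|Q [[NQ pQ pQ' tQ] _ Qmax]] := @maximal_projection V 0.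
- by move=> q [[]].
- by split; rewrite ?mulr0 ?tt0 ?ltW //; [split; [exact: tf0 | rewrite /= mulr0 mul0r] | exact: proj_zero].
- move=> u Q Vu us uQ.
  have pu n : proj (u n) by case: (Vu n).
  have Mu n : M (u n) by case: (Vu n) => [[]].
  split.
  - have [_ _ _ _ L] := relcomm_closed; apply: L uQ => n; by case: (Vu n).
  - have [Q' [uQ' pQ' _]] := proj_limit pu us.
    by rewrite (sconv_uniq uQ uQ').
  - apply: sconv_uniq (sconvMl p uQ) _; move: uQ; congr sconv; apply/funext => n.
    by case: (Vu n).
  - by apply: (tt_normal tf Mu pu us uQ) => n; case: (Vu n).
- move=> [Nu pu pu' tu] [NQ pQ pQ' tQ] Qu Mr pr Qr [NQr pQr pQr' tQr].
  have ur : u * r = 0 by rewrite -(proj_leC pu pQ Qu) -mulrA Qr mulr0.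
  have pr' : p * r = r.
    by move: pQr'; rewrite mulrDr pQ' => /addrI.
  have Nr : relcomm r by rewrite -(addKr Q r) addrC; apply: closed_classB relcomm_closed _ _.
  have [_ ND _ _ _] := relcomm_closed.
  split; [exact: ND | exact: projD (proj_orthC pr pu ur) | by rewrite mulrDr pu' pr' |].
  have [Mu _] := Nu; have [MQ _] := NQ.
  by apply: le_trans tQr; rewrite !(ttD tf) // lerD2r; apply: tp_le.
exists Q; split=> //; rewrite leNgt; apply/negP => hQ.
have MQ : M Q by case: NQ.
have NpQ : relcomm (p - Q) by apply: closed_classB relcomm_closed _ _.
have ppQ : proj (p - Q) by apply: projB.
have pQ0 : p - Q <> 0.
  by move=> h; have := ttB Mp MQ; rewrite h tt0; lra.
have d2 : 0 < d / 2 by lra.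
have [r [Nr pr pr' r0 tr]] := relcomm_small NpQ ppQ pQ0 d2.
have Mr : M r by case: Nr.
have Qr : Q * r = 0.
  by rewrite -pr' mulrA mulrBr pQ.2 (proj_leC pQ pp pQ') subrr mul0r.
apply: r0; apply: Qmax => //; have [_ ND _ _ _] := relcomm_closed.
split; [exact: ND | exact: projD (proj_orthC pr pQ Qr) | |by rewrite (ttD tf) //; lra].
rewrite mulrDr pQ'; congr (_ + _).
by rewrite -{1}pr' mulrA mulrBr pp.2 pQ' pr'.
Qed.

Definition orthogonal_proj (s : seq (bop H)) :=
  (forall q, q \in s -> proj q) /\ pairwise (fun p q => p * q == 0) s.

(** Induction on the number of steps [d / 2] in the trace of [p]; each extracted piece uses up at
    least one. *)
Lemma relcomm_partition (d : R) : 0 < d -> exists s : seq (bop H),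
  [/\ orthogonal_proj s, forall q, q \in s -> relcomm q /\ t q <= d
    & \sum_(q <- s) q = 1].
Proof.
move=> d0.
suff h k p : relcomm p -> proj p -> t p <= k%:R * (d / 2) -> exists s : seq (bop H),
    [/\ orthogonal_proj s, forall q, q \in s -> [/\ relcomm q, t q <= d & p * q = q]
      & \sum_(q <- s) q = p].
  pose k := Num.bound (1 / (d / 2)).
  have [|||s [os hs ss]] := h k 1.
  - by split; [exact: tf1 | rewrite /= mulr1 mul1r].
  - exact: proj_one.
  - have : 0 <= 1 / (d / 2) by rewrite divr_ge0 // divr_ge0 // ltW.
    by move=> /archi_boundP; rewrite -/k ltr_pdivrMr ?divr_gt0 // (tt1 tf) => /ltW.
  by exists s; split=> // q /hs[].
elim: k p => [|k ih] p Np pp tp; last have [tpd|tpd] := leP (t p) d.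
- exists [::]; split; rewrite ?big_nil //; apply/esym/tp_eq0 => //; first by case: Np.
  apply/eqP; rewrite eq_le tp_ge0 ?andbT //; last by case: Np.
  by rewrite mul0r in tp.
- exists [:: p]; split; rewrite ?big_seq1 //.
    by split=> // q; rewrite inE => /eqP ->.
  by move=> q; rewrite inE => /eqP ->; split=> //; case: pp.
have [q [Nq pq pq' tq1 tq2]] := relcomm_interval Np pp d0 (ltW tpd).
have [|||s [os hs ss]] := ih (p - q).
- exact: closed_classB relcomm_closed _ _.
- exact: projB.
- rewrite ttB; [|by case: Np|by case: Nq].
  by move: tp; rewrite -natr1 mulrDl mul1r; lra.
have qpq : q * (p - q) = 0 by rewrite mulrBr (proj_leC pq pp pq') pq.2 subrr.
exists (q :: s); split; last by rewrite big_cons ss addrC subrK.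
- split; first by move=> q'; rewrite inE => /orP[/eqP ->//|/os.1].
  rewrite /= os.2 andbT; apply/allP => q' /hs[_ _ <-].
  by rewrite mulrA qpq mul0r.
- move=> q'; rewrite inE => /orP[/eqP ->|/hs[? ? e]]; first by split.
  split=> //; rewrite -e mulrA mulrBr pp.2 pq'; congr (_ * _).
Qed.

End RelativeCommutant.
End FactorProjections.

(** * Comparison of projections *)

Section Comparison.
Context (R : realType) (H : completeNormedModType R[i])
        (ip : {dot H for Num.conj}) (hip : hilbert_inner_product ip).
Local Notation rip := (re_ip ip).
Local Notation "a ^*" := (star hip a) : ring_scope.
Local Notation "r **: a" := (scalr r a) (at level 40).
Local Notation positive := (positive hip).
Local Notation effect := (effect hip).
Local Notation proj := (proj hip).
Implicit Types (a b c e p q w x y z : bop H) (r : R) (S : set (bop H)).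
Context (M : set (bop H)) (t : bop H -> R) (tf : traced_factor hip M t).

Lemma star_eq0 a : a^* = 0 -> a = 0.
Proof. by move=> h; rewrite -(starK hip a) h star0. Qed.

(* The elements [y] with [p M y = y M p = 0] form a two-sided ideal; its
   largest projection is central. *)
Lemma factor_corner p q : M p -> M q -> proj p -> proj q -> p <> 0 -> q <> 0 ->
  exists2 a, M a & p * a * q <> 0.
Proof.
move=> Mp Mq pp pq p0 q0; apply: contrapT => none.
have {}none a : M a -> p * a * q = 0.
  by move=> Ma; apply: contrapT => h; apply: none; exists a.
pose I := [set y | M y /\ forall a, M a -> p * a * y = 0 /\ y * a * p = 0].
have Istar y : I y -> I y^*.
  move=> [My hy]; split=> [|a Ma]; first exact: (tf_star tf).
  have [h1 h2] := hy _ (tf_star tf Ma); split.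
    by apply: star_eq0; rewrite !starM starK pp.1 mulrA h2.
  by apply: star_eq0; rewrite !starM starK pp.1 mulrA h1.
have Imul a y : M a -> I y -> I (y * a) /\ I (a * y).
  move=> Ma [My hy]; split; split; try exact: (tfM tf).
    move=> b Mb; have [h1 _] := hy b Mb; have [_ h2] := hy _ (tfM tf Ma Mb).
    by rewrite mulrA h1 mul0r -[y * a * b]mulrA h2.
  move=> b Mb; have [h1 _] := hy _ (tfM tf Mb Ma); have [_ h2] := hy b Mb.
  by rewrite mulrA -[p * b * a]mulrA h1 -!mulrA [y * _]mulrA h2 mulr0.
have Iq : I q.
  split=> // a Ma; split; first exact: none.
  apply: star_eq0; rewrite !starM pp.1 pq.1 mulrA none //.
  exact: (tf_star tf).
have ID y y' : I y -> I y' -> I (y + y').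
  move=> [My hy] [My' hy']; split=> [|a Ma]; first exact: (tfD tf).
  have [h1 h2] := hy a Ma; have [h1' h2'] := hy' a Ma.
  by rewrite mulrDr !mulrDl h1 h2 h1' h2' addr0.
have [|||u Q s|Q [[IQ pQ] Qq Qmax]] :=
    @maximal_projection _ _ _ _ _ _ tf (I `&` proj) q.
- by move=> y [[My _] py].
- by split.
- move=> u Q Iu us uQ; have pu n : proj (u n) by case: (Iu n).
  split; last by have [Q' [uQ' pQ' _]] := proj_limit pu us; rewrite (sconv_uniq uQ uQ').
  split=> [|a Ma]; first by apply: (tf_lim tf) uQ => n; case: (Iu n) => [[]].
  split.
    apply: sconv_uniq (sconvMl (p * a) uQ) _.
    have := sconv_cst (0 : bop H); congr sconv; apply/funext => n.
    by have [[_ /(_ a Ma)[-> _]] _] := Iu n.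
  rewrite -mulrA; apply: sconv_uniq (sconvMr (a * p) uQ) _.
  have := sconv_cst (0 : bop H); congr sconv; apply/funext => n.
  by have [[_ /(_ a Ma)[_ h]] _] := Iu n; rewrite mulrA h.
- move=> [Iu pu] [IQ pQ] Qu Ms ps Qs [IQs pQs].
  have us : u * s = 0 by rewrite -(proj_leC pu pQ Qu) -mulrA Qs mulr0.
  split; last exact: projD (proj_orthC ps pu us).
  apply: ID => //; have -> : s = s * (Q + s) by rewrite mulrDr (proj_orthC ps pQ Qs) add0r ps.2.
  by case: (Imul s (Q + s) Ms IQs).
have MQ : M Q by case: IQ.
(* For [z = y (1 - Q)] the support projection [1 - e] of [z^* z] lies in the ideal and is orthogonal
   to [Q], so maximality makes it vanish and [z = 0]. *)
have Q_unit y : I y -> y * Q = y.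
  move=> Iy; apply/eqP; rewrite eq_sym -subr_eq0 -{1}[y]mulr1 -mulrBr; apply/eqP.
  set z := y * (1 - Q).
  have Iz : I z by case: (Imul (1 - Q) y) => //; apply: (tfB tf) => //; apply: (tf1 tf).
  have Mz : M z by case: Iz.
  pose c := z^* * z.
  have Ic : I c by case: (Imul z^* z) => //; apply: (tf_star tf).
  have sc : c^* = c by rewrite starM starK.
  have [e [pe ce he Se]] := kernel_proj sc.
  have Mc : M c by case: Ic.
  have Me : M e by apply: Se (tf_closed tf) Mc.
  have zQ : z * Q = 0 by rewrite -mulrA mulrBl mul1r pQ.2 subrr mulr0.
  have eQ : e * Q = Q by apply: he; rewrite -mulrA zQ mulr0.
  have eap a : M a -> e * (a * p) = a * p.
    by move=> Ma; apply: he; case: Ic => _ /(_ a Ma)[_]; rewrite mulrA.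
  have rap a : M a -> (1 - e) * a * p = 0.
    by move=> Ma; rewrite -mulrA mulrBl mul1r eap // subrr.
  have par a : M a -> p * a * (1 - e) = 0.
    move=> Ma; apply: star_eq0; rewrite !starM starB star1 pp.1 pe.1 mulrA rap //.
    exact: (tf_star tf).
  have M1e : M (1 - e) by apply: (tfB tf) => //; apply: (tf1 tf).
  have e1 : 1 - e = 0.
    have Q1e : Q * (1 - e) = 0.
      by apply: (proj_orthC pQ (projC pe)); rewrite mulrBl mul1r eQ subrr.
    apply: Qmax => //; first exact: projC.
    split; last exact: (projD pQ (projC pe) (proj_orthC (projC pe) pQ Q1e)).
    by apply: ID => //; split=> // a Ma; split; [exact: par | exact: rap].
  have : c = 0 by rewrite -[c]mulr1 -[1](subrK e) e1 add0r ce.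
  exact: (@star_mul_eq0 _ _ _ hip).
(* [Q] is a right unit of the ideal and, by adjoints, a left one: [Q a = Q a Q = a Q]. As a scalar
   idempotent it is [0] or [1], contradicting [q <> 0] or [p <> 0]. *)
have Q_central a : M a -> Q * a = a * Q.
  move=> Ma; have [IQa IaQ] := Imul a Q Ma IQ.
  rewrite -(Q_unit _ IQa); have /Q_unit := Istar _ IaQ.
  by move=> /(congr1 (star hip)); rewrite starM !starK pQ.1 mulrA => <-.
have [c Qc] := tf_center tf MQ Q_central.
have c2 : (c * c - c) *: (1 : bop H) = 0.
  by have := pQ.2; rewrite Qc -bop_scaleAl mul1r scalerA scalerBl => ->; rewrite subrr.
have [c0|c0] := eqVneq c 0.
  by apply: q0; rewrite -Qq Qc c0 scale0r mul0r.
have [c1|c1] := eqVneq c 1.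
  have [_ /(_ 1 (tf1 tf))[h _]] := IQ; apply: p0.
  by rewrite -h Qc c1 scale1r !mulr1.
apply: (tf_neq0 tf); have cc : c * c - c != 0.
  by rewrite -{3}[c]mulr1 -mulrBr mulf_neq0 // subr_eq0.
by rewrite -[LHS]scale1r -(mulVf cc) -scalerA c2 scaler0.
Qed.

Lemma partial_isometryE (v : bop H) : proj (v^* * v) -> v * (v^* * v) = v.
Proof.
set e := v^* * v => pe; apply/esym/eqP; rewrite -subr_eq0 -{1}[v]mulr1 -mulrBr; apply/eqP.
apply: (@star_mul_eq0 _ _ _ hip).
rewrite starM starB star1 pe.1 mulrA -[_ * v^* * v]mulrA -/e.
by rewrite mulrBl mul1r pe.2 subrr mul0r.
Qed.

Lemma final_proj (v : bop H) : proj (v^* * v) -> proj (v * v^*).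
Proof.
move=> pe; split; first by rewrite starM starK.
by rewrite mulrA -[v * v^* * v]mulrA partial_isometryE.
Qed.

(* [v = x e |x| ^ -1], where [e] is a spectral projection of [|x|] away from
   [0] and [x] is a nonzero element of [p M q]. *)
Lemma factor_partial_isometry p q : M p -> M q -> proj p -> proj q ->
  p <> 0 -> q <> 0 -> exists v,
  [/\ M v, v <> 0, proj (v^* * v), p * v = v & v * q = v].
Proof.
move=> Mp Mq pp pq p0 q0; have [a0 Ma0 ha0] := factor_corner Mp Mq pp pq p0 q0.
have [x [Mx x0 px xq cx]] : exists x,
    [/\ M x, x <> 0, p * x = x, x * q = x & contraction x].
  have [r r0 cr] := bop_scale_contraction (p * a0 * q).
  exists (r **: (p * a0 * q)); split=> //.
  - by apply: (tfZ tf); apply: (tfM tf) => //; apply: (tfM tf).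
  - move/(congr1 (scalr r^-1)); rewrite scalrVK ?gt_eqF // scalr0.
    exact: ha0.
  - by rewrite scalrAr !mulrA pp.2.
  - by rewrite scalrAl -!mulrA pq.2.
have [sq q2] := pq.
pose c := x^* * x; have Mc : M c by apply: (tfM tf) => //; apply: (tf_star tf).
have pc : positive c by apply: positive_star_mul.
have ec : effect c.
  apply: contraction_effect => // v; rewrite bopME.
  have cxs : nrm (x^* (x v)) ^+ 2 <= nrm (x^* (x v)) * nrm (x v).
    rewrite -(rip_nrm hip) -starP ripC.
    by apply: le_trans (rip_le hip _ _) _; rewrite mulrC ler_wpM2r ?nrm_ge0.
  have [h|h] := eqVneq (nrm (x^* (x v))) 0; first by rewrite h nrm_ge0.
  apply: le_trans (cx v); have h0 : 0 < nrm (x^* (x v)) by rewrite lt_def h nrm_ge0.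
  by rewrite -(ler_pM2l h0) -expr2.
have e1c : effect (1 - c) by split; [case: ec | rewrite subKr].
have [u [eu u2 Su]] := effect_sqrt e1c.
(* [b] is the absolute value of [x]. *)
pose b := 1 - u.
have eb : effect b by split; [case: eu | rewrite subKr; case: eu].
have b2 : b * b = c by rewrite /b u2 subKr.
have Mb : M b.
  by apply: (tfB tf); [exact: (tf1 tf) | apply: Su (tf_closed tf) _; apply: (tfB tf) => //; exact: (tf1 tf)].
have sb : b^* = b by case: eb => [[]].
clearbody b.
have b0 : b <> 0.
  move=> h; apply: x0; apply: (@star_mul_eq0 _ _ _ hip).
  by rewrite -/c -b2 h mulr0.
(* If the cut of [b] at every level [0 < d <= 1 / 2] were zero, [b <= d] would hold for all of them
   and [b] would vanish. *)
have [d [e [d0 d1 [pe be e1 e2 Se] e0]]] : exists (d : R) e, [/\ 0 < d, d <= 2^-1,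
   [/\ proj e, (b - d **: 1) * e = e * (b - d **: 1), positive ((b - d **: 1) * e),
       positive (- ((b - d **: 1) * (1 - e)))
     & forall S, closed_class S -> S (b - d **: 1) -> S e] & e <> 0].
  apply: contrapT => none; apply: b0.
  apply: (positive_antisym (hip := hip)); first by case: eb.
  split=> [|v]; first by rewrite starN sb.
  rewrite leNgt; apply/negP => h.
  pose d := Num.min 2^-1 (- rip ((- b) v) v / (2 * (nrm v ^+ 2 + 1))).
  have n1 : 0 < 2 * (nrm v ^+ 2 + 1) by have := sqr_ge0 (nrm v); lra.
  have d0 : 0 < d by rewrite lt_min invr_gt0 ltr0n divr_gt0 // oppr_gt0.
  have dv : d * (2 * (nrm v ^+ 2 + 1)) <= - rip ((- b) v) v.
    by rewrite -ler_pdivlMr // ge_min lexx orbT.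
  have [|e [pe be e1 e2 Se]] := @spectral_cut _ _ _ hip (b - d **: 1).
    by rewrite starB scalr_star star1 sb.
  have [e0|e0] := pselect (e = 0).
    have [_ /(_ v)] := e2; rewrite e0 subr0 mulr1 bopNE ripNl bopBE ripBl scalrE ripZl bop1E (rip_nrm hip).
    by move: dv h; rewrite bopNE ripNl; have := sqr_ge0 (nrm v); nra.
  by apply: none; exists d, e; split=> //; rewrite /d ge_min lexx.
have Me : M e.
  apply: Se (tf_closed tf) _; apply: (tfB tf) => //; apply: (tfZ tf); exact: (tf1 tf).
have comm_e y : b * y = y * b -> e * y = y * e.
  move=> h; apply: (Se _ (closed_class_commutant y)).
  by rewrite /= mulrBl mulrBr scalrAl scalrAr mul1r mulr1 h.
have bE : b * e = e * b by rewrite comm_e.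
(* [b'] is [b] on the range of [e] and [1] on its complement, so it lies between [d] and [1]; its
   inverse [k] inverts [b] on the range of [e]. *)
pose b' := b * e + (1 - e).
have sb' : b'^* = b' by rewrite starD starM starB star1 pe.1 sb -bE.
have w_eq : 1 - b' = e^* * (1 - b) * e.
  by rewrite /b' opprD opprB addrCA [1 + (e - 1)]addrC subrK pe.1 mulrBr mulr1 mulrBl pe.2 -bE -mulrA pe.2 addrC.
have pw : positive (1 - b') by rewrite w_eq; apply: positive_conj; case: eb.
have hw v : nrm ((1 - b') v) <= (1 - d) * nrm v.
  apply: (positive_norm_le (hip := hip)) => //; first lra.
  move=> {}v; rewrite w_eq !bopME starP starK.
  have bde : ((b - d **: 1) * e) (e v) = b (e v) - d%:C *: e v.
    by rewrite bopME -[e (e v)]bopME pe.2 bopBE scalrE bop1E.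
  have := e1.2 (e v); rewrite bde bopBE bop1E !ripBl ripZl !(rip_nrm hip) => h.
  have := effect_contraction (proj_effect pe) v; have := nrm_ge0 (e v) => h1 h2.
  have : nrm (e v) ^+ 2 <= nrm v ^+ 2 by rewrite ler_pXn2r ?nnegrE ?nrm_ge0.
  by move: (nrm (e v) ^+ 2) (nrm v ^+ 2) h => X Y h h3; nra.
have d1' : d <= 1 by lra.
have [k [sk bk Sk]] := positive_inverse d0 d1' pw hw.
have Mk : M k.
  apply: Sk (tf_closed tf) _; apply: (tfD tf); first exact: (tfM tf).
  by apply: (tfB tf) => //; exact: (tf1 tf).
have eb' : e * b' = e * b by rewrite mulrDr mulrBr mulr1 pe.2 subrr addr0 bE mulrA pe.2.
have be' : b' * e = e * b by rewrite mulrDl mulrBl mul1r pe.2 subrr addr0 -mulrA pe.2 bE.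
have kb : k * b' = 1.
  by rewrite -bk; apply: (Sk _ (closed_class_commutant b')).
have ke : k * e = e * k.
  by apply: (Sk _ (closed_class_commutant e)); rewrite /= be' eb'.
have vv : (x * e * k)^* * (x * e * k) = e.
  rewrite !starM sk pe.1 -!mulrA [x^* * _]mulrA -/c -b2.
  have -> : k * (e * (b * b * (e * k))) = k * (b' * e) * ((e * b') * k).
    by rewrite be' eb' -!mulrA; congr (k * (e * (b * _))); rewrite !mulrA bE.
  by rewrite !mulrA kb mul1r pe.2 -mulrA bk mulr1.
exists (x * e * k); split.
- by apply: (tfM tf) => //; apply: (tfM tf).
- by move=> h; apply: e0; rewrite -vv h mulr0.
- by rewrite vv.
- by rewrite !mulrA px.
(* [b] vanishes on the range of [1 - q], where [(b - d) e] is thus [- d e]; its positivity forces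
   [e (1 - q) = 0]. *)
have eq_e : e * q = e.
  have bq : b * (1 - q) = 0.
    apply: (@star_mul_eq0 _ _ _ hip); rewrite starM sb starB star1 sq.
    rewrite -mulrA [b * (b * _)]mulrA b2 /c -mulrA mulrBr mulr1 xq subrr.
    by rewrite !mulr0.
  have qb : (1 - q) * b = 0 by apply: star_eq0; rewrite starM sb starB star1 sq.
  have eq1 : e * (1 - q) = 0.
    apply: bop_ext => v; apply: nrm_eq0; apply/eqP.
    have [_ /(_ ((1 - q) v))] := e1.
    have -> : ((b - d **: 1) * e) ((1 - q) v) = - (d%:C *: e ((1 - q) v)).
      rewrite -[LHS]bopME -mulrA comm_e ?bq ?qb // mulrA mulrBl bq sub0r.
      by rewrite scalrAl mul1r mulNr scalrAl bopNE scalrE -comm_e ?bq ?qb.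
    rewrite ripNl ripZl (proj_form _ pe) oppr_ge0 => h.
    rewrite bopME -sqrf_eq0 eq_le sqr_ge0 andbT.
    by rewrite -(ler_pM2l d0) mulr0.
  by rewrite -[RHS]mulr1 -[1 in RHS](subrK q) mulrDr eq1 add0r.
by rewrite -[X in X * q]partial_isometryE vv // -mulrA eq_e -{2}vv partial_isometryE // vv.
Qed.

Lemma sconv_shift (u : nat -> bop H) Q n : sconv u Q -> sconv (fun k => u (k + n)%N) Q.
Proof.
move=> hQ v d /(hQ v)[N hN]; exists N => k Nk; apply: hN.
exact: leq_trans Nk (leq_addr _ _).
Qed.

(** The squared distance of [w m v] and [w n v] is exactly the growth of the form of the initial
    projection, which serves as the potential. *)
Lemma isometry_strong_limit (w : nat -> bop H) : (forall n, proj ((w n)^* * w n)) ->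
  (forall n m, (n <= m)%N ->
    (w m)^* * w n = (w n)^* * w n /\ (w n)^* * w m = (w n)^* * w n) ->
  (forall n, contraction (w n)) /\ exists v, sconv w v.
Proof.
move=> pw hw; have nE a v : nrm (a v) ^+ 2 = rip ((a^* * a) v) v.
  by rewrite bopME -(rip_nrm hip) [RHS]starP starK.
have cw n : contraction (w n).
  move=> v; rewrite -(ler_pXn2r (n := 2)) ?nnegrE ?nrm_ge0 // nE.
  exact: effect_le (proj_effect (pw n)).
split=> //; apply: (@strong_limit _ _ w
  (fun n v => rip (((w n)^* * w n) v) v) (fun v => nrm v ^+ 2)) => // [n m v nm|n v].
  have [h1 h2] := hw n m nm.
  rewrite -bopBE nE -ripBl -bopBE starB mulrBl !mulrBr h1 h2.
  by rewrite subrr subr0.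
exact: effect_le (proj_effect (pw n)).
Qed.

(** The hypotheses express that [v] extends the partial isometry [w], seen from the initial and from
    the final space of [w]. *)
Lemma extension_facts w v : proj (w^* * w) ->
  v * (w^* * w) = w -> (w * w^*) * v = w ->
  [/\ v^* * w = w^* * w, v * w^* = w * w^*, (v^* * v) * (w^* * w) = w^* * w
    & (v * v^*) * (w * w^*) = w * w^*].
Proof.
set e := w^* * w; set g := w * w^*; move=> pe k1 k2.
have pg : proj g by apply: final_proj.
have we : w * e = w by apply: partial_isometryE.
have gw : g * w = w by rewrite /g -mulrA we.
have ews : e * w^* = w^* by rewrite -[in RHS]we starM pe.1.
have k3 : v^* * g = w^* by rewrite -[in RHS]k2 starM pg.1.
have k4 : v^* * w = e by rewrite -{1}gw mulrA k3.
have k5 : v * w^* = g by rewrite -ews mulrA k1.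
split=> //; first by rewrite -mulrA k1 k4.
by rewrite -mulrA k3 k5.
Qed.

(** The adjoints form an increasing sequence of partial isometries too, so both [u] and its adjoints
    converge strongly; only then do the initial projections converge to that of the limit. *)
Lemma isometry_limit (u : nat -> bop H) : (forall n, proj ((u n)^* * u n)) ->
  (forall n, u n.+1 * ((u n)^* * u n) = u n) ->
  (forall n, (u n * (u n)^*) * u n.+1 = u n) ->
  exists v, [/\ sconv u v, proj (v^* * v), forall n, v * ((u n)^* * u n) = u n
    & forall n, (u n * (u n)^*) * v = u n].
Proof.
move=> pu h1 h2; pose e n := (u n)^* * u n; pose g n := u n * (u n)^*.
have pe n : proj (e n) by apply: pu.
have pg n : proj (g n) by apply: final_proj.
have ue n : u n * e n = u n by apply: partial_isometryE.
have gu n : g n * u n = u n by rewrite /g -mulrA ue.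
have step2 n m := @extension_facts (u n) (u m) (pu n).
have step n k : u (k + n)%N * e n = u n /\ g n * u (k + n)%N = u n.
  elim: k => [|k [ih1 ih2]]; first by rewrite ue gu.
  have [_ _ ee gg] := step2 _ _ ih1 ih2; rewrite addSn; split.
    by rewrite -[e n]ee mulrA h1.
  by rewrite -(proj_leC (pg n) (pg (k + n)%N) gg) -mulrA [g (k + n)%N * _]h2.
have le n m : (n <= m)%N -> [/\ (u m)^* * u n = e n, u m * (u n)^* = g n & True].
  by move=> /subnK <-; have [k1 k2] := step n (m - n)%N; have [] := step2 _ _ k1 k2.
have [cu [v uv]] : (forall n, contraction (u n)) /\ exists v, sconv u v.
  apply: isometry_strong_limit => // n m /le[k _ _]; split=> //.
  by rewrite -[LHS](starK hip) [X in X^*]starM starK k (pe n).1.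
have [cus [v' uv']] : (forall n, contraction ((u n)^*)) /\ exists v, sconv (fun n => (u n)^*) v.
  apply: isometry_strong_limit => [n|n m /le[_ k _]]; rewrite !starK; first exact: pg.
  split=> //; rewrite -[LHS](starK hip) [X in X^*]starM starK k; exact: (pg n).1.
have vv' : v^* = v' by apply: (sconv_star uv uv').
have ev : sconv e (v^* * v) by rewrite vv'; apply: sconvM.
exists v; split=> // [|n|n].
- split; first by rewrite starM starK.
  apply: sconv_uniq (sconvM _ ev ev) _.
    by move=> n; apply: effect_contraction (proj_effect (pe n)).
  by move: ev; congr sconv; apply/funext => n; rewrite (pe n).2.
- apply: sconv_uniq (sconvMr (e n) (sconv_shift n uv)) _.
  by have := sconv_cst (u n); congr sconv; apply/funext => k; have [-> _] := step n k.
- apply: sconv_uniq (sconvMl (g n) (sconv_shift n uv)) _.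
  by have := sconv_cst (u n); congr sconv; apply/funext => k; have [_ ->] := step n k.
Qed.

(* Exhaustion: a partial isometry between the remainders would have been
   noticed by the greedy sequence. *)
Lemma comparison p q : M p -> M q -> proj p -> proj q -> t p <= t q ->
  exists v, [/\ M v, v^* * v = p & q * v = v].
Proof.
move=> Mp Mq pp pq tpq.
pose V := [set v | [/\ M v, proj (v^* * v), v * p = v & q * v = v]].
have V0 : V 0 by split; rewrite ?mulr0 ?mul0r //; [exact: (tf0 tf) | exact: proj_zero].
pose T := {v | V v}.
pose step (A B : T) := sval B * ((sval A)^* * sval A) = sval A /\
  (sval A * (sval A)^*) * sval B = sval A.
have Mi v : V v -> M (v^* * v).
  by case=> Mv _ _ _; apply: (tfM tf) => //; apply: (tf_star tf).
have [A|A|u [u0 us ud]] := @greedy_sequence R T step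
    (fun A => t ((sval A)^* * sval A)) 1 (exist _ 0 V0).
- have [_ pe _ _] := svalP A; split; first exact: partial_isometryE.
  by rewrite -mulrA partial_isometryE.
- have [Mv pv _ _] := svalP A; rewrite -(tt1 tf).
  by apply: (tp_le tf) => //; [exact: Mi (svalP A) | exact: (tf1 tf) | exact: proj_one | rewrite mul1r].
pose w n := sval (u n).
have Vw n : V (w n) by exact: svalP.
have [|n|n|v [wv pv vw wv']] := @isometry_limit w.
- by move=> n; case: (Vw n).
- by case: (us n).
- by case: (us n).
have Mv : M v by apply: (tf_lim tf) wv => n; case: (Vw n).
have vp : v * p = v.
  apply: sconv_uniq (sconvMr p wv) _.
  by move: wv; congr sconv; apply/funext => n; case: (Vw n).
have qv : q * v = v.
  apply: sconv_uniq (sconvMl q wv) _.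
  by move: wv; congr sconv; apply/funext => n; case: (Vw n).
exists v; split=> //; apply: contrapT => ne.
set e := v^* * v in pv ne; pose g := v * v^*.
have pg : proj g by apply: final_proj.
have Mvs : M v^* by apply: (tf_star tf).
have Me : M e by apply: (tfM tf).
have Mg : M g by apply: (tfM tf).
have pe : p * e = e by rewrite mulrA -{1}pp.1 -starM vp.
have qg : q * g = g by rewrite mulrA qv.
have teg : t g = t e by rewrite /g /e (ttC tf).
have ppe : proj (p - e) by apply: projB.
have pqg : proj (q - g) by apply: projB.
have Mpe : M (p - e) by apply: (tfB tf).
have Mqg : M (q - g) by apply: (tfB tf).
have pe0 : p - e <> 0 by move=> /eqP; rewrite subr_eq0 => /eqP h; apply: ne.
(* Traciality gives [t g = t e < t p <= t q], so a remainder is left in [q] as well. *)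
have qg0 : q - g <> 0.
  move=> h; have := tp_gt0 tf Mpe ppe pe0; have := ttB tf Mq Mg.
  by rewrite h (tt0 tf) (ttB tf) // teg; lra.
have [z [Mz z0 pz qz zp]] := factor_partial_isometry Mqg Mpe pqg ppe qg0 pe0.
have Mzz : M (z^* * z) by apply: (tfM tf) => //; apply: (tf_star tf).
have tz : 0 < t (z^* * z).
  by apply: (tp_gt0 tf) => // h; apply: z0; apply: (@star_mul_eq0 _ _ _ hip).
have [n hn] := ud _ tz.
have [Mw pw wp qw] := Vw n; pose en := (w n)^* * w n.
have [f1 f2 f3 f4] := extension_facts pw (vw n) (wv' n).
have gw : g * w n = w n.
  by rewrite -[in LHS](partial_isometryE pw) !mulrA -[g * w n * _]mulrA f4 -mulrA partial_isometryE.
have wsz : (w n)^* * z = 0.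
  rewrite -qz mulrA mulrBr -[X in _ * X - _]pq.1 -[X in _ - _ * X]pg.1 -!starM.
  by rewrite qw gw subrr mul0r.
have ews : e * (w n)^* = (w n)^*.
  have h : (w n)^* = en * (w n)^*.
    by rewrite -[in LHS](partial_isometryE pw) starM pw.1.
  by rewrite h mulrA f3.
have zws : z * (w n)^* = 0.
  have h : p * (w n)^* = (w n)^* by rewrite -{1}pp.1 -starM wp.
  by rewrite -zp -mulrA mulrBl ews h subrr mulr0.
have zsw : z^* * w n = 0 by apply: star_eq0; rewrite starM starK.
(* [z] goes from the remainder [p - e] to the remainder [q - g], hence is orthogonal to [w n] on
   both sides; adding it gains the full trace of [z^* z], which the choice of [n] excludes. *)
pose y := w n + z.
have yy : y^* * y = en + z^* * z.
  by rewrite /y starD mulrDl !mulrDr wsz zsw addr0 add0r.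
have Vy : V y.
  split; first exact: (tfD tf).
  - rewrite yy; apply: projD => //.
    by rewrite /en mulrA -[z^* * z * _]mulrA zws mulr0 mul0r.
  - rewrite mulrDl wp; congr (_ + _).
    by rewrite -{1}zp -mulrA mulrBl pp.2 (proj_leC pv pp pe) zp.
  - rewrite mulrDr qw; congr (_ + _).
    by rewrite -{1}qz mulrA mulrBr pq.2 qg qz.
have := hn (exist _ y Vy); rewrite /step /= -/(w n) -/en yy (ttD tf) //; last exact: Mi (Vw n).
rewrite ltxx => h; apply: notF; apply: h; split.
  by rewrite mulrDl /en partial_isometryE // mulrA zws mul0r addr0.
by rewrite mulrDr -!mulrA partial_isometryE // wsz mulr0 addr0.
Qed.

End Comparison.

(** * Packing blocks into hermitian operators *)

(** The square splits into increasing pairs, their transposes and the diagonal; the additive form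
    avoids truncated subtraction. *)
Lemma card_lt_pairs (T : finType) (A : {pred T}) :
  (2 * #|[pred ij : T * T | [&& ij.1 \in A, ij.2 \in A
            & (enum_rank ij.1 < enum_rank ij.2)%N]]| + #|A| = #|A| * #|A|)%N.
Proof.
pose lt (i j : T) : nat := (enum_rank i < enum_rank j)%N.
have -> : #|[pred ij : T * T | [&& ij.1 \in A, ij.2 \in A
            & (enum_rank ij.1 < enum_rank ij.2)%N]]| =
    (\sum_(i in A) \sum_(j in A) lt i j)%N.
  rewrite pair_big_dep /= -[LHS]sum1_card big_mkcond [RHS]big_mkcond /=.
  apply: eq_bigr => -[i j] _; rewrite !inE /= /lt.
  by case: (i \in A) => //=; case: (j \in A) => //=; case: ltnP.
have -> : #|A| = (\sum_(i in A) 1)%N by rewrite sum1_card.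
rewrite mulSn mul1n {2}exchange_big /= -!big_split /=.
rewrite big_distrl /=; apply: eq_bigr => i Ai; rewrite mul1n -big_split /=.
rewrite (bigD1 i) //= [RHS](bigD1 i) //= /lt ltnn add0n [RHS]addnC.
congr (_ + _)%N; apply: eq_bigr => j /andP[_ ji].
have : enum_rank i != enum_rank j by rewrite (inj_eq enum_rank_inj) eq_sym.
by rewrite -val_eqE /=; case: ltngtP.
Qed.

(** Elements are matched by their index in the two enumerations; [t0] is only the default of
    [nth]. *)
Lemma card_le_inj (S T : finType) (A : {pred S}) (B : {pred T}) (t0 : T) :
  (#|A| <= #|B|)%N ->
  exists f : S -> T, {in A &, injective f} /\ {in A, forall a, f a \in B}.
Proof.
move=> AB; exists (fun a => nth t0 (enum B) (index a (enum A))).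
have idx a : a \in A -> (index a (enum A) < size (enum B))%N.
  move=> Aa; rewrite -cardE; apply: leq_trans AB.
  by rewrite [X in (_ < X)%N]cardE index_mem mem_enum.
split=> [a a' Aa Aa'|a Aa]; last by rewrite -mem_enum mem_nth ?idx.
move=> /(congr1 (index^~ (enum B))); rewrite !index_uniq ?idx ?enum_uniq //.
by move=> h; rewrite -(nth_index a (s := enum A) (x := a)) ?mem_enum // h nth_index ?mem_enum.
Qed.

Section Blocks.
Context (R : realType) (H : completeNormedModType R[i])
        (ip : {dot H for Num.conj}) (hip : hilbert_inner_product ip).
Local Notation "a ^*" := (star hip a) : ring_scope.
Local Notation "r **: a" := (scalr r a) (at level 40).
Local Notation proj := (proj hip).
Implicit Types (a b c e p q w x y z : bop H) (r : R).

(** Neither a unit nor closedness is required: the generators are recovered by finitely many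
    algebraic operations, and a generated algebra is not assumed to contain [1]. *)
Definition star_alg (B : set (bop H)) : Prop :=
  [/\ B 0, forall a b, B a -> B b -> B (a + b),
      forall r a, B a -> B (r **: a), forall a b, B a -> B b -> B (a * b)
    & forall a, B a -> B a^*].

Context (B : set (bop H)) (hB : star_alg B).

Lemma alg0 : B 0. Proof. by case: hB. Qed.
Lemma algD a b : B a -> B b -> B (a + b). Proof. by case: hB => _ h _ _ _; apply: h. Qed.
Lemma algZ r a : B a -> B (r **: a). Proof. by case: hB => _ _ h _ _; apply: h. Qed.
Lemma algM a b : B a -> B b -> B (a * b). Proof. by case: hB => _ _ _ h _; apply: h. Qed.
Lemma algS a : B a -> B a^*. Proof. by case: hB => _ _ _ _ h; apply: h. Qed.
Lemma algB a b : B a -> B b -> B (a - b).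
Proof.
move=> Ba Bb; have := algD Ba (algZ (-1) Bb).
by rewrite /scalr rmorphN1 scaleN1r.
Qed.
Lemma alg_sum I (s : seq I) (P : pred I) (F : I -> bop H) :
  (forall i, P i -> B (F i)) -> B (\sum_(i <- s | P i) F i).
Proof. by move=> h; apply: (big_ind B) => //; [exact: alg0 | exact: algD]. Qed.

Lemma scalr_sumr I (s : seq I) (P : pred I) r (F : I -> bop H) :
  r **: (\sum_(i <- s | P i) F i) = \sum_(i <- s | P i) r **: F i.
Proof. exact: scaler_sumr. Qed.

Lemma scalr0l a : 0 **: a = 0.
Proof. by rewrite /scalr rmorph0 scale0r. Qed.

(* Lagrange interpolation without constant term, as [B] may not contain [1]. *)
Lemma diagonal_alg (T : finType) (e : T -> bop H) (l : T -> R) :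
  (forall i j, e i * e j = if i == j then e i else 0) -> injective l ->
  (forall i, l i != 0) -> B (\sum_i l i **: e i) -> forall i, B (e i).
Proof.
move=> he linj l0 BD i0; pose D := \sum_i l i **: e i.
(* The value at [l i] of the polynomial [X] times the product of the [X - m] for [m] in [s]; with
   all the other eigenvalues in [s] it leaves only [e i0]. *)
pose co (s : seq R) i := l i * \prod_(m <- s) (l i - m).
have De (f : T -> R) : D * \sum_i f i **: e i = \sum_i (l i * f i) **: e i.
  rewrite mulr_suml; apply: eq_bigr => i _; rewrite mulr_sumr (bigD1 i) //=.
  rewrite scalrAl scalrAr he eqxx scalrA big1 ?addr0 // => j ji.
  by rewrite scalrAl scalrAr he eq_sym (negbTE ji) !scalr0.
have key s : B (\sum_i co s i **: e i).
  elim: s => [|m s ih].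
    rewrite (_ : \sum_i _ = D) //; apply: eq_bigr => i _.
    by rewrite /co big_nil mulr1.
  have -> : \sum_i co (m :: s) i **: e i =
      D * (\sum_i co s i **: e i) - m **: (\sum_i co s i **: e i).
    rewrite De scalr_sumr -sumrB; apply: eq_bigr => i _.
    by rewrite scalrA -scalrBl /co big_cons; congr (_ **: _); ring.
  by apply: algB; [exact: algM | exact: algZ].
pose s := [seq l j | j <- enum T & j != i0].
have ne0 : co s i0 != 0.
  rewrite mulf_neq0 // prodf_seq_neq0; apply/allP => m /mapP[j].
  rewrite mem_filter => /andP[ji _] ->; rewrite /= subr_eq0.
  by rewrite (inj_eq linj) eq_sym.
have := algZ (co s i0)^-1 (key s); rewrite (bigD1 i0) //= big1.
  by rewrite addr0 scalrVK.
move=> i ii0; suff -> : co s i = 0 by rewrite scalr0l.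
rewrite /co (perm_big (l i :: rem (l i) s)) /=; last first.
  by apply: perm_to_rem; apply/mapP; exists i; rewrite // mem_filter ii0 mem_enum.
by rewrite big_cons subrr mul0r mulr0.
Qed.

End Blocks.

(** * Moving blocks to free positions *)

Section Placement.
Context (R : realType) (H : completeNormedModType R[i])
        (ip : {dot H for Num.conj}) (hip : hilbert_inner_product ip).
Local Notation "a ^*" := (star hip a) : ring_scope.
Local Notation "r **: a" := (scalr r a) (at level 40).
Local Notation proj := (proj hip).
Implicit Types (a b c e p q w x y z : bop H) (r : R).

(** [v i] carries the piece [E i] into the common projection [e], and onto it when [i] is full. A
    block between any two pieces thus passes through the corner of [e] and can be stored, without
    loss, between two full pieces. *)
Context (T : finType) (v : T -> bop H) (e : bop H) (full : {pred T}) (b0 : T).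
Context (ev : forall i, e * v i = v i)
  (vv : forall i j, i != j -> v i * (v j)^* = 0)
  (pv : forall i, proj ((v i)^* * v i))
  (sum_v : \sum_i (v i)^* * v i = 1)
  (fullv : forall i, i \in full -> v i * (v i)^* = e) (fb : b0 \in full).
Context (n : nat) (X : 'I_n -> bop H) (m : nat).

Let E i := (v i)^* * v i.

Definition nonzero_blocks : {pred 'I_n * T * T} :=
  [pred s | E s.1.2 * X s.1.1 * E s.2 != 0].
(** Strictly upper positions, so that a stored block never meets an adjoint. Row and column [b0]
    stay free for [base], and only full pieces can hold an arbitrary block. *)
Definition positions : {pred 'I_m * T * T} :=
  [pred s | [&& s.1.2 \in full, s.2 \in full, s.1.2 != b0, s.2 != b0
                 & (enum_rank s.1.2 < enum_rank s.2)%N]].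

Context (phi : 'I_n * T * T -> 'I_m * T * T)
  (phi_inj : {in nonzero_blocks &, injective phi})
  (phi_pos : {in nonzero_blocks, forall s, phi s \in positions}) (k0 : 'I_m).

(* The block [E i * X k * E j], moved to the position assigned by [phi]. *)
Definition moved s : bop H :=
  (v (phi s).1.2)^* * (v s.1.2 * X s.1.1 * (v s.2)^*) * v (phi s).2.
(* The partial isometry of [packed k0] in row [b0], a row without positions. *)
Definition base i : bop H := (v b0)^* * v i.
Definition packed k : bop H :=
  \sum_(s | (s \in nonzero_blocks) && ((phi s).1.1 == k)) (moved s + (moved s)^*) +
  (if k == k0 then \sum_(i | i != b0) (base i + (base i)^*) else 0).
(** The coefficients are distinct and, thanks to the successor, nonzero; without a unit, a
    projection with coefficient zero would be lost. *)
Definition diagonal : bop H := \sum_i (enum_rank i).+1%:R **: E i.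

Lemma Ev i j : E i * (v j)^* = if i == j then (v j)^* else 0.
Proof.
case: eqVneq => [->|ij]; last by rewrite -mulrA vv // mulr0.
by rewrite -[in RHS](partial_isometryE (pv j)) [RHS]starM (pv j).1.
Qed.

Lemma vE i j : v i * E j = if i == j then v i else 0.
Proof.
case: eqVneq => [->|ij]; first exact: partial_isometryE.
by rewrite mulrA vv // mul0r.
Qed.

Lemma EE i j : E i * E j = if i == j then E i else 0.
Proof. by rewrite {2}/E mulrA Ev; case: eqVneq => [->|_]; rewrite ?mul0r. Qed.

Lemma corner_moved s i j : E i * moved s * E j =
  if (i == (phi s).1.2) && (j == (phi s).2) then moved s else 0.
Proof.
rewrite /moved !mulrA Ev -!mulrA vE [j == _]eq_sym.
by case: (_ == _); case: (_ == _); rewrite ?mul0r ?mulr0 //= ?mulr0.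
Qed.

Lemma corner_moved_star s i j : E i * (moved s)^* * E j =
  if (i == (phi s).2) && (j == (phi s).1.2) then (moved s)^* else 0.
Proof.
rewrite -[LHS](starK hip); have -> : (E i * (moved s)^* * E j)^* = E j * moved s * E i.
  by rewrite !starM !starK mulrA.
by rewrite corner_moved andbC; case: ifP; rewrite ?star0.
Qed.

Lemma corner_base i j l : E i * base l * E j =
  if (i == b0) && (j == l) then base l else 0.
Proof.
rewrite /base mulrA Ev -mulrA vE [j == _]eq_sym.
by case: (_ == _); case: (_ == _); rewrite ?mul0r ?mulr0.
Qed.

Lemma corner_base_star i j l : E i * (base l)^* * E j =
  if (i == l) && (j == b0) then (base l)^* else 0.
Proof.
rewrite -[LHS](starK hip); have -> : (E i * (base l)^* * E j)^* = E j * base l * E i.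
  by rewrite !starM !starK mulrA.
by rewrite corner_base andbC; case: ifP; rewrite ?star0.
Qed.

Lemma packed_sa k : (packed k)^* = packed k.
Proof.
rewrite /packed starD star_sum; congr (_ + _).
  by apply: eq_bigr => s _; rewrite starD starK addrC.
case: ifP => _; last by rewrite star0.
by rewrite star_sum; apply: eq_bigr => s _; rewrite starD starK addrC.
Qed.

Lemma diagonal_sa : diagonal^* = diagonal.
Proof.
by rewrite /diagonal star_sum; apply: eq_bigr => i _; rewrite scalr_star (pv i).1.
Qed.

(** Nothing else lies in that corner: [phi] is injective on the nonzero blocks, the adjoints are
    strictly below the diagonal, and the [base] terms sit in row or column [b0]. *)
Lemma corner_packed s : s \in nonzero_blocks ->
  E (phi s).1.2 * packed (phi s).1.1 * E (phi s).2 = moved s.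
Proof.
move=> Bs; have /and5P[f1 f2 n1 n2 lt] := phi_pos Bs.
rewrite /packed mulrDr mulrDl [X in _ + X](_ : _ = 0) ?addr0; last first.
  case: ifP => _; last by rewrite mulr0 mul0r.
  rewrite mulr_sumr mulr_suml big1 // => i _.
  rewrite mulrDr mulrDl corner_base corner_base_star.
  by rewrite (negbTE n1) (negbTE n2) andbF addr0.
rewrite mulr_sumr mulr_suml (bigD1 s) /=; last by rewrite Bs eqxx.
rewrite mulrDr mulrDl corner_moved corner_moved_star !eqxx /=.
case: eqVneq => [h|_]; first by rewrite h ltnn in lt.
rewrite /= addr0 big1 ?addr0 // => s' /andP[/andP[Bs' /eqP k'] ns].
rewrite mulrDr mulrDl corner_moved corner_moved_star.
have -> : ((phi s).1.2 == (phi s').1.2) && ((phi s).2 == (phi s').2) = false.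
  apply/negbTE/negP => /andP[/eqP h1 /eqP h2]; case/eqP: ns.
  apply: phi_inj => //; move: k' h1 h2.
  by case: (phi s) => [[? ?] ?]; case: (phi s') => [[? ?] ?] /= -> -> ->.
have /and5P[_ _ _ _ lt'] := phi_pos Bs'.
case: eqVneq => [h1|_] /=; last by rewrite addr0.
case: eqVneq => [h2|_] /=; last by rewrite addr0.
by move: lt'; rewrite -h1 -h2 => /(ltn_trans lt); rewrite ltnn.
Qed.

Lemma corner_packed_base i : i != b0 -> E b0 * packed k0 * E i = base i.
Proof.
move=> ib; rewrite /packed eqxx mulrDr mulrDl [X in X + _](_ : _ = 0) ?add0r; last first.
  rewrite mulr_sumr mulr_suml big1 // => s /andP[Bs _].
  have /and5P[f1 f2 n1 n2 lt] := phi_pos Bs.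
  rewrite mulrDr mulrDl corner_moved corner_moved_star.
  by rewrite ![b0 == _]eq_sym (negbTE n1) (negbTE n2) addr0.
rewrite mulr_sumr mulr_suml (bigD1 i) //= mulrDr mulrDl corner_base corner_base_star.
rewrite !eqxx [b0 == i]eq_sym (negbTE ib) /= addr0 big1 ?addr0 // => j /andP[jb ji].
rewrite mulrDr mulrDl corner_base corner_base_star.
by rewrite [i == j]eq_sym (negbTE ji) [b0 == j]eq_sym (negbTE jb) andbF addr0.
Qed.

(** The diagonal operator yields the [E i], corners then isolate [base i] and [moved s], and
    products of a [base] with the adjoint of another carry each moved block back to its origin. *)
Lemma packed_generate (B : set (bop H)) : star_alg hip B ->
  (forall k, B (packed k)) -> B diagonal -> forall k, B (X k).
Proof.
move=> hB Bp Bd k.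
have BE : forall i, B (E i).
  have linj : injective (fun i : T => (enum_rank i).+1%:R : R).
    by move=> i j /eqP; rewrite eqr_nat eqSS => /eqP/val_inj/enum_rank_inj.
  by apply: (diagonal_alg hB EE linj _ Bd) => i; rewrite pnatr_eq0.
have Bb i : B (base i).
  have [->|ib] := eqVneq i b0; first exact: BE.
  by rewrite -(corner_packed_base ib); apply: (algM hB) => //; apply: (algM hB).
have Bm s : s \in nonzero_blocks -> B (moved s).
  by move=> Bs; rewrite -(corner_packed Bs); apply: (algM hB) => //; apply: (algM hB).
have -> : X k = \sum_i \sum_j E i * X k * E j.
  rewrite -[LHS]mul1r -[LHS]mulr1 -sum_v mulr_suml mulr_suml; apply: eq_bigr => i _.
  by rewrite mulr_sumr.
apply: (alg_sum hB) => i _; apply: (alg_sum hB) => j _.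
have [->|nz] := eqVneq (E i * X k * E j) 0; first exact: (alg0 hB).
pose s : 'I_n * T * T := (k, i, j).
have Bs : s \in nonzero_blocks by [].
have /and5P[f1 f2 n1 n2 lt] := phi_pos Bs.
have left_ i' l : l \in full -> (base i')^* * base l * (v l)^* * v i' = E i'.
  move=> fl; rewrite /base starM starK -!mulrA [v l * (_ * _)]mulrA (fullv fl).
  by rewrite ev [v b0 * (_ * _)]mulrA (fullv fb) ev.
have right_ i' l : l \in full -> (v i')^* * v l * ((base l)^* * base i') = E i'.
  move=> fl; rewrite /base starM starK -!mulrA [v l * (_ * _)]mulrA (fullv fl).
  have -> : v b0 * ((v b0)^* * v i') = v i' by rewrite mulrA (fullv fb) ev.
  by rewrite ev.
have -> : E i * X k * E j =
    (base i)^* * base (phi s).1.2 * moved s * ((base (phi s).2)^* * base j).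
  rewrite -(left_ i _ f1) -(right_ j _ f2) /moved /= !mulrA.
  by [].
apply: (algM hB); first apply: (algM hB).
- by apply: (algM hB) => //; apply: (algS hB).
- exact: Bm.
- by apply: (algM hB) => //; apply: (algS hB).
Qed.

End Placement.

Lemma big_sigma (V : Type) (idx : V) (op : Monoid.com_law idx) (L : nat)
    (k : 'I_L -> nat) (F : {l : 'I_L & 'I_(k l).+1} -> V) :
  \big[op/idx]_s F s =
  \big[op/idx]_(l < L) \big[op/idx]_(i < (k l).+1) F (existT _ l i).
Proof.
rewrite (@sig_big_dep _ _ op 'I_L (fun l => 'I_(k l).+1 : finType) xpredT
  (fun=> xpredT) (fun l i => F (existT _ l i))) /=.
by apply: eq_bigr => -[].
Qed.

Lemma card_triple (S U : finType) (A : {pred S * U * U}) :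
  #|A| = (\sum_s \sum_i \sum_j (((s, i, j) : S * U * U) \in A))%N.
Proof.
rewrite -sum1_card big_mkcond /= [RHS]pair_big /= [RHS]pair_big /=.
by apply: eq_bigr => -[[s i] j] _ /=; case: (_ \in A).
Qed.

(** * Splitting projections and counting blocks *)

Section Packing.
Context (R : realType) (H : completeNormedModType R[i])
        (ip : {dot H for Num.conj}) (hip : hilbert_inner_product ip).
Local Notation "a ^*" := (star hip a) : ring_scope.
Local Notation "r **: a" := (scalr r a) (at level 40).
Local Notation proj := (proj hip).
Implicit Types (a b c e p q x y z : bop H) (r : R).
Context (M : set (bop H)) (t : bop H -> R) (tf : traced_factor hip M t).

Lemma trace_sum (L : nat) (P : 'I_L -> bop H) : (forall l, M (P l)) ->
  t (\sum_l P l) = \sum_l t (P l).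
Proof.
move=> MP; have : M (\sum_l P l) /\ t (\sum_l P l) = \sum_l t (P l); last by case.
elim/big_rec2: _ => [|l a r _ [Ma ta]]; first by split; [exact: (tf0 tf) | exact: (tt0 tf)].
by split; [exact: (tfD tf) | rewrite (ttD tf) // ta].
Qed.

(* For [i < k] the partial isometry [w i] maps a piece of [p] onto [e], while
   [w k] maps the remainder into [e]. *)
Definition is_split e p (k : nat) (w : nat -> bop H) : Prop :=
  [/\ forall i, (i <= k)%N ->
        [/\ M (w i), proj ((w i)^* * w i), e * w i = w i & w i * p = w i],
      forall i, (i < k)%N -> w i * (w i)^* = e,
      forall i j, (i <= k)%N -> (j <= k)%N -> i != j -> w i * (w j)^* = 0,
      \sum_(i < k.+1) (w i)^* * w i = p
    & k%:R * t e <= t p < k.+1%:R * t e].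

Lemma split_small e p : M e -> proj e -> M p -> proj p -> t p < t e ->
  exists k w, is_split e p k w.
Proof.
move=> Me pe Mp pp h; have [v [Mv vv ev]] := comparison tf Mp Me pp pe (ltW h).
have vp : v * p = v by rewrite -vv partial_isometryE ?vv.
exists 0%N, (fun=> v); split=> //.
- by move=> i _; rewrite vv.
- by case=> [|i] [|j].
- by rewrite big_ord1.
- by rewrite mul0r mul1r h (tp_ge0 tf).
Qed.

(** Division with remainder: as long as [t e <= t p], [comparison] finds a copy of [e] under [p],
    and removing it lowers the trace by [t e]. *)
Lemma split_projection e p : M e -> proj e -> e <> 0 -> M p -> proj p ->
  exists k w, is_split e p k w.
Proof.
move=> Me pe e0 Mp pp; have te := tp_gt0 tf Me pe e0.
have [n hn] : exists n, t p < n.+1%:R * t e.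
  have h : 0 <= t p / t e by apply: divr_ge0; [exact: (tp_ge0 tf) | exact: ltW].
  have := archi_boundP h; set n := Num.bound _; rewrite ltr_pdivrMr // => h1.
  by exists n; rewrite -[n.+1%:R]natr1 mulrDl mul1r; lra.
elim: n p Mp pp hn => [|n ih] p Mp pp tp.
  by apply: split_small => //; rewrite mul1r in tp.
have [h|h] := ltrP (t p) (t e); first exact: split_small.
have [u [Mu uu pu]] := comparison tf Me Mp pe pp h.
have Mus : M u^* by apply: (tf_star tf).
pose f := u * u^*; have pf : proj f by apply: final_proj; rewrite uu.
have Mf : M f by apply: (tfM tf).
have pf' : p * f = f by rewrite mulrA pu.
have tfe : t f = t e by rewrite /f (ttC tf) // uu.
have [|k [w [w1 w2 w3 w4 w5]]] := ih (p - f) (tfB tf Mp Mf) (projB pf pp pf').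
  by rewrite (ttB tf) // tfe; move: tp; rewrite -[n.+2%:R]natr1 mulrDl mul1r; lra.
have uue : u * e = u by rewrite -uu partial_isometryE ?uu.
have eus : e * u^* = u^* by rewrite -[in RHS]uue starM pe.1.
have usp : u^* * p = u^* by rewrite -[in RHS]pu starM pp.1.
have usf : u^* * f = u^* by rewrite mulrA uu eus.
have fp : f * p = f by apply: (proj_leC pf pp).
have wu i : (i <= k)%N -> w i * u = 0.
  move=> /w1[_ _ _ <-]; rewrite -mulrA mulrBl.
  have -> : f * u = u by rewrite -mulrA uu.
  by rewrite pu subrr mulr0.
exists k.+1, (fun i => if i is i'.+1 then w i' else u^*); split.
- move=> [_|i ik]; first by rewrite starK; split=> //; rewrite starK.
  have [m1 m2 m3 m4] := w1 i ik; split=> //.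
  by rewrite -{1}m4 -mulrA mulrBl pp.2 fp m4.
- by move=> [_|i /w2 //]; rewrite starK.
- move=> [|i] [|j] // ik jk ij.
  + by apply: (star_eq0 (hip := hip)); rewrite starM starK starK wu.
  + by rewrite starK wu.
  + by apply: w3.
- by rewrite big_ord_recl /= starK w4 addrC subrK.
- move: w5; rewrite (ttB tf) // tfe => /andP[g1 g2].
  rewrite -[k.+2%:R]natr1 -[k.+1%:R in X in X && _]natr1 !mulrDl !mul1r.
  by apply/andP; split; lra.
Qed.

(** A fine partition commuting with [1] has a nonzero member, because [1] is nonzero. *)
Lemma small_projection (d : R) : 0 < d ->
  exists e, [/\ M e, proj e, e <> 0 & t e <= d].
Proof.
move=> d0; have [||s [[os _] hs ss]] := @relcomm_partition _ _ _ _ _ _ tf 1 _ _ d d0.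
- exact: (tf1 tf).
- exact: star1.
apply: contrapT => none; apply: (tf_neq0 tf); rewrite -ss big_seq big1 // => q qs.
apply: contrapT => q0; apply: none; exists q; split=> //; last by case: (hs q qs).
  by case: (hs q qs) => [[]].
exact: os.
Qed.

Lemma few_generators (L n m : nat) (P : 'I_L -> bop H) (X : 'I_n -> bop H) :
  (forall l, M (P l) /\ proj (P l)) ->
  (forall l l', l != l' -> P l * P l' = 0) -> \sum_l P l = 1 ->
  (0 < m)%N -> (forall i, M (X i)) ->
  \sum_i \sum_l \sum_l' (P l * X i * P l' != 0)%:R * (t (P l) * t (P l')) < m%:R / 2 ->
  exists y : 'I_m.+1 -> bop H, (forall i, M (y i) /\ (y i)^* = y i) /\
    forall B, star_alg hip B -> (forall i, B (y i)) -> forall i, B (X i).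
Proof.
move=> hP oP sP m0 MX; set S := (X in X < _) => Sm.
(* With [D = 1 / t e], twice the number of blocks is at most [2 S D ^ 2 + 4 n L D + 2 n L ^ 2], and
   twice the number of positions is at least [m (D ^ 2 - (2 L + 3) D)]. As [D >= 1], the difference
   is at least [eta D ^ 2 - C D], so [C <= eta D] suffices. *)
pose C : R := m%:R * (2 * L%:R + 3) + 4 * n%:R * L%:R + 2 * n%:R * L%:R ^+ 2.
pose eta := m%:R - 2 * S.
have eta0 : 0 < eta by rewrite /eta; lra.
have C0 : 0 <= C.
  by rewrite /C; do !apply: addr_ge0; do !apply: mulr_ge0; rewrite ?exprn_ge0 ?ler0n //;
    apply: addr_ge0; rewrite ?mulr_ge0 ?ler0n.
have D0' : 0 < C / eta + L%:R + 3.
  by apply: ltr_wpDl => //; apply: addr_ge0; rewrite ?ler0n // divr_ge0 // ltW.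
(* The summand [C / eta] serves the count; [L + 3] guarantees enough full pieces, at least
   [D - L >= 3]. *)
have Di0 : 0 < (C / eta + L%:R + 3)^-1 by rewrite invr_gt0.
have [e [Me pe e0 te]] := small_projection Di0.
have d0 := tp_gt0 tf Me pe e0; set d := t e in te d0.
pose D := d^-1.
have D0 : 0 < D by rewrite invr_gt0.
have hD : C / eta + L%:R + 3 <= D by rewrite -[leLHS]invrK lef_pV2 ?posrE ?invr_gt0.
have hCD : C <= eta * D.
  have : C / eta <= D by have := ler0n R L; lra.
  by rewrite ler_pdivrMr // mulrC.
have hLD : L%:R + 3 <= D.
  have : 0 <= C / eta by rewrite divr_ge0 // ltW.
  lra.
have /choice[k hk] (l : 'I_L) := split_projection Me pe e0 (hP l).1 (hP l).2.
have {hk} /choice[w hw] := hk.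
pose T := {l : 'I_L & 'I_(k l).+1}.
pose v (s : T) : bop H := w (tag s) (tagged s).
pose full : {pred T} := [pred s : T | (tagged s < k (tag s))%N].
have hv (s : T) : [/\ M (v s), proj ((v s)^* * v s), e * v s = v s & v s * P (tag s) = v s].
  by have [h _ _ _ _] := hw (tag s); apply: h; exact: leq_ord.
have vv (i j : T) : i != j -> v i * (v j)^* = 0.
  case: i j => [l i] [l' j] ij; have [ll|ll] := eqVneq l l'; last first.
    have [_ _ _ h1] := hv (Tagged _ i); have [_ _ _ h2] := hv (Tagged _ j).
    rewrite -h1 -h2 starM (hP l').2.1 /= -!mulrA [P l * _]mulrA oP //.
    by rewrite mul0r mulr0.
  subst l'; have [_ _ h _ _] := hw l; apply: h; try exact: leq_ord.
  by apply: contra_neq ij => /= /ord_inj ->.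
have sum_v : \sum_s (v s)^* * v s = 1.
  by rewrite -sP big_sigma; apply: eq_bigr => l _; case: (hw l).
have fullv (s : T) : s \in full -> v s * (v s)^* = e.
  by move=> fs; have [_ h _ _ _] := hw (tag s); apply: h.
have Nfull : #|full| = (\sum_l k l)%N.
  rewrite -sum1_card big_mkcond /= big_sigma; apply: eq_bigr => l _.
  rewrite big_ord_recr /= inE /= ltnn addn0 (eq_bigr (fun=> 1%N)) => [|i _].
    by rewrite sum_nat_const card_ord muln1.
  by rewrite inE /= ltn_ord.
have tge l : 0 <= t (P l) by apply: (tp_ge0 tf); case: (hP l).
have kt l : (k l)%:R <= t (P l) * D.
  have [_ _ _ _ /andP[h _]] := hw l.
  by rewrite ler_pdivlMr.
have tk l : t (P l) * D <= (k l).+1%:R.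
  have [_ _ _ _ /andP[_ h]] := hw l.
  by rewrite ler_pdivrMr // ltW.
have st : \sum_l t (P l) = 1.
  by rewrite -(trace_sum (fun l => (hP l).1)) sP (tt1 tf).
(* Each [P l] loses at most one copy of [e] to its remainder. *)
have NR : D - L%:R <= #|full|%:R.
  have : \sum_l t (P l) * D <= \sum_l ((k l)%:R + 1).
    by apply: ler_sum => l _; rewrite natr1; apply: tk.
  rewrite -mulr_suml st mul1r big_split /= sumr_const card_ord -natr_sum -Nfull.
  lra.
have [b0 fb] : exists b0 : T, b0 \in full.
  apply/existsP; rewrite -[[exists _, _]]negbK negb_exists; apply/negP => /forallP h.
  have : #|full| = 0%N by apply: eq_card0 => s; apply/negbTE.
  by move=> h0; move: NR; rewrite h0; lra.
pose nz i l l' := P l * X i * P l' != 0.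
(* A block can be nonzero only inside a nonzero [P l * X i * P l'], and [P l] consists of [(k l).+1]
   pieces, the remainder included. *)
have Kn : (#|nonzero_blocks hip v X| <=
    \sum_i \sum_l \sum_l' nz i l l' * ((k l).+1 * (k l').+1))%N.
  rewrite card_triple; apply: leq_sum => i _.
  apply: (@leq_trans (\sum_(s : T) \sum_(s' : T) nz i (tag s) (tag s'))).
    apply: leq_sum => s _; apply: leq_sum => s' _; rewrite inE /= /nz.
    case: (eqVneq (P (tag s) * X i * P (tag s')) 0) => [h|_]; last exact: leq_b1.
    have [_ _ _ h1] := hv s; have [_ _ _ h2] := hv s'.
    rewrite -{2}h1 -{1}h2 starM (hP (tag s')).2.1.
    have -> : (v s)^* * (v s * P (tag s)) * X i * (P (tag s') * (v s')^* * v s') =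
      (v s)^* * v s * (P (tag s) * X i * P (tag s')) * ((v s')^* * v s') by rewrite !mulrA.
    by rewrite h mulr0 mul0r eqxx.
  rewrite big_sigma /=; apply: leq_sum => l _.
  rewrite sum_nat_const card_ord big_sigma /= big_distrr /=; apply: leq_sum => l' _.
  rewrite sum_nat_const card_ord mulnA mulnC; exact: leqnn.
have KR : #|nonzero_blocks hip v X|%:R <= S * D ^+ 2 + n%:R * (2 * L%:R * D + L%:R ^+ 2).
  apply: (@le_trans _ _ (\sum_i \sum_l \sum_l' ((nz i l l')%:R *
     (t (P l) * t (P l')) * D ^+ 2 + ((t (P l) + t (P l')) * D + 1)))).
    apply: le_trans (_ : (\sum_i \sum_l \sum_l' nz i l l' * ((k l).+1 * (k l').+1))%N%:R <= _).
      by rewrite ler_nat.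
    rewrite natr_sum; apply: ler_sum => i _; rewrite natr_sum; apply: ler_sum => l _.
    rewrite natr_sum; apply: ler_sum => l' _.
    have a1 := tge l; have a2 := tge l'.
    have c1 : 0 <= t (P l) * D by rewrite mulr_ge0 // ltW.
    have c2 : 0 <= t (P l') * D by rewrite mulr_ge0 // ltW.
    case: (nz i l l') => /=; last by rewrite mul0n !mul0r add0r mulrDl !addr_ge0.
    rewrite mul1n mul1r mulrDl natrM.
    have b1 : (k l).+1%:R <= t (P l) * D + 1 by rewrite -natr1 lerD2r.
    have b2 : (k l').+1%:R <= t (P l') * D + 1 by rewrite -natr1 lerD2r.
    apply: le_trans (ler_pM (ler0n R _) (ler0n R _) b1 b2) _.
    by rewrite le_eqVlt; apply/orP; left; apply/eqP; ring.
  have -> : n%:R * (2 * L%:R * D + L%:R ^+ 2) =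
      \sum_(i < n) \sum_(l < L) \sum_(l' < L) ((t (P l) + t (P l')) * D + 1).
    rewrite sumr_const card_ord mulr_natl; congr (_ *+ _).
    rewrite (eq_bigr (fun l => (L%:R * t (P l) + 1) * D + L%:R)) => [|l _].
      rewrite big_split /= sumr_const card_ord -mulr_suml big_split /= -mulr_sumr st.
      by rewrite sumr_const card_ord -[_ *+ L]mulr_natl; ring.
    rewrite big_split /= sumr_const card_ord -mulr_suml big_split /= st.
    by rewrite sumr_const card_ord -[_ *+ L]mulr_natl.
  rewrite /S mulr_suml -big_split /=; apply: ler_sum => i _.
  rewrite mulr_suml -big_split /=; apply: ler_sum => l _.
  by rewrite mulr_suml -big_split.
pose A : {pred T} := [pred s | (s \in full) && (s != b0)].
have cA : (#|full| = #|A|.+1)%N.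
  rewrite (cardD1 b0) fb add1n; congr _.+1; apply: eq_card => s.
  by rewrite !inE andbC.
have cpos : (2 * #|@positions T full b0 m| = m * (#|A| * #|A| - #|A|))%N.
  pose pairs := #|[pred ij : T * T | [&& ij.1 \in A, ij.2 \in A
            & (enum_rank ij.1 < enum_rank ij.2)%N]]|.
  have hA : (2 * pairs + #|A| = #|A| * #|A|)%N by apply: card_lt_pairs.
  have -> : #|@positions T full b0 m| = (m * pairs)%N.
    rewrite card_triple (eq_bigr (fun=> pairs)) => [|s _].
      by rewrite sum_nat_const card_ord.
    rewrite pair_big /= -[pairs]sum1_card big_mkcond [RHS]big_mkcond /=.
    apply: eq_bigr => -[i j] _; rewrite !inE /=.
    by case: (_ < k (tag i))%N => //=; case: (_ < k (tag j))%N => //=;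
      rewrite ?andbF //; case: (i != b0) => //=; case: (j != b0) => //=;
      case: (_ < enum_rank j)%N.
  by rewrite mulnCA -hA addnK.
have Kpos : (#|nonzero_blocks hip v X| <= #|@positions T full b0 m|)%N.
  rewrite -(leq_pmul2l (isT : 0 < 2)%N) cpos -(ler_nat R) natrM.
  rewrite natrM natrB ?leq_pmull //; last first.
    by rewrite -ltnS -cA; move: NR; rewrite -(ltr_nat R); lra.
  rewrite natrM; have NA : #|A|%:R = #|full|%:R - 1 :> R by rewrite cA -natr1 addrK.
  rewrite NA; set N : R := #|full|%:R.
  (* The right side is [(N - 1) (N - 2)] with [N >= D - L]; expanding at [D - L] produces the
     coefficient [2 L + 3]. *)
  have h1 : D ^+ 2 - (2 * L%:R + 3) * D <= (N - 1) * (N - 1) - (N - 1).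
    have g1 : 0 <= (N - (D - L%:R)) by rewrite subr_ge0.
    have g2 := ler0n R L.
    nra.
  have h2 : m%:R * (D ^+ 2 - (2 * L%:R + 3) * D) <= m%:R * ((N - 1) * (N - 1) - (N - 1)).
    by rewrite ler_wpM2l ?ler0n.
  apply: le_trans h2; apply: le_trans (ler_wpM2l (ler0n R 2) KR) _.
  have h3 : C * D <= eta * D * D by rewrite ler_wpM2r // ltW.
  have h4 : 2 * n%:R * L%:R ^+ 2 <= 2 * n%:R * L%:R ^+ 2 * D.
    rewrite ler_peMr ?mulr_ge0 ?exprn_ge0 ?ler0n //.
    by have := ler0n R L; lra.
  by move: h3 h4; rewrite /C /eta; nra.
have [phi [phi_inj phi_pos]] := card_le_inj (Ordinal m0, b0, b0) Kpos.
pose k0 := Ordinal m0.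
pose pk := packed hip v b0 X phi k0.
(* Index [ord0] holds the diagonal operator, the other [m] indices the packed ones. *)
exists (fun i => oapp pk (diagonal hip v) (unlift ord0 i)); split.
  move=> i; have MS a : M a -> M a^* by apply: (tf_star tf).
  have Msum I (r : seq I) (Q : pred I) F : (forall i, M (F i)) -> M (\sum_(i <- r | Q i) F i).
    by move=> h; apply: (big_ind M) => [|a b|j _]; [exact: (tf0 tf)|exact: (tfD tf)|].
  have Mv s : M (v s) by case: (hv s).
  case: (unlift ord0 i) => [j|] /=; last first.
    split; last by apply: diagonal_sa => s; case: (hv s).
    by apply: Msum => s; apply: (tfZ tf); apply: (tfM tf) => //; apply: MS.
  split; last exact: packed_sa.
  apply: (tfD tf).
    apply: Msum => s; have Mm : M (moved hip v X phi s).
      apply: (tfM tf) => //; apply: (tfM tf); first exact: MS.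
      by apply: (tfM tf); [exact: (tfM tf) | exact: MS].
    by apply: (tfD tf) => //; apply: MS.
  case: ifP => _; last exact: (tf0 tf).
  apply: Msum => s; have Mb : M (base hip v b0 s) by apply: (tfM tf) => //; apply: MS.
  by apply: (tfD tf) => //; apply: MS.
move=> B hB By.
apply: (@packed_generate _ _ _ hip _ v e full b0 _ vv _ sum_v fullv fb n X m
  phi phi_inj phi_pos k0) => //.
- by move=> s; case: (hv s).
- by move=> s; case: (hv s).
- by move=> j; have := By (lift ord0 j); rewrite liftK.
- by have := By ord0; rewrite unlift_none.
Qed.

End Packing.

(** * Triangular truncation *)

Section Triangular.
Context (R : realType) (H : completeNormedModType R[i])
        (ip : {dot H for Num.conj}) (hip : hilbert_inner_product ip).
Local Notation "a ^*" := (star hip a) : ring_scope.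
Local Notation proj := (proj hip).
Context (M : set (bop H)) (t : bop H -> R) (tf : traced_factor hip M t).

(** Zero members are dropped so that the family becomes injective and can be read as a set of
    projections with the same sum. *)
Lemma small_partition (x : bop H) (d : R) : M x -> x^* = x -> 0 < d ->
  exists L (P : 'I_L -> bop H),
  [/\ forall l, [/\ M (P l), proj (P l), P l <> 0 & P l * x = x * P l],
      forall l l', l != l' -> P l * P l' = 0, \sum_l P l = 1
    & forall l, t (P l) <= d].
Proof.
move=> Mx sx d0; have [s0 [[ps0 os0] hs0 ss0]] := relcomm_partition tf Mx sx d0.
pose s := [seq p <- s0 | p != 0].
have hs p : p \in s -> [/\ M p, proj p, p <> 0, p * x = x * p & t p <= d].
  rewrite mem_filter => /andP[/eqP p0 ps]; have [[Mp px] tp] := hs0 p ps.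
  by split=> //; apply: ps0.
have os : pairwise (fun p q : bop H => p * q == 0) s.
  by apply: subseq_pairwise os0; apply: filter_subseq.
have hn (l : 'I_(size s)) : s`_l \in s by apply: mem_nth.
exists (size s), (fun l => s`_l); split.
- by move=> l; have [] := hs _ (hn l).
- have lt (l l' : 'I_(size s)) : (l < l')%N -> s`_l * s`_l' = 0.
    by move=> ll; apply/eqP; apply: (pairwiseP 0 os) => //; rewrite inE.
  move=> l l'; rewrite neq_ltn => /orP[/lt //|/lt h].
  have [_ p _ _ _] := hs _ (hn l); have [_ p' _ _ _] := hs _ (hn l').
  exact: (proj_orthC p p' h).
- rewrite -ss0 -(big_mkord xpredT (fun l => s`_l)) -(big_nth 0 xpredT id) big_filter.
  by rewrite big_mkcond /=; apply: eq_bigr => p _; case: eqP => [->|].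
- by move=> l; have [] := hs _ (hn l).
Qed.

(** For a hermitian element the blocks below the diagonal are the adjoints of those above, so the
    upper part together with the projections recovers it. *)
Lemma triangular_generators (L n : nat) (P : 'I_L -> bop H) (X : 'I_n -> bop H) :
  (forall l, M (P l) /\ proj (P l)) ->
  (forall l l', l != l' -> P l * P l' = 0) -> \sum_l P l = 1 ->
  (forall i, M (X i) /\ (X i)^* = X i) ->
  exists y : 'I_n -> bop H,
  [/\ forall i, M (y i),
      forall i (l l' : 'I_L), (l' < l)%N -> P l * y i * P l' = 0
    & forall B, star_alg hip B -> (forall l, B (P l)) -> (forall i, B (y i)) ->
        forall i, B (X i)].
Proof.
move=> hP oP sP hX.
pose y i := \sum_(l < L) \sum_(l' < L | (l <= l')%N) P l * X i * P l'.
have Py i (l l' : 'I_L) : P l * y i * P l' = if (l <= l')%N then P l * X i * P l' else 0.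
  rewrite /y mulr_sumr (bigD1 l) //= [X in _ + X]big1 ?addr0 => [|k kl]; last first.
    by rewrite mulr_sumr big1 // => k' _; rewrite !mulrA oP ?mul0r // eq_sym.
  rewrite mulr_sumr mulr_suml; case: ifP => [ll|/negbT ll].
    rewrite (bigD1 l') //= big1 ?addr0 => [|k /andP[_ kl]].
      by rewrite !mulrA (hP l).2.2 -[LHS]mulrA (hP l').2.2.
    by rewrite -!mulrA oP // !mulr0.
  rewrite big1 // => k lk; rewrite -!mulrA oP ?mulr0 //.
  by apply: contraNneq ll => <-.
exists y; split=> [i|i l l' ll|B hB BP By i].
- have MP l := (hP l).1; have MX := (hX i).1.
  apply: (big_ind M) => [|a b|l _]; [exact: (tf0 tf) | exact: (tfD tf) |].
  apply: (big_ind M) => [|a b|l' _]; [exact: (tf0 tf) | exact: (tfD tf) |].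
  by apply: (tfM tf) => //; apply: (tfM tf).
- by rewrite Py leqNgt ll.
have Bup (l l' : 'I_L) : (l <= l')%N -> B (P l * X i * P l').
  by move=> ll; have := Py i l l'; rewrite ll => <-; apply: (algM hB) => //; apply: (algM hB).
have -> : X i = \sum_l \sum_l' P l * X i * P l'.
  rewrite -[LHS]mul1r -[LHS]mulr1 -sP !mulr_suml; apply: eq_bigr => l _.
  by rewrite mulr_sumr.
apply: (alg_sum hB) => l _; apply: (alg_sum hB) => l' _.
case/orP: (leq_total l l') => ll; first exact: Bup.
have -> : P l * X i * P l' = (P l' * X i * P l)^*.
  by rewrite !starM (hP l).2.1 (hP l').2.1 (hX i).2 mulrA.
by apply: (algS hB); apply: Bup.
Qed.

End Triangular.

Lemma sum_sqr_le (R : realType) (L : nat) (f : 'I_L -> R) (d : R) :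
  (forall l, 0 <= f l <= d) -> \sum_l f l = 1 -> \sum_l f l * f l <= d.
Proof.
move=> hf sf; rewrite -[d]mulr1 -sf mulr_sumr; apply: ler_sum => l _.
by have /andP[f0 fd] := hf l; rewrite ler_wpM2r.
Qed.

(** The sum plus its transpose counts every pair once and the diagonal once more, which gives [1]
    plus a diagonal sum of at most [d]. *)
Lemma sum_triangle_le (R : realType) (L : nat) (f : 'I_L -> R) (d : R) :
  (forall l, 0 <= f l <= d) -> \sum_l f l = 1 ->
  \sum_(l < L) \sum_(l' < L) (l <= l')%N%:R * (f l * f l') <= (1 + d) / 2.
Proof.
move=> hf sf; set S := \sum_l _.
have S2 : S + S = 1 + \sum_l f l * f l.
  have -> : 1 = \sum_(l < L) \sum_(l' < L) f l * f l' :> R.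
    rewrite (eq_bigr f) ?sf // => l _; by rewrite -mulr_sumr sf mulr1.
  have {2}-> : S = \sum_(l < L) \sum_(l' < L) (l' <= l)%N%:R * (f l * f l').
    by rewrite /S exchange_big /=; apply: eq_bigr => l _; apply: eq_bigr => l' _; rewrite [f l * _]mulrC.
  rewrite -!big_split /=; apply: eq_bigr => l _; rewrite -big_split /=.
  rewrite (bigD1 l) //= [\sum_l' _](bigD1 l) //= leqnn !mul1r addrAC; congr (_ + _ + _).
  apply: eq_bigr => l'; rewrite -mulrDl => ll.
  suff -> : (l <= l')%N%:R + (l' <= l)%N%:R = 1 :> R by rewrite mul1r.
  by move: ll; rewrite -val_eqE /=; case: ltngtP => //= _ _; rewrite ?addr0 ?add0r.
have := sum_sqr_le hf sf; lra.
Qed.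

(** * Generating sets of von Neumann algebras *)

Lemma sum_map_enum (V : nmodType) (J : Type) (n : nat) (f : 'I_n -> J) (F : J -> V) :
  \sum_(x <- [seq f i | i <- enum 'I_n]) F x = \sum_i F (f i).
Proof. by rewrite big_map big_enum. Qed.

Lemma fsum_range (V : nmodType) (J : choiceType) (n : nat) (f : 'I_n -> J) (F : J -> V) :
  injective f -> \sum_(x \in range f) F x = \sum_i F (f i).
Proof.
move=> fi; have -> : range f = [set` map f (enum 'I_n)].
  apply/seteqP; split=> [_ [i _ <-]|x /mapP[i _ ->]]; last by exists i.
  by apply: map_f; rewrite mem_enum.
rewrite -fsbig_seq; last by rewrite map_inj_uniq // enum_uniq.
exact: sum_map_enum.
Qed.

(** A sequence may repeat an element that the set counts once; this spares showing that the
    generators listed for the upper bound are distinct. *)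
Lemma fsum_seq_le (R : realType) (J : choiceType) (s : seq J) (F : J -> R) :
  (forall x, x \in s -> 0 <= F x) -> \sum_(x \in [set` s]) F x <= \sum_(x <- s) F x.
Proof.
move=> F0; have -> : [set` s] = [set` undup s].
  by apply/seteqP; split=> x /=; rewrite mem_undup.
rewrite -fsbig_seq ?undup_uniq //; elim: s F0 => [|x s ih] F0 /=; first by rewrite !big_nil.
have ih' : \sum_(y <- undup s) F y <= \sum_(y <- s) F y.
  by apply: ih => y ys; apply: F0; rewrite inE ys orbT.
rewrite [leRHS]big_cons; case: ifP => _; last by rewrite big_cons lerD2l.
by apply: le_trans ih' _; rewrite lerDr F0 // mem_head.
Qed.

Lemma finite_range_inj (T : choiceType) (A : set T) : finite_set A ->
  exists n (f : 'I_n -> T), injective f /\ range f = A.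
Proof.
move=> fA; pose s := finmap.enum_fset (fset_set A).
have sA x : (x \in s) = (x \in A) by rewrite /s -in_fset_set.
have us : uniq s by apply: finmap.fset_uniq.
exists (size s), (tnth (in_tuple s)); split.
  by apply/tuple_uniqP.
apply/seteqP; split=> [x [i _ <-]|x Ax].
  by have := mem_tnth i (in_tuple s); rewrite sA inE.
have /tnthP[i ->] : x \in in_tuple s by rewrite sA inE.
by exists i.
Qed.

(** * Passing between bundled operators and plain functions *)

Section Link.
Context (R : realType) (H : completeNormedModType R[i])
        (ip : {dot H for Num.conj}) (hip : hilbert_inner_product ip).
Local Notation rip := (re_ip ip).
Local Notation "a ^*" := (star hip a) : ring_scope.
Local Notation proj := (proj hip).
Local Notation bopf := (@bopf R H).

Lemma bopf_inj (a b : bop H) : (a : H -> H) = b -> a = b.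
Proof. by move=> h; apply: bop_ext => v; rewrite h. Qed.

Lemma bopf_sum (n : nat) (P : 'I_n -> bop H) :
  bopf (\sum_i P i) = \sum_i bopf (P i).
Proof. by elim/big_rec2: _ => // i f a _ <-. Qed.

Lemma projectionP (p : bop H) : projection ip p <-> proj p.
Proof.
split=> [[[_ sp] pp]|[sp pp]]; split.
- by apply: bopf_inj; rewrite -adj_star.
- exact: bopf_inj.
- by split; [exact: bopP | rewrite (adj_star hip) sp].
- exact: (congr1 bopf pp).
Qed.

Lemma sa_ip_real (a : bop H) v : a^* = a -> ip (a v) v = (rip (a v) v)%:C.
Proof.
move=> sa; rewrite ipE; congr (_ +i* _).
have h : rip (a v) ('i%C *: v) = - rip (a ('i%C *: v)) v.
  by rewrite bopZv rip_i opprK.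
move: h; rewrite [rip (a ('i%C *: v)) v]starP sa [rip ('i%C *: v) _]ripC; lra.
Qed.

Lemma op_leP (a b : bop H) : a^* = a -> b^* = b ->
  op_le ip a b <-> forall v, rip (a v) v <= rip (b v) v.
Proof.
move=> sa sb; have e v : ip (((b : H -> H) - (a : H -> H)) v) v = (rip (b v) v - rip (a v) v)%:C.
  have -> : (b : H -> H) - (a : H -> H) = bopf (b - a).
    by apply/funext => w; rewrite bopBE.
  by rewrite sa_ip_real ?starB ?sa ?sb // bopBE ripBl.
by split=> h v; have := h v; rewrite ?e lecR subr_ge0.
Qed.

Context (M : set (H -> H)) (tau : (H -> H) -> R[i]).

Definition lift_set (A : set (H -> H)) : set (bop H) := [set a | A (bopf a)].

Lemma von_neumann_bounded : von_neumann_algebra ip M -> M `<=` @bounded_op R H.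
Proof. by case=> [[[]]]. Qed.

Lemma traced_factor_lift : type_II1_factor ip M -> faithful_normal_trace ip M tau ->
  traced_factor hip (lift_set M) (fun a => Re (tau (bopf a))).
Proof.
case=> [[vM id0 center] diffuse _] [[tD tZ tp tC t1] faithful normal].
have Mb := von_neumann_bounded vM.
have [[_ MD MZ MM Ms] wM M1] := vM.
have closed : closed_class (lift_set M).
  split=> //.
  - by move=> a b; apply: MD.
  - by move=> r a; apply: MZ.
  - by move=> a b; apply: MM.
  - by move=> u b Mu ub; apply: (wot_closed_sconv hip wM _ ub) => n; apply: Mu.
have star_in a : lift_set M a -> lift_set M a^*.
  by move=> Ma; rewrite /lift_set /= -adj_star; apply: Ms.
have pos a : lift_set M a -> 0 <= tau (bopf (a^* * a)).
  by move=> Ma; have := tp _ Ma; rewrite (adj_star hip).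
split=> //.
- by move=> a; apply: MZ.
- move=> a Ma ac; have [|c hc] := center (bopf a) Ma.
    by move=> b bM; exact: (congr1 bopf (ac (Bop (Mb _ bM)) bM)).
  by exists c; apply: bopf_inj.
- move=> p Mp pp hp; apply: bopf_inj; apply: diffuse; split=> //.
    exact/projectionP.
  move=> a b aM bM.
  exact: (congr1 bopf (hp (Bop (Mb _ aM)) (Bop (Mb _ bM)) aM bM)).
- by move=> h; apply: id0; exact: (congr1 bopf h).
- by move=> a b Ma Mb'; rewrite -ReD -tD.
- by move=> a b Ma Mb'; rewrite -[bopf (a * b)]/(bopf a \o bopf b) tC.
- by move=> a /pos; rewrite lecE => /andP[].
- by rewrite t1.
- move=> a Ma h; apply: bopf_inj; apply: faithful => //.
  have := pos a Ma; rewrite (adj_star hip) lecE /= => /andP[/eqP im _].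
  by rewrite -[tau _]/(tau (bopf (a^* * a))) [LHS]complexE h im mulr0 addr0.
- move=> u Q r Mu pu us uQ hr.
  have [Q' [uQ' pQ Qu]] := proj_limit pu us; rewrite -(sconv_uniq uQ uQ') in pQ Qu.
  have umn n k : u (k + n)%N * u n = u n.
    by elim: k => [|k ih]; [case: (pu n) | rewrite addSn -ih mulrA us].
  have su n : (u n)^* = u n by case: (pu n).
  have le_form p q : proj p -> proj q -> q * p = p -> op_le ip (bopf p) (bopf q).
    move=> pp pq qp; apply/op_leP; [by case: pp | by case: pq | move=> v].
    by have [_ /(_ v)] := proj_positive (projB pp pq qp); rewrite bopBE ripBl subr_ge0.
  have sQ : selfadjoint ip (bopf Q) by apply: ((projectionP Q).2 pQ).1.
  (* The sequence is an increasing net whose least upper bound is its strong limit [Q], so normality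
     gives the trace of [Q] as the supremum of the traces. *)
  pose A := [set bopf (u n) | n in setT].
  rewrite (normal A (bopf Q)) //.
  + apply: ge_sup; first by exists (Re (tau (bopf (u 0%N)))), (bopf (u 0%N)) => //; exists 0%N.
    by move=> _ [_ [n _ <-] <-]; apply: hr.
  + by exists (bopf (u 0%N)), 0%N.
  + move=> _ [n _ <-]; split; first exact: Mu.
    exact: ((projectionP (u n)).2 (pu n)).1.
  + move=> _ _ [n _ <-] [k _ <-]; exists (bopf (u (n + k)%N)); split.
    * by exists (n + k)%N.
    * by apply: le_form => //; rewrite addnC umn.
    * by apply: le_form => //; rewrite umn.
  + by case: closed => _ _ _ _ L; apply: (L u).
  + by move=> _ [n _ <-]; apply: le_form.
  + move=> y My [by_ sy] hy; pose b := Bop by_.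
    have sb : b^* = b by apply: bopf_inj; rewrite -adj_star.
    apply: (op_leP pQ.1 sb).2 => v; apply: (converges_rip_le hip (uQ v)).
    exists 0%N => n _; apply: (op_leP (su n) sb).1.
    by apply: hy; exists n.
Qed.

Lemma star_alg_lift (A : set (H -> H)) : star_subalgebra ip A -> star_alg hip (lift_set A).
Proof.
case=> [[_ A0] AD AZ AM As]; split=> //.
- by move=> a b; apply: AD.
- by move=> r a; apply: AZ.
- by move=> a b; apply: AM.
- by move=> a Aa; rewrite /lift_set /= -adj_star; apply: As.
Qed.

Lemma generated_vna_eq (X : set (H -> H)) : von_neumann_algebra ip M -> X `<=` M ->
  (forall A, star_subalgebra ip A -> wot_closed ip A -> X `<=` A -> M `<=` A) ->
  generated_vna ip X = M.
Proof.
move=> [sM wM _] XM h; apply/seteqP; split=> a.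
  by apply; split.
by move=> Ma A [[sA wA] XA]; apply: h Ma.
Qed.

Lemma generated_vna_sub (X A : set (H -> H)) : generated_vna ip X = M ->
  star_subalgebra ip A -> wot_closed ip A -> X `<=` A -> M `<=` A.
Proof. by move=> <- sA wA XA a; apply; split. Qed.

Lemma gen_cost1_range (L : nat) (f : 'I_L -> H -> H) (x : H -> H) : injective f ->
  gen_cost1 tau x (range f) = \sum_l \sum_l'
    (`[< f l \o x \o f l' <> 0 >])%:R * (Re (tau (f l)) * Re (tau (f l'))).
Proof.
move=> fi; pose g (q : 'I_L * 'I_L) := (f q.1, f q.2).
pose nz (q : 'I_L * 'I_L) := `[< f q.1 \o x \o f q.2 <> 0 >].
pose s := [seq g q | q <- enum [pred q | nz q]].
rewrite /gen_cost1 (_ : [set pq | _] = [set` s]); last first.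
  apply/seteqP; split=> [[p q] /= [[l _ lp] [l' _ lq] h]|_ /mapP[q qs ->]] /=.
    apply/mapP; exists (l, l'); last by rewrite /g /= lp lq.
    by rewrite mem_enum; apply/asboolP; rewrite /= lp lq.
  by split; [exists q.1 | exists q.2 | move: qs; rewrite mem_enum => /asboolP].
rewrite -fsbig_seq; last first.
  rewrite map_inj_uniq ?enum_uniq // => -[l l'] [k k'] [/fi -> /fi ->].
  by [].
rewrite big_map big_enum_cond /= [RHS]pair_big /= big_mkcond /=.
apply: eq_bigr => q _; rewrite andbT -/(nz q) (_ : (q \in _) = nz q) //.
by case: (nz q); rewrite ?mul1r ?mul0r.
Qed.

End Link.

(** * The two cost estimates and the theorem *)

Section Main.
Context (R : realType) (H : completeNormedModType R[i])
        (ip : {dot H for Num.conj}) (hip : hilbert_inner_product ip).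
Local Notation "a ^*" := (star hip a) : ring_scope.
Local Notation proj := (proj hip).
Local Notation bopf := (@bopf R H).
Context (M : set (H -> H)) (tau : (H -> H) -> R[i]).
Context (vM : von_neumann_algebra ip M).
Local Notation t := (fun a : bop H => Re (tau (bopf a))).
Context (tf : traced_factor hip (lift_set M) t).

Let Mb : M `<=` @bounded_op R H := von_neumann_bounded vM.

Lemma trace_proj_ge0 p : M p -> projection ip p -> 0 <= Re (tau p).
Proof.
move=> Mp pp; have pp' : proj (Bop (Mb Mp)) by apply/projectionP.
exact: (tp_ge0 tf (Mp : lift_set M (Bop (Mb Mp))) pp').
Qed.

Lemma gen_cost1_ge0 P x : projection_partition ip M P -> 0 <= gen_cost1 tau x P.
Proof.
case=> _ PM _ _; apply: fsumr_ge0 => -[p q] /= [Pp Pq _].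
have [? ?] := PM _ Pp; have [? ?] := PM _ Pq.
by apply: mulr_ge0; apply: trace_proj_ge0.
Qed.

Lemma gen_cost_at_ge0 X P : projection_partition ip M P -> 0 <= gen_cost_at tau X P.
Proof. by move=> hP; apply: fsumr_ge0 => x _; apply: gen_cost1_ge0. Qed.

Lemma partition_range (L : nat) (P : 'I_L -> bop H) :
  (forall l, [/\ M (P l), proj (P l) & P l <> 0]) ->
  (forall l l', l != l' -> P l * P l' = 0) -> \sum_l P l = 1 ->
  injective (fun l => bopf (P l)) /\
  projection_partition ip M (range (fun l => bopf (P l))).
Proof.
move=> hP oP sP.
have inj : injective (fun l => bopf (P l)).
  move=> l l' /bopf_inj h; apply/eqP/negPn/negP => /oP; rewrite -h.
  by have [_ [_ ->] p0] := hP l.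
split=> //; split.
- exact: finite_image.
- by move=> _ [l _ <-]; have [Ml pl _] := hP l; split=> //; apply/projectionP.
- move=> _ _ [l _ <-] [l' _ <-] h.
  have ll : l != l' by apply/eqP => e; apply: h; rewrite e.
  exact: (congr1 bopf (oP _ _ ll)).
- by rewrite fsum_range // -bopf_sum sP.
Qed.

(** [x0] is block diagonal and costs at most the sum of the squared traces, hence at most [d]; the
    members of [P] together cost exactly that sum, which explains [2 d]. Each of the other [n]
    generators is upper triangular. *)
Lemma generator_cost_upper (n : nat) (d : R) :
  0 < d -> generated_by_selfadjoints ip M n.+1 ->
  exists X P, [/\ finite_generating_set ip M X, projection_partition ip M P
    & gen_cost_at tau X P <= 2 * d + n%:R * ((1 + d) / 2)].
Proof.
move=> d0 [x [hx gx]].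
have hb i : bounded_op (x i) by apply: Mb; case: (hx i).
pose X (i : 'I_n) := Bop (hb (lift ord0 i)); pose x0 := Bop (hb ord0).
have saE i : (Bop (hb i))^* = Bop (hb i).
  by apply: bopf_inj; rewrite -adj_star; case: (hx i) => _ [].
have Mx i : lift_set M (Bop (hb i)) by case: (hx i).
have [L [P [hP oP sP tP]]] := small_partition tf (Mx ord0) (saE ord0) d0.
have hP' l : lift_set M (P l) /\ proj (P l) by case: (hP l).
have [y [My ylow ygen]] := triangular_generators tf hP' oP sP
  (fun i => conj (Mx (lift ord0 i)) (saE (lift ord0 i))).
have [inj part] := @partition_range L P (fun l => let: And4 a b c _ := hP l in And3 a b c) oP sP.
pose PP := range (fun l => bopf (P l)).
pose s : seq (H -> H) := bopf x0 :: [seq bopf (P l) | l <- enum 'I_L]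
  ++ [seq bopf (y i) | i <- enum 'I_n].
have t_ge l : 0 <= t (P l) by apply: (tp_ge0 tf); case: (hP l).
have tb l : 0 <= t (P l) <= d by rewrite t_ge tP.
have st : \sum_l t (P l) = 1.
  by rewrite -(trace_sum tf) ?sP ?(tt1 tf) // => l; case: (hP l).
have nz (a b c : bop H) : a * b * c = 0 -> `[< bopf a \o bopf b \o bopf c <> 0 >] = false.
  by move=> h; apply/negP => /asboolP; apply; exact: (congr1 bopf h).
have diag_le (a : bop H) : (forall l l', l != l' -> P l * a * P l' = 0) ->
    gen_cost1 tau a PP <= \sum_l t (P l) * t (P l).
  move=> ha; rewrite gen_cost1_range //; apply: ler_sum => l _.
  rewrite (bigD1 l) //= big1 ?addr0 => [|l' ll]; last by rewrite nz ?mul0r // ha // eq_sym.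
  by case: asboolP => _; rewrite ?mul1r // mul0r mulr_ge0.
exists [set` s], PP; split=> //.
- split; first exact: finite_seq.
    move=> z /=; rewrite inE mem_cat => /or3P[/eqP ->|/mapP[l _ ->]|/mapP[i _ ->]].
    + exact: Mx.
    + by case: (hP l).
    + exact: My.
  apply: generated_vna_eq => //.
    move=> z /=; rewrite inE mem_cat => /or3P[/eqP ->|/mapP[l _ ->]|/mapP[i _ ->]].
    + exact: Mx.
    + by case: (hP l).
    + exact: My.
  move=> A sA wA sub; apply: (generated_vna_sub gx sA wA) => _ [i _ <-].
  have [->|[j ->]] : i = ord0 \/ exists j, i = lift ord0 j.
    by case: (unliftP ord0 i) => [j ->|->]; [right; exists j | left].
    by apply: (sub (bopf x0)) => /=; rewrite mem_head.
  apply: (ygen (lift_set A) (star_alg_lift hip sA)) => [l|k].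
    apply: (sub (bopf (P l))) => /=; rewrite inE mem_cat; apply/or3P/Or32.
    by apply: map_f; rewrite mem_enum.
  apply: (sub (bopf (y k))) => /=; rewrite inE mem_cat; apply/or3P/Or33.
  by apply: map_f; rewrite mem_enum.
- rewrite /gen_cost_at; apply: le_trans (fsum_seq_le _) _.
    by move=> z _; apply: gen_cost1_ge0.
  rewrite big_cons big_cat /= !sum_map_enum addrA.
  have sq := sum_sqr_le tb st.
  apply: lerD; first rewrite mulr_natl mulr2n.
    apply: lerD.
      apply: le_trans (diag_le x0 _) sq => l l' ll.
      have [_ _ _ c] := hP l.
      by rewrite c -mulrA oP // mulr0.
    apply: le_trans sq; apply: ler_sum => k _.
    rewrite gen_cost1_range //.
    rewrite (bigD1 k) //= [X in _ + X]big1 ?addr0 => [|l lk]; last first.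
      by rewrite big1 // => l' _; rewrite nz ?mul0r // oP ?mul0r.
    rewrite (bigD1 k) //= big1 ?addr0 => [|l lk]; last first.
      by rewrite nz ?mul0r // -mulrA [P k * P l]oP ?mulr0 // eq_sym.
    by case: asboolP => _; rewrite ?mul1r // mul0r mulr_ge0.
  rewrite -[n in n%:R](card_ord n) mulr_natl -sumr_const; apply: ler_sum => i _.
  apply: le_trans (sum_triangle_le tb st); rewrite gen_cost1_range //.
  apply: ler_sum => l _; apply: ler_sum => l' _.
  have tt : 0 <= t (P l) * t (P l') by rewrite mulr_ge0.
  case: leqP => [_|ll]; first by case: asboolP => _; rewrite ?mul1r ?mul0r.
  by rewrite nz ?mul0r // ylow.
Qed.

(** Injective enumerations of [X] and [P] turn the cost into the triple sum of [few_generators],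
    whose algebraic recovery applies to every closed star subalgebra containing the new
    generators. *)
Lemma generator_cost_lower (m : nat) X P : (0 < m)%N ->
  finite_generating_set ip M X -> projection_partition ip M P ->
  gen_cost_at tau X P < m%:R / 2 -> generated_by_selfadjoints ip M m.+1.
Proof.
move=> m0 [fX XM gX] [fP PM oP sP].
have [n [x [xi xX]]] := finite_range_inj fX.
have [L [p [pi pP]]] := finite_range_inj fP.
have Mx i : M (x i) by apply: XM; rewrite -xX; exists i.
have Pp l : P (p l) by rewrite -pP; exists l.
have Mp l : M (p l) by case: (PM _ (Pp l)).
pose x' i := Bop (Mb (Mx i)); pose p' l := Bop (Mb (Mp l)).
have hp l : lift_set M (p' l) /\ proj (p' l).
  by split; [exact: Mp | apply/projectionP; exact: (PM _ (Pp l)).2].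
have op l l' : l != l' -> p' l * p' l' = 0.
  move=> ll; apply: bopf_inj; apply: (oP _ _ (Pp l) (Pp l')) => /pi h.
  by rewrite h eqxx in ll.
have sp : \sum_l p' l = 1.
  by apply: bopf_inj; rewrite bopf_sum -[RHS]/(idfun : H -> H) -sP -pP fsum_range.
rewrite /gen_cost_at -xX fsum_range // -pP => cost.
have [|y [hy ygen]] := few_generators tf hp op sp m0 (X := x') Mx.
  apply: le_lt_trans cost; apply: ler_sum => i _; rewrite gen_cost1_range //.
  apply: ler_sum => l _; apply: ler_sum => l' _; apply: ler_wpM2r.
    have pj k := (PM _ (Pp k)).2.
    by apply: mulr_ge0; apply: trace_proj_ge0; solve [exact: Mp | exact: pj].
  case: eqVneq => [_|h]; first exact: ler0n.
  have -> : `[< p l \o x i \o p l' <> 0 >] = true by apply/asboolP => h'; case/eqP: h; apply: bopf_inj.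
  exact: lexx.
exists (fun i => bopf (y i)); split.
  move=> i; have [My sy] := hy i; split=> //; split; first exact: bopP.
  by rewrite (adj_star hip) sy.
apply: generated_vna_eq => // [_ [i _ <-]|A sA wA sub]; first by case: (hy i).
apply: (generated_vna_sub gX sA wA) => z; rewrite -xX => -[i _ <-].
apply: (ygen (lift_set A) (star_alg_lift hip sA)) => k.
by apply: sub; exists k.
Qed.

End Main.

Theorem corollary5p7 (R : realType) (H : completeNormedModType R[i])
    (ip : {dot H for Num.conj}) (M : set (H -> H)) (tau : (H -> H) -> R[i])
    (n : nat) :
  hilbert_inner_product ip ->
  type_II1_factor ip M ->
  faithful_normal_trace ip M tau ->
  finitely_generated ip M ->
  min_selfadjoint_generators ip M n ->
  ((n%:R - 1)%:E <= 2%:E * generator_invariant ip M tau + 1)%E /\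
  (2%:E * generator_invariant ip M tau + 1 <= n%:R%:E)%E.
Proof.
move=> hip II1 tr fg [gn min_n].
have [[vM id0 _] _ _] := II1.
have tf := traced_factor_lift hip II1 tr.
have G_ge0 X P : projection_partition ip M P -> 0 <= gen_cost_at tau X P.
  exact: (gen_cost_at_ge0 vM tf).
(* The empty family generates only [0], which does not contain the nonzero [idfun]. *)
have [n' en] : exists n', n = n'.+1.
  case: n gn {min_n} => [[x [_ gx]]|n' _]; last by exists n'.
  have vM1 : M idfun by case: vM.
  case: id0; have sZ : star_subalgebra ip [set (0 : H -> H)].
    have a0 : adj ip (0 : H -> H) = 0.
      by rewrite (adj_star hip (0 : bop H)) star0.
    split=> //.
    - by split=> // _ ->; apply: bounded_op0.
    - by move=> _ _ -> ->; rewrite /= addr0.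
    - by move=> c _ ->; rewrite /= scaler0.
    - by move=> _ _ -> ->.
    - by move=> _ ->.
  have sub : M `<=` [set (0 : H -> H)].
    (* Weak closedness of the zero set: testing at [(v, a v)] with tolerance [ip (a v) (a v)]
       separates [a] from [0] when [a v] is nonzero. *)
    apply: (generated_vna_sub gx sZ) => [a _ ha|_ [[]] //].
    apply/funext => v; apply: contrapT => /eqP av0.
    have p0 : 0 < ip (a v) (a v) by apply: neq0_dnorm_gt0.
    have [_ -> /(_ (v, a v))] := ha [:: (v, a v)] _ p0.
    by rewrite inE eqxx subr0 /= gtr0_norm // ltxx => /(_ isT).
  exact: sub _ vM1.
subst n.
(* The trivial partition ensures that the infimum over partitions is not taken over the empty
   set. *)
have part1 : projection_partition ip M [set idfun].
  split=> //; last by rewrite fsbig_set1.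
    move=> _ ->; split; first by case: vM.
    exact: (projectionP hip 1).2 (proj_one hip).
  by move=> p q -> ->.
have cost0 X : has_lbound [set gen_cost_at tau X P | P in projection_partition ip M].
  by exists 0 => _ [P hP <-]; apply: G_ge0.
split.
(* A cost below [(n' - 1) / 2] would give [n'] hermitian generators, one fewer than the minimum. For
   [n' <= 1] the bound is nonpositive, and costs are nonnegative. *)
- have low : (((n'%:R - 1) / 2)%:E <= generator_invariant ip M tau)%E.
    apply: le_ereal_inf_tmp => _ [X gX <-]; rewrite lee_fin; apply: lb_le_inf.
      by exists (gen_cost_at tau X [set idfun]), [set idfun].
    move=> _ [P hP <-]; rewrite leNgt; apply/negP => lt.
    case: n' gn min_n lt => [|m] gn min_n lt.
      by have := G_ge0 X P hP; lra.
    rewrite -natr1 addrK in lt.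
    have [m0|m0] := posnP m; first by have := G_ge0 X P hP; rewrite m0 in lt; lra.
    by have := min_n _ (generator_cost_lower vM tf m0 gX hP lt); rewrite ltnn.
  case: (generator_invariant ip M tau) low => [r low|_|low].
  - by rewrite lee_fin in low; rewrite -EFinM -EFinD lee_fin -natr1; lra.
  - by rewrite gt0_muley ?lte_fin // addye // leey.
  - by rewrite leeNy_eq in low.
- have up : (generator_invariant ip M tau <= (n'%:R / 2)%:E)%E.
    apply/lee_addgt0Pr => e e0.
    (* With [d = e / (2 + n' / 2)] the excess [2 d + n' d / 2] of the cost over [n' / 2] is exactly
       [e]. *)
    have c0 : 0 < 2 + n'%:R / 2 :> R by have := ler0n R n'; lra.
    have [X [P [gX hP hc]]] := generator_cost_upper vM tf (divr_gt0 e0 c0) gn.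
    apply: (@le_trans _ _ (gen_cost ip M tau X)%:E).
      by apply: ereal_inf_lbound; exists X.
    rewrite -EFinD lee_fin; apply: (@le_trans _ _ (gen_cost_at tau X P)).
      by apply: ge_inf => //; exists P.
    apply: le_trans hc _; set d := e / _.
    have : d * (2 + n'%:R / 2) = e by rewrite divfK // gt_eqF.
    nra.
  case: (generator_invariant ip M tau) up => [r up|up|_].
  - by rewrite lee_fin in up; rewrite -EFinM -EFinD lee_fin -natr1; lra.
  - by rewrite leye_eq in up.
  - by rewrite gt0_muleNy ?lte_fin // addNye leNye.
Qed.
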